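(* Let $\Omega\subset\mathbb{R}^n$, $n\in\{1,2,3\}$, be a bounded domain that is regular in the sense of Gröger, let $f\in L^2(\Omega)$, and let $q_{\min},q_{\max},\psi\in\mathbb{R}$ with $0<q_{\min}<q_{\max}$ and $\psi>0$. Set $Q=L^2(\Omega;\mathbb{R}^{n\times n}_{\mathrm{sym}})$, $$Q^{\mathrm{ad}}=\{q\in Q : q_{\min}I\preccurlyeq q(x)\preccurlyeq q_{\max}I \text{ for a.e. } x\in\Omega\},\qquad K=\{u\in H_0^1(\Omega): u\le\psi\},$$ and let $S\colon Q^{\mathrm{ad}}\to H_0^1(\Omega)$ map $q$ to the unique $u\in K$ satisfying $(q\nabla u,\nabla(v-u))\ge(f,v-u)$ for all $v\in K$. Then $S$ is directionally differentiable at every $q\in Q^{\mathrm{ad}}$: for every direction $d\in Q$ with $q+d\in Q^{\mathrm{ad}}$ the limit $$S'(q;d)=\lim_{t\downarrow 0}\frac{S(q+td)-S(q)}{t}$$ exists in $H_0^1(\Omega)$. Moreover, with $u=S(q)$ and $\lambda=\nabla\cdot(q\nabla u)+f$, the derivative $\tilde u=S'(q;d)$ is the unique solution of the variational inequality $$\tilde u\in\mathcal{K}(q),\qquad (q\nabla\tilde u,\nabla(\varphi-\tilde u))\ge\langle\nabla\cdot(d\nabla u),\varphi-\tilde u\rangle\quad\forall\varphi\in\mathcal{K}(q),$$ where $$\mathcal{K}(q)=\{\varphi\in H_0^1(\Omega): \varphi\le 0\ \text{q.e. on } \{u=\psi\}\ \text{and}\ \varphi=0\ \text{q.e. on } \o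peratorname{q-supp}(\lambda)\}.$$
   Context: $(\cdot,\cdot)$ denotes the $L^2(\Omega)$ inner product for scalar-, vector- and matrix-valued functions; $\langle\cdot,\cdot\rangle$ is the duality pairing of $H^{-1}(\Omega)$ and $H_0^1(\Omega)$, and $\langle\nabla\cdot(d\nabla u),w\rangle=-(d\nabla u,\nabla w)$. $\mathbb{R}^{n\times n}_{\mathrm{sym}}$ is the space of symmetric matrices, $I$ the identity, and $A\preccurlyeq B$ means that $B-A$ is positive semidefinite. Gröger regularity (with homogeneous Dirichlet condition on all of $\partial\Omega$): every $x\in\partial\Omega$ has an open neighbourhood $V$ and a bi-Lipschitz map $\Phi$ from $V$ onto an open subset of $\mathbb{R}^n$ with $\Phi(x)=0$ and $\Phi(V\cap\Omega)=\{y\in\mathbb{R}^n:|y|<1,\ y_n<0\}$. ''q.e.'' (quasi-everywhere) means up to a set of zero $H_0^1(\Omega)$-capacity; elements of $H_0^1(\Omega)$ are identified with their quasi-continuous representatives, so that the set $\{u=\psi\}$ is defined up to a set of capacity zero. The multiplier $\lambda=\nabla\cdot(q\nabla u)+f$ belongs to $L^2(\Omega)$ and satisfies $\lambda\ge0$ a.e.; it is identified with the measure $\lambda\,\mathrm{d}x$. Its quasi-support $\operatorname{q-supp}(\lambda)$ is the smallest (up to sets of capacity zero) quasi-closed set $A\subset\Omega$ with $\lambda(\Omega\setminus A)=0$. *)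

(* Defs.v *)
From HB Require Import structures.
From mathcomp Require Import all_boot all_order all_algebra.
From mathcomp Require Import all_classical all_reals all_analysis.

Set Implicit Arguments.
Unset Strict Implicit.
Unset Printing Implicit Defensive.
Import Order.TTheory GRing.Theory Num.Theory.
Import numFieldNormedType.Exports.

Local Open Scope classical_set_scope.
Local Open Scope ring_scope.

(* R^n is 'rV[R]_m.+1 with n = m.+1.  Lebesgue measure on R^n is the Caratheodory
   measure of the outer measure given by countable coverings by open boxes; the
   measurable sets are the Lebesgue measurable ones. *)
Section lebesgue_outer_measure.
Context {R : realType} {m : nat}.
Local Notation E := 'rV[R]_m.+1.

Definition open_box (c : E * E) : set E :=
  [set x | forall i, c.1 0 i < x 0 i < c.2 0 i].

Definition box_volume (c : E * E) : \bar R :=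
  (\prod_i Num.max (c.2 0 i - c.1 0 i) 0)%:E.

Definition leb_outer (X : set E) : \bar R :=
  ereal_inf [set (\sum_(k <oo) box_volume (c k))%E |
             c in [set c : nat -> E * E | X `<=` \bigcup_k open_box (c k)]].

Local Open Scope ereal_scope.

Lemma box_volume_ge0 c : 0 <= box_volume c.
Proof.
rewrite lee_fin; apply: prodr_ge0 => i _.
by rewrite le_max lexx orbT.
Qed.

Lemma leb_outer_ge0 X : 0 <= leb_outer X.
Proof.
apply: le_ereal_inf_tmp => _ [c _ <-].
by apply: nneseries_ge0 => k _ _; exact: box_volume_ge0.
Qed.

Lemma le_leb_outer : {homo leb_outer : X Y / X `<=` Y >-> X <= Y}.
Proof.
move=> X Y XY; apply/ereal_inf_le_tmp => x [c Yc <-].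
by exists c => //; exact: subset_trans XY Yc.
Qed.

Lemma leb_outer0 : leb_outer set0 = 0.
Proof.
apply/eqP; rewrite eq_le leb_outer_ge0 andbT.
apply: ereal_inf_lbound; exists (fun=> (0%R, 0%R)); first by [].
apply: eseries0 => k _ _ /=; rewrite /box_volume /= big_ord_recl.
by rewrite subrr maxxx mul0r.
Qed.

Lemma leb_outer_sigma_subadditive : sigma_subadditive leb_outer.
Proof.
move=> A; have [[i ioo]|] := pselect (exists i, leb_outer (A i) = +oo).
  rewrite (eseries_pinfty _ _ ioo) ?leey// => n _.
  by rewrite -ltNye (lt_le_trans _ (leb_outer_ge0 _)).
rewrite -forallNE => Aoo.
suff add2e (e : {posnum R}) :
    leb_outer (\bigcup_n A n) <= \sum_(i <oo) leb_outer (A i) + e%:num%:E.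
  by apply/lee_addgt0Pr => _/posnumP[].
rewrite (le_trans _ (epsilon_trick _ _ _))//; last first.
  by move=> n; exact: leb_outer_ge0.
pose P n (c : nat -> E * E) := A n `<=` \bigcup_k open_box (c k) /\
  \sum_(k <oo) box_volume (c k)
    <= leb_outer (A n) + (e%:num / (2 ^ n.+1)%:R)%:E.
have [G PG] : {G : nat -> nat -> E * E & forall n, P n (G n)}.
  apply: (@choice _ _ P) => n; rewrite /P /leb_outer.
  set S := (X in ereal_inf X); move infS : (ereal_inf S) => iS.
  case: iS infS => [r Sr|Soo|Soo].
  - have en1 : (0 < e%:num / (2 ^ n.+1)%:R)%R by [].
    have /(lb_ereal_inf_adherent en1) : ereal_inf S \is a fin_num by rewrite Sr.
    move=> [x [c Ac cx] xS].
    by exists c; split => //; rewrite cx -Sr; exact/ltW.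
  - by have := Aoo n; rewrite /leb_outer Soo.
  - suff : lbound S 0 by move/le_ereal_inf_tmp; rewrite Soo.
    move=> /= _ [c _ <-].
    by apply: nneseries_ge0 => k _ _; exact: box_volume_ge0.
pose vol := box_volume \o uncurry G.
have vol_ge0 x : 0 <= vol x by exact: box_volume_ge0.
apply: (@le_trans _ _ (\esum_(i in setT) vol i)).
  apply: ereal_inf_lbound => /=.
  have /card_esym/ppcard_eqP[g] := card_nat2.
  exists (uncurry G \o g).
    move=> t [i _] /(PG i).1 [j _ Gijt].
    by exists (g^-1%FUN (i, j)) => //=; rewrite invK ?inE.
  rewrite -(esum_pred_image vol _ xpredT) ?[fun=> _]set_true//.
  by rewrite image_eq.
rewrite (_ : esum _ _ = \sum_(i <oo) \sum_(j <oo) box_volume (G i j)); last first.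
  pose J : nat -> set (nat * nat) := fun i => [set (i, j) | j in setT].
  rewrite (_ : setT = \bigcup_k J k); last first.
    by rewrite predeqE => -[a b]; split => // _; exists a => //; exists b.
  rewrite esum_bigcupT /=; last 2 first.
  - apply/trivIsetP => i j _ _ ij.
    rewrite predeqE => -[n k] /=; split => //= -[] [_] _ [<-{n} _].
    by move=> [k' _] [] /esym/eqP; rewrite (negbTE ij).
  - by move=> x; exact: vol_ge0.
  rewrite -(image_id [set: nat]) -fun_true esum_pred_image//; last first.
    by move=> n _; exact: esum_ge0.
  apply: eq_eseriesr => /= j _.
  rewrite -(esum_pred_image vol (pair j) predT)//=; last first.
    by move=> ? ? _ _; exact: (@can_inj _ _ _ snd).
  by congr esum; rewrite predeqE => -[a b]; split; move=> [i _ <-]; exists i.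
apply: lee_lim.
- apply: is_cvg_nneseries => n *.
  by apply: nneseries_ge0 => k *; exact: (vol_ge0 (n, k)).
- by apply: is_cvg_nneseries => n *; apply: adde_ge0 => //; exact: leb_outer_ge0.
- by near=> n; apply: lee_sum => i _; exact: (PG i).2.
Unshelve. all: by end_near. Qed.

HB.instance Definition _ := isOuterMeasure.Build R E leb_outer
  leb_outer0 leb_outer_ge0 le_leb_outer leb_outer_sigma_subadditive.

End lebesgue_outer_measure.

Section lebesgue_measure_rV.
Context (R : realType) (m : nat).
Local Notation E := 'rV[R]_m.+1.
Local Notation mu := (@leb_outer R m).

HB.instance Definition _ := @isMeasurable.Build (caratheodory_display mu)
  E mu.-caratheodory
  (caratheodory_measurable_set0 mu)
  (@caratheodory_measurable_setC _ _ mu)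
  (@caratheodory_measurable_bigcup _ _ mu).

Definition leb (A : set E) : \bar R := mu A.

HB.instance Definition _ := isMeasure.Build _ E R leb
  (@caratheodory_measure0 R E mu) (@caratheodory_measure_ge0 R E mu)
  (@caratheodory_measure_sigma_additive R E mu).

End lebesgue_measure_rV.
Arguments leb {R m} A.

Section obstacle_problem.
Context {R : realType} {m : nat}.
Local Notation E := 'rV[R]_m.+1.
Local Notation Mat := 'M[R]_m.+1.
Implicit Types (Omega A B G O K V : set E) (u v w phi f lam : E -> R).

(* The library norm on 'rV is the sup norm, hence the explicit |.| here. *)
Definition dot (a b : E) : R := \sum_i a 0 i * b 0 i.
Definition enorm (a : E) : R := Num.sqrt (dot a a).

Definition bounded_domain Omega : Prop :=
  [/\ Omega !=set0, open Omega, connected Omega & bounded_set Omega].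

Definition half_ball : set E := [set y | enorm y < 1 /\ y 0 ord_max < 0].

Definition bi_lipschitz_on V (Phi : E -> E) : Prop :=
  exists L : R, forall y z, V y -> V z ->
    enorm (Phi y - Phi z) <= L * enorm (y - z) /\
    enorm (y - z) <= L * enorm (Phi y - Phi z).

Definition groger_regular Omega : Prop :=
  forall x, (closure Omega `\` interior Omega) x ->
  exists (V : set E) (Phi : E -> E),
    [/\ open V /\ V x, bi_lipschitz_on V Phi, open (Phi @` V), Phi x = 0
      & Phi @` (V `&` Omega) = half_ball].

(* Functions on Omega are total functions on R^n whose values outside Omega are
   irrelevant.  Elements of L^2(Omega) and H^1_0(Omega) are represented by
   functions, equality in these spaces being equality a.e. in Omega. *)
Definition ae_in Omega (P : E -> Prop) : Prop :=
  {ae leb, forall x, Omega x -> P x}.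

Definition L2 Omega u : Prop := (u \_ Omega) \in Lfun leb 2%:E.

Definition innerL2 Omega u v : R := \int[leb]_(x in Omega) (u x * v x).

Definition innerL2_vec Omega (F G : E -> E) : R :=
  \int[leb]_(x in Omega) dot (F x) (G x).

Definition basis_vec (i : 'I_m.+1) : E := delta_mx 0 i.

Definition partial (i : 'I_m.+1) phi : E -> R := 'D_(basis_vec i) phi.

Definition iter_partial (s : seq 'I_m.+1) phi : E -> R := foldr partial phi s.

Definition smooth phi : Prop := forall s : seq 'I_m.+1,
  continuous (iter_partial s phi) /\
  forall i x, derivable (iter_partial s phi) x (basis_vec i).

Definition test_function Omega phi : Prop :=
  smooth phi /\
  exists K, [/\ compact K, K `<=` Omega & forall x, ~ K x -> phi x = 0].

Definition is_weak_grad Omega u (g : E -> E) : Prop :=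
  forall i, L2 Omega (fun x => g x 0 i) /\
    forall phi, test_function Omega phi ->
      innerL2 Omega u (partial i phi) = - innerL2 Omega (fun x => g x 0 i) phi.

Definition H1 Omega u : Prop := L2 Omega u /\ exists g, is_weak_grad Omega u g.

(* A representative of the weak gradient, which is unique a.e. in Omega. *)
Definition wgrad Omega u : E -> E := xget (cst 0) [set g | is_weak_grad Omega u g].

Definition H1_norm Omega u : R :=
  Num.sqrt (innerL2 Omega u u + innerL2_vec Omega (wgrad Omega u) (wgrad Omega u)).

Definition H10 Omega u : Prop :=
  H1 Omega u /\
  forall e : R, 0 < e -> exists phi,
    test_function Omega phi /\ H1_norm Omega (u - phi) < e.

Definition psd (M : Mat) : Prop := forall a : E, 0 <= (a *m M *m a^T) 0 0.

Definition loewner_le (M N : Mat) : Prop := psd (N - M).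

Definition Qspace Omega (q : E -> Mat) : Prop :=
  (forall i j, L2 Omega (fun x => q x i j)) /\
  ae_in Omega (fun x => (q x)^T = q x).

Definition Qad Omega (qmin qmax : R) (q : E -> Mat) : Prop :=
  Qspace Omega q /\
  ae_in Omega (fun x => loewner_le qmin%:M (q x) /\ loewner_le (q x) qmax%:M).

(* (q grad u, grad w); gradients are row vectors. *)
Definition diffusion_form Omega (q : E -> Mat) u w : R :=
  innerL2_vec Omega (fun x => wgrad Omega u x *m (q x)^T) (wgrad Omega w).

(* <div (d grad u), w> *)
Definition div_pairing Omega (d : E -> Mat) u w : R := - diffusion_form Omega d u w.

Definition obstacle_set Omega (psi : R) u : Prop :=
  H10 Omega u /\ ae_in Omega (fun x => u x <= psi).

Definition obstacle_solution Omega f (psi : R) (q : E -> Mat) u : Prop :=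
  obstacle_set Omega psi u /\
  forall v, obstacle_set Omega psi v ->
    diffusion_form Omega q u (v - u) >= innerL2 Omega f (v - u).

(* For q in Qad the solution exists and is unique as an element of H^1_0(Omega),
   so the default value of xget plays no role (likewise below). *)
Definition solution_map Omega f (psi : R) (q : E -> Mat) : E -> R :=
  xget (cst 0) [set u | obstacle_solution Omega f psi q u].

Definition is_multiplier Omega f (q : E -> Mat) u lam : Prop :=
  L2 Omega lam /\
  forall w, H10 Omega w ->
    innerL2 Omega lam w = div_pairing Omega q u w + innerL2 Omega f w.

(* The L^2 density of div (q grad u) + f, unique a.e. in Omega. *)
Definition multiplier Omega f (q : E -> Mat) u : E -> R :=
  xget (cst 0) [set lam | is_multiplier Omega f q u lam].

Definition capacity Omega A : \bar R :=
  ereal_inf [set (innerL2_vec Omega (wgrad Omega v) (wgrad Omega v))%:E |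
    v in [set v | H10 Omega v /\
      exists O, [/\ open O, A `<=` O, O `<=` Omega
                  & ae_in O (fun x => 1 <= v x)]]].

Definition qe_on Omega A (P : E -> Prop) : Prop :=
  capacity Omega [set x | [/\ Omega x, A x & ~ P x]] = 0%E.

Definition quasi_open Omega O : Prop :=
  O `<=` Omega /\
  forall e : R, 0 < e -> exists G,
    [/\ open G, G `<=` Omega, (capacity Omega G < e%:E)%E & open (O `|` G)].

Definition quasi_closed Omega A : Prop :=
  A `<=` Omega /\ quasi_open Omega (Omega `\` A).

Definition quasi_continuous Omega v : Prop :=
  forall e : R, 0 < e -> exists G,
    [/\ open G, G `<=` Omega, (capacity Omega G < e%:E)%E
      & {within Omega `\` G, continuous v}].

(* The quasi-continuous representative, which exists for v in H^1_0(Omega) and is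
   unique up to sets of capacity zero. *)
Definition qc_rep Omega v : E -> R :=
  xget v [set w | quasi_continuous Omega w /\ ae_in Omega (fun x => w x = v x)].

(* The measure lam dx. *)
Definition density_measure lam A : \bar R := (\int[leb]_(x in A) (lam x)%:E)%E.

Definition is_q_supp Omega lam A : Prop :=
  [/\ quasi_closed Omega A, density_measure lam (Omega `\` A) = 0%E
    & forall B, quasi_closed Omega B ->
        density_measure lam (Omega `\` B) = 0%E ->
        capacity Omega (A `\` B) = 0%E].

Definition q_supp Omega lam : set E := xget set0 [set A | is_q_supp Omega lam A].

Definition critical_cone Omega f (psi : R) (q : E -> Mat) phi : Prop :=
  let u := solution_map Omega f psi q in
  let lam := multiplier Omega f q u in
  [/\ H10 Omega phi,
      qe_on Omega [set x | qc_rep Omega u x = psi]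
        (fun x => qc_rep Omega phi x <= 0)
    & qe_on Omega (q_supp Omega lam) (fun x => qc_rep Omega phi x = 0)].

Definition is_dir_derivative Omega f (psi : R) (q d : E -> Mat) w : Prop :=
  H10 Omega w /\
  H1_norm Omega
    (t^-1 *: (solution_map Omega f psi (q + t *: d) - solution_map Omega f psi q) - w) @[t --> 0^'+]
  --> (0 : R).

Definition linearized_solution Omega f (psi : R) (q d : E -> Mat) w : Prop :=
  critical_cone Omega f psi q w /\
  forall phi, critical_cone Omega f psi q phi ->
    diffusion_form Omega q w (phi - w)
      >= div_pairing Omega d (solution_map Omega f psi q) (phi - w).

End obstacle_problem.

(* Main.v *)
(* Write [a] and [b] for the forms [(q grad ., grad .)] and [(d grad ., grad .)],
   and [u = S(q)].  The Lewy-Stampacchia estimate bounds the residual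
   [(f, .) - a(u, .)] in the L^2 norm, so that it has a density [lam >= 0], and
   [lam (psi - u) = 0].  A function in H^1_0 vanishes q.e. on the quasi-support of
   [lam] iff its product with [lam] vanishes a.e.; together with a truncation
   argument this shows that the critical cone is the closure of the functions
   [phi] with [lam phi = 0] and [phi <= c (psi - u)] for some [c].

   Such a [phi] is admissible in the variational inequality of the difference
   quotient [dl = (S(q + t d) - u) / t] as soon as [t c <= 1], which gives
   [a(dl, phi - dl) + b(u, phi - dl) + t b(dl, phi - dl) >= 0] and bounds [dl].
   With [w] the solution of the linearized problem and [l = a(w, .) + b(u, .)],
   which is nonnegative on the cone and vanishes at [w], it follows that
   [a(dl - w, dl - w)] is at most [- l(dl)] plus terms that are small for [phi]
   close to [w] and [t] small.  Finally [liminf l(dl) >= 0], since weak limits of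
   difference quotients lie in the cone. *)

Require Import Defs.
From HB Require Import structures.
From mathcomp Require Import all_boot all_order all_algebra.
From mathcomp Require Import all_classical all_reals all_analysis.
From mathcomp Require Import measurable_realfun ring lra.

Set Implicit Arguments.
Unset Strict Implicit.
Unset Printing Implicit Defensive.
Import Order.TTheory GRing.Theory Num.Theory.
Import numFieldNormedType.Exports.

Local Open Scope classical_set_scope.
Local Open Scope ring_scope.

(** * Semi-inner products and variational inequalities *)

Section semi_inner.
Context {R : realType} {X : lmodType R}.
Implicit Types (V K : set X) (a : X -> X -> R) (F : X -> R).

(** Elements of the spaces are plain functions, so the forms are only semidefinite: the Hilbert
    space arguments are carried out for a seminorm on a subspace, and limits are determined up to
    seminorm zero. No weak topology is used; almost minimal elements of nested convex sets give
    strongly convergent substitutes for weak limits.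

    The residual must have an L^2 density so that the condition on the quasi-support becomes the
    a.e. equation [lam phi = 0], which survives limits and truncations. The return from a.e. to q.e.
    rests on quasi-continuity: an a.e. inequality between quasi-continuous functions holds q.e.

    Limits of difference quotients lie in the cone because three convex closed constraints persist:
    [lam dl <= 0] a.e., [- (lam, dl) <= t M], and [dl <= 0] q.e. on the contact set. The first
    follows from complementarity. The second comes from keeping [(lam, dl)] in the variational
    inequality, where it is one order in [t] larger than the other terms. In the limit [lam y <= 0]
    has a nonnegative integral, hence [lam y = 0]. In the final estimate [phi] and its constant [c]
    are fixed before [t] is taken small. *)

Definition subspace V := V 0 /\ forall c u v, V u -> V v -> V (c *: u + v).

(** Nothing is required outside [V], where integrals may take default values, and no definiteness,
    since functions that vanish a.e. have seminorm zero. *)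
Record semi_inner V a : Prop := SemiInner {
  si_sub : subspace V ;
  si_sym : forall u v, V u -> V v -> a u v = a v u ;
  si_lin : forall c u v w, V u -> V v -> V w ->
    a (c *: u + v) w = c * a u w + a v w ;
  si_pos : forall u, V u -> 0 <= a u u }.

Definition linear_on V F := forall c u v, V u -> V v -> F (c *: u + v) = c * F u + F v.

(** Cauchy sequences and limits are expressed with the square of the seminorm, which keeps square
    roots out of the estimates. *)
Definition form_cauchy a (v : nat -> X) := forall e : R, 0 < e ->
  exists N, forall n k, (N <= n)%N -> (N <= k)%N -> a (v n - v k) (v n - v k) < e.

Definition form_cvg a (v : nat -> X) u := forall e : R, 0 < e ->
  exists N, forall n, (N <= n)%N -> a (v n - u) (v n - u) < e.

Definition form_complete V a := forall v, (forall n, V (v n)) -> form_cauchy a v ->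
  exists2 u, V u & form_cvg a v u.

Definition form_closed V a K := forall v u, (forall n, K (v n)) -> V u ->
  form_cvg a v u -> K u.

Definition convex_on K := forall s u v, 0 <= s -> s <= 1 -> K u -> K v ->
  K (s *: u + (1 - s) *: v).

Section subspace_theory.
Context {V} (sV : subspace V).
Lemma sub0 : V 0. Proof. exact: sV.1. Qed.
Lemma subZ c u : V u -> V (c *: u).
Proof. by move=> Vu; rewrite -[c *: u]addr0; apply: sV.2 => //; exact: sub0. Qed.
Lemma subD u v : V u -> V v -> V (u + v).
Proof. by move=> Vu Vv; rewrite -[u]scale1r; apply: sV.2. Qed.
Lemma subN u : V u -> V (- u).
Proof. by move=> Vu; rewrite -scaleN1r; exact: subZ. Qed.
Lemma subB u v : V u -> V v -> V (u - v).
Proof. by move=> Vu Vv; apply: subD => //; exact: subN. Qed.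
Lemma sub_conv s u v : V u -> V v -> V (s *: u + (1 - s) *: v).
Proof. by move=> Vu Vv; apply: subD; exact: subZ. Qed.

Context {F} (lF : linear_on V F).
Lemma lin0 : F 0 = 0.
Proof. by have := lF 1 sub0 sub0; rewrite scaler0 addr0 => h; lra. Qed.
Lemma linZ c u : V u -> F (c *: u) = c * F u.
Proof. by move=> Vu; rewrite -[c *: u]addr0 lF ?lin0 ?addr0//; exact: sub0. Qed.
Lemma linD u v : V u -> V v -> F (u + v) = F u + F v.
Proof. by move=> Vu Vv; rewrite -[u in LHS]scale1r lF// mul1r. Qed.
Lemma linN u : V u -> F (- u) = - F u.
Proof. by move=> Vu; rewrite -scaleN1r linZ// mulN1r. Qed.
Lemma linB u v : V u -> V v -> F (u - v) = F u - F v.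
Proof. by move=> Vu Vv; rewrite linD// ?linN//; exact: subN. Qed.
End subspace_theory.

Section form_theory.
Context {V a} (sa : semi_inner V a).
Let sV := si_sub sa.

Lemma linear_formr w : V w -> linear_on V (a w).
Proof.
move=> Vw c u v Vu Vv; rewrite (si_sym sa)//; last exact: sV.2.
by rewrite (si_lin sa)// !(si_sym sa Vw).
Qed.

Lemma linear_forml w : V w -> linear_on V (a^~ w).
Proof. by move=> Vw c u v Vu Vv; rewrite (si_lin sa). Qed.

Lemma formD2 u v : V u -> V v -> a (u + v) (u + v) = a u u + 2 * a u v + a v v.
Proof.
move=> Vu Vv; have Vuv := subD sV Vu Vv.
rewrite (linD (linear_formr Vuv))// !(linD (linear_forml _))//.
by rewrite (si_sym sa Vv Vu); ring.
Qed.

Lemma formB2 u v : V u -> V v -> a (u - v) (u - v) = a u u - 2 * a u v + a v v.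
Proof.
move=> Vu Vv; have VNv := subN sV Vv; rewrite formD2//.
rewrite (linN sV (linear_formr Vu))// (linN sV (linear_formr VNv))//.
by rewrite (linN sV (linear_forml Vv))//; ring.
Qed.

Lemma formZ2 c u : V u -> a (c *: u) (c *: u) = c ^+ 2 * a u u.
Proof.
move=> Vu; have Vcu := subZ sV c Vu.
by rewrite (linZ sV (linear_formr Vcu))// (linZ sV (linear_forml Vu))//; ring.
Qed.

Lemma formN2 u : V u -> a (- u) (- u) = a u u.
Proof. by move=> Vu; rewrite -scaleN1r formZ2// sqrrN expr1n mul1r. Qed.

Lemma formB_sym u v : V u -> V v -> a (u - v) (u - v) = a (v - u) (v - u).
Proof. by move=> Vu Vv; rewrite -(opprB v u) formN2//; exact: subB. Qed.

Lemma form_CS u v : V u -> V v -> a u v ^+ 2 <= a u u * a v v.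
Proof.
move=> Vu Vv.
have P s : 0 <= a u u + 2 * s * a u v + s ^+ 2 * a v v.
  have Vsv := subZ sV s Vv.
  have := si_pos sa (subD sV Vu Vsv).
  by rewrite formD2// formZ2// (linZ sV (linear_formr Vu))// mulrA.
have [v0|v0] := eqVneq (a v v) 0.
  have [->|uv0] := eqVneq (a u v) 0; first by rewrite v0 mulr0 expr0n.
  (* With [a v v = 0] the polynomial in [P] is affine in [s]; at this [s] it would take the value
     [-1]. *)
  have := P (- (a u u + 1) / (2 * a u v)).
  rewrite v0 mulr0 addr0.
  have -> : 2 * (- (a u u + 1) / (2 * a u v)) * a u v = - (a u u + 1) by field.
  by move=> h; exfalso; lra.
have vp : 0 < a v v by rewrite lt_neqAle eq_sym v0 (si_pos sa).
have := P (- a u v / a v v).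
have -> : a u u + 2 * (- a u v / a v v) * a u v + (- a u v / a v v) ^+ 2 * a v v
  = a u u - a u v ^+ 2 / a v v by field.
by rewrite subr_ge0 ler_pdivrMr.
Qed.

(** Young's inequality: the difference of the squares of both sides is a square plus four times the
    Cauchy-Schwarz defect. *)
Lemma form_le_mean (e : R) u v : V u -> V v -> 0 < e ->
  2 * `|a u v| <= e * a u u + e^-1 * a v v.
Proof.
move=> Vu Vv e0; have h := form_CS Vu Vv.
have u0 := si_pos sa Vu; have v0 := si_pos sa Vv.
rewrite -(@ler_pXn2r _ 2) ?nnegrE//; last by rewrite addr_ge0// mulr_ge0// ?invr_ge0 ltW.
rewrite exprMn real_normK ?num_real//.
rewrite -subr_ge0.
have -> : (e * a u u + e^-1 * a v v) ^+ 2 - 2 ^+ 2 * a u v ^+ 2 =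
  (e * a u u - e^-1 * a v v) ^+ 2 + 4 * (a u u * a v v - a u v ^+ 2).
  by field; rewrite gt_eqF.
by rewrite addr_ge0 ?sqr_ge0// mulr_ge0// subr_ge0.
Qed.

Lemma formD2_le u v : V u -> V v -> a (u + v) (u + v) <= 2 * a u u + 2 * a v v.
Proof.
move=> Vu Vv; rewrite formD2//.
have := form_le_mean Vu Vv ltr01; have := ler_norm (a u v).
by rewrite invr1 !mul1r; lra.
Qed.

Lemma form_norm_triangle u v : V u -> V v ->
  Num.sqrt (a (u + v) (u + v)) <= Num.sqrt (a u u) + Num.sqrt (a v v).
Proof.
move=> Vu Vv; have u0 := si_pos sa Vu; have v0 := si_pos sa Vv.
rewrite -(@ler_pXn2r _ 2) ?nnegrE ?addr_ge0 ?sqrtr_ge0//.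
rewrite sqr_sqrtr; last by apply: (si_pos sa); apply: (subD sV).
rewrite sqrrD !sqr_sqrtr// formD2// -sqrtrM// lerD2r lerD2l mulr_natl ler_pMn2r//.
rewrite (le_trans (ler_norm _))// -sqrtr_sqr.
by rewrite ler_sqrt ?mulr_ge0// form_CS.
Qed.

Lemma form_cvgr (v : nat -> X) u w : (forall n, V (v n)) -> V u -> V w ->
  form_cvg a v u -> a w (v n) @[n --> \oo] --> a w u.
Proof.
move=> Vv Vu Vw vu; apply/cvgrPdist_lt => e e0.
have p0 : 0 < a w w + 1 by have := si_pos sa Vw; lra.
have [N HN] := vu (e ^+ 2 / (a w w + 1)) (divr_gt0 (exprn_gt0 2 e0) p0).
exists N => // n /= /HN {}HN.
have Vd := subB sV (Vv n) Vu.
rewrite -(linB sV (linear_formr Vw))// -opprB (linN sV (linear_formr Vw))// normrN.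
rewrite -(@ltr_pXn2r _ 2) ?nnegrE// ?(ltW e0)// real_normK ?num_real//.
apply: le_lt_trans (form_CS Vw Vd) _.
rewrite ltr_pdivlMr// in HN; apply: le_lt_trans HN.
by rewrite mulrC ler_wpM2l ?(si_pos sa)// lerDl.
Qed.

Lemma form_cvg_sq (v : nat -> X) u : (forall n, V (v n)) -> V u ->
  form_cvg a v u -> a (v n) (v n) @[n --> \oo] --> a u u.
Proof.
move=> Vv Vu vu.
have h : a (v n - u) (v n - u) @[n --> \oo] --> 0.
  apply/cvgrPdist_lt => e e0; have [N HN] := vu e e0.
  exists N => // n /= /HN; rewrite sub0r normrN ger0_norm// (si_pos sa)//.
  exact: subB.
have E n : a (v n) (v n) = a (v n - u) (v n - u) + 2 * a u (v n) - a u u.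
  by rewrite formB2// (si_sym sa (Vv n) Vu); ring.
have -> : (fun n => a (v n) (v n)) =
  (fun n => a (v n - u) (v n - u) + 2 * a u (v n) - a u u) by exact/funext.
have H : (a (v n - u) (v n - u) + 2 * a u (v n) - a u u) @[n --> \oo] -->
    0 + 2 * a u u - a u u.
  apply: cvgB; last exact: cvg_cst.
  by apply: cvgD => //; apply: cvgM; [exact: cvg_cst|exact: form_cvgr].
by rewrite (_ : 0 + _ - _ = a u u) in H; [exact: H|ring].
Qed.

Lemma form_cvg_cst u : V u -> form_cvg a (fun=> u) u.
Proof.
move=> Vu e e0; exists 0%N => n _.
by rewrite subrr (lin0 sV (linear_formr (sub0 sV))).
Qed.

Lemma form_cvgZD c (v v' : nat -> X) u u' : (forall n, V (v n)) -> V u ->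
  (forall n, V (v' n)) -> V u' -> form_cvg a v u -> form_cvg a v' u' ->
  form_cvg a (fun n => c *: v n + v' n) (c *: u + u').
Proof.
move=> Vv Vu Vv' Vu' vu vu' e e0.
have p0 : 0 < 2 * c ^+ 2 + 1 by have := sqr_ge0 c; lra.
have [N HN] := vu (e / 2 / (2 * c ^+ 2 + 1)) (divr_gt0 (divr_gt0 e0 (ltr0Sn _ _)) p0).
have [N' HN'] := vu' (e / 4) (divr_gt0 e0 (ltr0Sn _ _)).
exists (maxn N N') => n; rewrite geq_max => /andP[/HN h /HN' h'].
have -> : c *: v n + v' n - (c *: u + u') = c *: (v n - u) + (v' n - u').
  by rewrite scalerBr opprD addrACA.
have V1 := subB sV (Vv n) Vu; have V2 := subB sV (Vv' n) Vu'.
apply: le_lt_trans (formD2_le (subZ sV c V1) V2) _; rewrite formZ2//.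
rewrite ltr_pdivlMr// in h; have := si_pos sa V1; lra.
Qed.

Lemma form_cauchy_subseq (v : nat -> X) (s : nat -> nat) u : (forall n, V (v n)) -> V u ->
  (forall n, (n <= s n)%N) -> form_cauchy a v -> form_cvg a (v \o s) u -> form_cvg a v u.
Proof.
move=> Vv Vu sn cv vu e e0; have e4 : 0 < e / 4 by rewrite divr_gt0.
have [N HN] := cv _ e4; have [N' HN'] := vu _ e4.
exists N => n Nn; set k := maxn N N'.
have h1 := HN n (s k) Nn (leq_trans (leq_maxl N N') (sn _)).
have h2 := HN' k (leq_maxr N N').
have := formD2_le (subB sV (Vv n) (Vv (s k))) (subB sV (Vv (s k)) Vu).
by rewrite subrKA; move: h1 h2 => /=; lra.
Qed.

(* The parallelogram law makes almost-minimal elements of decreasing convex sets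
   a Cauchy sequence; this replaces weak compactness. *)
Lemma nested_convex_cauchy (K : nat -> set X) (M : R) :
  (forall n, K n `<=` V) -> (forall n, K n.+1 `<=` K n) ->
  (forall n, convex_on (K n)) -> (forall n, exists2 v, K n v & a v v <= M) ->
  exists2 v, (forall n, K n (v n)) & form_cauchy a v.
Proof.
move=> KV Kdec Kcvx KM.
have Kdecr n k : (n <= k)%N -> K k `<=` K n.
  move=> /subnK <-; elim: (k - n)%N => // j IH x; rewrite addSn => /Kdec; exact: IH.
pose A n := [set r | exists2 v, K n v & r = a v v].
have hA n : has_inf (A n).
  split; first by have [v Kv _] := KM n; exists (a v v), v.
  by exists 0 => _ [v Kv ->]; apply: (si_pos sa); exact: KV Kv.
pose mm n := inf (A n).
have mlb n v : K n v -> mm n <= a v v.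
  by move=> Kv; apply: ge_inf; [exact: (hA n).2 | exists v].
have mM n : mm n <= M by have [v Kv vM] := KM n; apply: le_trans vM; exact: mlb.
have mnd n k : (n <= k)%N -> mm n <= mm k.
  move=> nk; apply: lb_le_inf; first exact: (hA k).1.
  by move=> _ [v Kv ->]; apply: mlb; exact: Kdecr Kv.
have cm : has_sup (range mm).
  by split; [exists (mm 0%N), 0%N | exists M => _ [n _ <-]].
have ch n : exists v, K n v /\ a v v < mm n + n.+1%:R^-1.
  have [|_ [v Kv ->] h] := @inf_adherent _ (A n) (n.+1%:R^-1) _ (hA n).
    by rewrite invr_gt0.
  by exists v.
pose v n := projT1 (cid (ch n)).
have Kv n : K n (v n) by rewrite /v; case: cid => x [].
have hv n : a (v n) (v n) < mm n + n.+1%:R^-1 by rewrite /v; case: cid => x [].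
exists v => // e e0.
(* By the parallelogram law the squared distance is at most [2 (mm k - mm n)] plus
   [2 / n.+1 + 2 / k.+1], the midpoint being in [K n]. Errors of [e / 8] in each of the three
   quantities suffice. *)
have [_ [N1 _ <-] HN1] := @sup_adherent _ _ (e / 8) (divr_gt0 e0 (ltr0Sn _ _)) cm.
have [N2 _ HN2] := (cvgrPdist_lt _ 0).1 (@cvg_harmonic R) (e / 8) (divr_gt0 e0 (ltr0Sn _ _)).
exists (maxn N1 N2).
suff H n k : (maxn N1 N2 <= n)%N -> (n <= k)%N -> a (v n - v k) (v n - v k) < e.
  move=> n k Nn Nk; have [nk|/ltnW kn] := leqP n k; first exact: H.
  by rewrite formB_sym; [exact: H|exact: KV (Kv _)|exact: KV (Kv _)].
rewrite geq_max => /andP[N1n N2n] nk.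
have Vn := KV _ _ (Kv n); have Vk := KV _ _ (Kv k).
have mid : K n (2^-1 *: (v n + v k)).
  rewrite scalerDr; have -> : 2^-1 *: v k = (1 - 2^-1) *: v k.
    by congr (_ *: _); lra.
  by apply: Kcvx => //; [lra|exact: Kdecr (Kv k)].
have := mlb _ _ mid; rewrite formZ2; last exact: subD.
rewrite formB2// formD2//.
have s1 := ge_sup; have hk : mm k <= sup (range mm) by apply: ub_le_sup; [exact: cm.2|exists k].
have hn := mnd _ _ N1n.
have := HN2 n N2n; have := HN2 k (leq_trans N2n nk).
rewrite /= !sub0r !normrN !ger0_norm ?invr_ge0//.
have := hv n; have := hv k; have := hn; have := hk; have := HN1.
rewrite /harmonic.
set S := sup _; set x1 := n.+1%:R^-1; set x2 := k.+1%:R^-1.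
have -> : (2^-1 : R) ^+ 2 = 4^-1 by field.
move: (a _ _) (a _ _) (a _ _) (mm _) (mm _) (mm _); intros; lra.
Qed.

(** * Minimization of quadratic functionals over convex sets *)

Section minimization.
Context {K} (KV : K `<=` V) (K0 : K !=set0) (Kcvx : convex_on K).
Context {F} (lF : linear_on V F) {M : R} (FM : forall v, V v -> F v ^+ 2 <= M * a v v).
Let J v := a v v - 2 * F v.

Lemma bounded_form_mean (e : R) v : V v -> 0 < e -> 2 * `|F v| <= e * a v v + e^-1 * `|M|.
Proof.
move=> Vv e0; have v0 := si_pos sa Vv.
rewrite -(@ler_pXn2r _ 2) ?nnegrE//; last first.
  by rewrite addr_ge0// mulr_ge0// ?invr_ge0 ltW.
rewrite exprMn real_normK ?num_real// -subr_ge0.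
have h : F v ^+ 2 <= `|M| * a v v.
  by apply: le_trans (FM Vv) _; rewrite ler_wpM2r// ler_norm.
have -> : (e * a v v + e^-1 * `|M|) ^+ 2 - 2 ^+ 2 * F v ^+ 2 =
  (e * a v v - e^-1 * `|M|) ^+ 2 + 4 * (`|M| * a v v - F v ^+ 2).
  by field; rewrite gt_eqF.
by rewrite addr_ge0 ?sqr_ge0// mulr_ge0// subr_ge0.
Qed.

Lemma energy_conv s u v : V u -> V v ->
  J (s *: u + (1 - s) *: v) =
  s * J u + (1 - s) * J v - s * (1 - s) * a (u - v) (u - v).
Proof.
move=> Vu Vv; rewrite /J.
have Vs := subZ sV s Vu; have Vt := subZ sV (1 - s) Vv.
rewrite (formD2 Vs Vt) !formZ2// (formB2 Vu Vv) (linD lF)// !(linZ sV lF)//.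
by rewrite (linZ sV (linear_formr Vs))// (linZ sV (linear_forml Vv))//; ring.
Qed.

(** Completeness of [V] is not assumed: the multiplier is found from a minimizing sequence in H^1_0
    that is Cauchy for the L^2 form only. The sublevel sets of [J] are nested, convex and
    bounded. *)
Lemma almost_minimizers : exists v,
  [/\ forall n, K (v n), form_cauchy a v &
      forall n w, K w -> J (v n) <= J w + n.+1%:R^-1].
Proof.
pose A := [set J v | v in K].
have Jlb v : V v -> - `|M| <= J v.
  move=> Vv; have := bounded_form_mean Vv ltr01; have := ler_norm (F v).
  by rewrite /J invr1 !mul1r; lra.
have hA : has_inf A.
  by split; [have [v Kv] := K0; exists (J v), v
            |exists (- `|M|) => _ [v /KV/Jlb h <-]].
pose j := inf A.
have jlb v : K v -> j <= J v by move=> Kv; apply: ge_inf; [exact: hA.2|exists v].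
pose Kn n := [set v | K v /\ J v <= j + n.+1%:R^-1].
(* The bound comes from [J v <= j + 1] and [2 |F v| <= a v v / 2 + 2 |M|]. *)
have [||||v Kv cv] := @nested_convex_cauchy Kn (2 * (j + 1) + 4 * `|M|).
- by move=> n v [/KV].
- move=> n v [Kv h]; split => //; apply: le_trans h _.
  by rewrite lerD2l lef_pV2 ?posrE// ler_nat.
- move=> n s u v s0 s1 [Ku hu] [Kv hv]; split; first exact: Kcvx.
  have := energy_conv s (KV Ku) (KV Kv).
  have := si_pos sa (subB sV (KV Ku) (KV Kv)).
  set d := a _ _ => d0 ->.
  have : 0 <= s * (1 - s) * d by rewrite !mulr_ge0// subr_ge0.
  move: hu hv; set x := n.+1%:R^-1 => hu hv h.
  have h1 : s * J u <= s * (j + x) by rewrite ler_wpM2l.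
  have h2 : (1 - s) * J v <= (1 - s) * (j + x) by rewrite ler_wpM2l// subr_ge0.
  have -> : j + x = s * (j + x) + (1 - s) * (j + x) by ring.
  lra.
- move=> n; have [|_ [v Kv <-] h] := @inf_adherent _ A (n.+1%:R^-1) _ hA.
    by rewrite invr_gt0.
  exists v; first by split => //; exact: ltW.
  have := bounded_form_mean (KV Kv) (@ltr0Sn R 1 : 0 < 2).
  have : n.+1%:R^-1 <= 1 :> R by rewrite invf_le1 ?ler1n.
  have h2 : 0 < 2^-1 :> R by rewrite invr_gt0.
  have := bounded_form_mean (KV Kv) h2; rewrite invrK.
  have := ler_norm (F v); move: h; rewrite -/j /J.
  by move: (n.+1%:R^-1) => x; lra.
exists v; split => // [n|n w Kw]; first by case: (Kv n).
by apply: le_trans (Kv n).2 _; rewrite lerD2r; exact: jlb.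
Qed.

(** The comparison of [u] with [u + s (w - u)], divided by [s]. The error [r / s] is absent for a
    minimizer; for almost minimizers it disappears when [r] tends to zero at fixed [s]. *)
Lemma almost_min_variation r u w (s : R) : V u -> V w -> 0 < s -> s <= 1 ->
  J u <= J (s *: w + (1 - s) *: u) + r ->
  - (r / s) - s * a (w - u) (w - u) <= 2 * (a u (w - u) - F (w - u)).
Proof.
move=> Vu Vw s0 s1; have Vd := subB sV Vw Vu.
have -> : s *: w + (1 - s) *: u = u + s *: (w - u).
  by rewrite scalerBr scalerBl scale1r addrCA.
rewrite /J formD2//; last exact: subZ.
rewrite formZ2// (linZ sV (linear_formr Vu))// (linD lF)//; last exact: subZ.
rewrite (linZ sV lF)// => h.
rewrite -(ler_pM2l s0); set d := a (w - u) _ in h *.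
have -> : s * (- (r / s) - s * d) = - r - s ^+ 2 * d by field; rewrite gt_eqF.
by move: h; set x := a u _; set y := F (w - u); lra.
Qed.

Lemma variational_inequality : form_complete V a -> form_closed V a K ->
  exists2 u, K u & forall w, K w -> F (w - u) <= a u (w - u).
Proof.
move=> cV cK; have [v [Kv cv hv]] := almost_minimizers.
have Vv n := KV (Kv n).
have [u Vu vu] := cV v Vv cv; have Ku := cK _ _ Kv Vu vu.
exists u => // w Kw; have Vw := KV Kw; have Vd := subB sV Vw Vu.
have Fcvg : F (v n) @[n --> \oo] --> F u.
  apply/cvgrPdist_lt => e e0.
  have p0 : 0 < `|M| + 1 by have := normr_ge0 M; lra.
  have [N HN] := vu (e ^+ 2 / (`|M| + 1)) (divr_gt0 (exprn_gt0 2 e0) p0).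
  exists N => // n /= /HN; have Vnu := subB sV (Vv n) Vu.
  rewrite -(linB sV lF)// -[u - v n]opprB (linN sV lF)// normrN ltr_pdivlMr// => h.
  rewrite -(@ltr_pXn2r _ 2) ?nnegrE// ?(ltW e0)// real_normK ?num_real//.
  apply: le_lt_trans h; apply: le_trans (FM Vnu) _.
  rewrite mulrC ler_wpM2l ?(si_pos sa)//; have := ler_norm M; lra.
have Jcvg : J (v n) @[n --> \oo] --> J u.
  by apply: cvgB; [exact: form_cvg_sq|apply: cvgM => //; exact: cvg_cst].
have Jmin z : K z -> J u <= J z.
  move=> Kz; have : J z + harmonic n @[n --> \oo] --> J z + 0.
    by apply: cvgD; [exact: cvg_cst|exact: cvg_harmonic].
  rewrite addr0 => h; apply: (ler_cvg_to Jcvg h).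
  by apply: nearW => n; exact: hv.
have H s : 0 < s -> s <= 1 -> - (s * a (w - u) (w - u)) <= 2 * (a u (w - u) - F (w - u)).
  move=> s0 s1; have := @almost_min_variation 0 u w s Vu Vw s0 s1.
  by rewrite mul0r oppr0 sub0r addr0; apply; apply/Jmin/Kcvx => //; exact: ltW.
rewrite leNgt; apply/negP => h.
have d0 := si_pos sa Vd.
set x := a u _ - _ in H; set d := a (w - u) _ in d0 H.
have x0 : x < 0 by rewrite subr_lt0.
have p0 : 0 < d + `|x| by rewrite ltr_wpDl// normr_gt0 lt_eqF.
(* For this [s] the product [s * d] is at most [|x|], whereas [H] with [x < 0] requires
   [2 |x| <= s * d]. *)
have := H (`|x| / (d + `|x|)) (divr_gt0 _ p0).
rewrite normr_gt0 lt_eqF// ler_pdivrMr// mul1r lerDr => /(_ isT d0).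
have : `|x| / (d + `|x|) * d <= `|x|.
  by rewrite mulrAC ler_pdivrMr// ler_wpM2l// lerDl.
rewrite ltr0_norm//; lra.
Qed.

End minimization.
End form_theory.
End semi_inner.

(** * Lebesgue measure on row vectors *)

Section measure_preserving.
Context d (T : measurableType d) (R : realType) (mu : {measure set T -> \bar R}).
Context (phi : T -> T) (mphi : measurable_fun [set: T] phi).
Context (mu_phi : forall A, measurable A -> mu (phi @^-1` A) = mu A).

Let integral_pushforward_preserving (g : T -> \bar R) :
  (\int[pushforward mu phi]_x g x = \int[mu]_x g x)%E.
Proof. by apply: (eq_measure_integral mu) => A mA _; exact: mu_phi. Qed.

Lemma integrable_measure_preserving (f : T -> \bar R) :
  mu.-integrable [set: T] f -> mu.-integrable [set: T] (f \o phi).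
Proof.
move=> fi; have mf := measurable_int _ fi.
apply/integrableP; split; first exact: measurableT_comp mf mphi.
have /integrableP[_] := fi; rewrite -integral_pushforward_preserving.
by rewrite ge0_integral_pushforward//=; exact: measurableT_comp.
Qed.

Lemma integral_measure_preserving (f : T -> \bar R) :
  mu.-integrable [set: T] f -> (\int[mu]_x f (phi x) = \int[mu]_x f x)%E.
Proof.
move=> fi; have mf := measurable_int _ fi.
rewrite -[RHS]integral_pushforward_preserving integral_pushforward//.
exact: integrable_measure_preserving.
Qed.

End measure_preserving.

Section lebesgue_row.
Context {R : realType} {m : nat}.
Local Notation E := 'rV[R]_m.+1.
Local Notation mu := (@leb R m).

Lemma open_boxE (c : E * E) :
  open_box c = \bigcap_(i in [set: 'I_m.+1]) ((fun x : E => x 0 i) @^-1` `]c.1 0 i, c.2 0 i[).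
Proof.
apply/seteqP; split => x /= h i; first by move=> _; have := h i; rewrite /= in_itv.
by have := h i I; rewrite /= in_itv.
Qed.

Lemma open_box_open (c : E * E) : open (open_box c).
Proof.
rewrite openE => x xc; suff H : \forall y \near x, forall i : 'I_m.+1, c.1 0 i < (y : E) 0 i < c.2 0 i by [].
apply: (@filter_forall _ _ (fun i (y : E) => c.1 0 i < y 0 i < c.2 0 i) (nbhs x)) => i.
have : nbhs (x 0 i) `]c.1 0 i, c.2 0 i[%classic.
  apply: open_nbhs_nbhs; split; first exact: itv_open.
  by have := xc i; rewrite /= in_itv.
move=> h; have := @coord_continuous R 1 m.+1 0 i x _ h.
by apply: (@filterS _ (nbhs x)) => y /=; rewrite in_itv.
Qed.

Definition upd (i : 'I_m.+1) (t : R) (x : E) : E := \row_j (if j == i then t else x 0 j).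

Lemma box_volumeE (c : E * E) i : box_volume c =
  (Num.max (c.2 0 i - c.1 0 i) 0 * \prod_(j | j != i) Num.max (c.2 0 j - c.1 0 j) 0)%:E.
Proof. by rewrite /box_volume (bigD1 i). Qed.

Lemma leb_outer_cover (X : set E) (c : nat -> E * E) : X `<=` \bigcup_k open_box (c k) ->
  (leb_outer X <= \sum_(k <oo) box_volume (c k))%E.
Proof. by move=> Xc; apply: ereal_inf_lbound; exists c. Qed.

(** An open interval is cut at [t] into two open intervals; the upper one is extended by [e] to the
    left so that the cut point remains covered. *)
Lemma split_interval_len (a b t e : R) : 0 <= e ->
  Num.max (Num.min b t - a) 0 + Num.max (b - (Num.max a t - e)) 0 <= Num.max (b - a) 0 + e.
Proof.
move=> e0; rewrite /Num.max /Num.min.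
by repeat case: ifPn; rewrite -?leNgt; lra.
Qed.

(** Each box of a covering is cut at the hyperplane [x_i = t]. The two families cover the two parts
    of [X], and the total volume grows by at most [e]. *)
Lemma halfspace_caratheodory (i : 'I_m.+1) (t : R) :
  (@leb_outer R m).-caratheodory [set x : E | x 0 i < t].
Proof.
apply: le_caratheodory_measurable => X.
apply: le_ereal_inf_tmp => _ [c Xc <-].
apply/lee_addgt0Pr => e e0.
pose P k := \prod_(j | j != i) Num.max ((c k).2 0 j - (c k).1 0 j) 0.
have P0 k : 0 <= P k by apply: prodr_ge0 => j _; rewrite le_max lexx orbT.
(* [P k] is the volume of the face orthogonal to direction [i], so the extension adds [ek k * P k],
   at most [e / 2 ^ k.+1]. The [+ 1] covers degenerate faces. *)
pose ek k := e / (2 ^ k.+1)%:R / (P k + 1).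
have ek0 k : 0 < ek k.
  rewrite !divr_gt0// ?ltr0n ?expn_gt0//; have := P0 k; lra.
pose c1 k := ((c k).1, upd i (Num.min ((c k).2 0 i) t) (c k).2).
pose c2 k := (upd i (Num.max ((c k).1 0 i) t - ek k) (c k).1, (c k).2).
have v1 k : box_volume (c1 k) = (Num.max (Num.min ((c k).2 0 i) t - (c k).1 0 i) 0 * P k)%:E.
  rewrite (box_volumeE _ i) /= mxE eqxx; congr (_ * _)%:E.
  by apply: eq_bigr => j /negbTE ji; rewrite !mxE ji.
have v2 k : box_volume (c2 k) = (Num.max ((c k).2 0 i - (Num.max ((c k).1 0 i) t - ek k)) 0 * P k)%:E.
  rewrite (box_volumeE _ i) /= mxE eqxx; congr (_ * _)%:E.
  by apply: eq_bigr => j /negbTE ji; rewrite !mxE ji.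
have h1 : (leb_outer (X `&` [set x | (x 0 i < t)%R]) <= \sum_(k <oo) box_volume (c1 k))%E.
  apply: leb_outer_cover => x [/Xc[k _ xk] /= xt]; exists k => // j.
  have := xk j; rewrite /= mxE; case: eqP => [->|//].
  by rewrite lt_min xt andbT.
have h2 : (leb_outer (X `&` ~` [set x | (x 0 i < t)%R]) <= \sum_(k <oo) box_volume (c2 k))%E.
  apply: leb_outer_cover => x [/Xc[k _ xk] /negP/= ]; rewrite -leNgt => xt; exists k => // j.
  have := xk j; rewrite /= mxE; case: eqP => [->|//] /andP[h1' ->]; rewrite andbT.
  have := ek0 k; rewrite ltrBlDr => ?; rewrite gt_max; apply/andP; split; lra.
apply: le_trans (leeD h1 h2) _.
rewrite -nneseriesD; [|by move=> *; exact: box_volume_ge0..].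
apply: le_trans (epsilon_trick xpredT _ (ltW e0)); last by move=> k; exact: box_volume_ge0.
apply: lee_nneseries => k _; first by rewrite adde_ge0// box_volume_ge0.
rewrite v1 v2 (box_volumeE _ i) -!EFinD lee_fin -mulrDl.
have := split_interval_len ((c k).1 0 i) ((c k).2 0 i) t (ltW (ek0 k)) => h.
apply: le_trans (ler_wpM2r (P0 k) h) _; rewrite mulrDl lerD2l.
rewrite /ek mulrAC ler_pdivrMr; last by have := P0 k; lra.
by rewrite ler_wpM2l ?lerDl// divr_ge0// ltW.
Qed.

Lemma measurable_halfspace_lt (i : 'I_m.+1) t : measurable [set x : E | x 0 i < t].
Proof. exact: halfspace_caratheodory. Qed.

Lemma measurable_coord (i : 'I_m.+1) : measurable_fun [set: E] (fun x : E => x 0 i).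
Proof.
apply: (measurability _ (RGenInftyO.measurableE R)) => _ [_ [a ->] <-].
rewrite setTI; have -> : (fun x : E => x 0 i) @^-1` `]-oo, a[%classic = [set x | x 0 i < a].
  by apply/seteqP; split => x /=; rewrite in_itv.
exact: measurable_halfspace_lt.
Qed.

Lemma measurable_open_box (c : E * E) : measurable (open_box c).
Proof.
rewrite open_boxE; apply: fin_bigcap_measurable => // i _.
by rewrite -[X in measurable X]setTI; apply: measurable_coord.
Qed.

Definition closed_box (c : E * E) : set E := [set x | forall i, c.1 0 i <= x 0 i <= c.2 0 i].

Lemma open_closed_box c : open_box c `<=` closed_box c.
Proof. by move=> x h i; have /andP[/ltW-> /ltW->] := h i. Qed.

(** Boxes with rational corners, enumerated by [unpickle]. The closed boxes stay inside [U] so that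
    bump functions on them have compact support in [U]. *)
Lemma open_union_boxes (U : set E) : open U ->
  exists c : nat -> E * E, U = \bigcup_k open_box (c k) /\
    forall k, closed_box (c k) `<=` U.
Proof.
move=> oU.
pose r (v : 'rV[rat]_m.+1) : E := \row_j ratr (v 0 j).
(* The default corners [1] and [0] are in the wrong order: even the closed box is empty. *)
pose c k : E * E := if unpickle k is Some (p, q) then
  (if `[< closed_box (r p, r q) `<=` U >] then (r p, r q) else (const_mx 1, 0)) else (const_mx 1, 0).
have cU k : closed_box (c k) `<=` U.
  have h0 : closed_box ((const_mx 1, 0) : E * E) `<=` U.
    by move=> x /(_ ord0); rewrite /= !mxE => /andP[/le_trans h /h]; rewrite ler10.
  by rewrite /c; case: unpickle => // -[p q]; case: asboolP.
exists c; split => //; apply/seteqP; split; last by move=> x [k _ /open_closed_box/cU].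
move=> x Ux; have [e /= e0 xeU] := (nbhs_ballP _ _).1 (open_nbhs_nbhs (conj oU Ux)).
have hp j : exists p : rat, ratr p \in `]x 0 j - e, x 0 j[ by apply: rat_in_itvoo; lra.
have hq j : exists p : rat, ratr p \in `]x 0 j, x 0 j + e[ by apply: rat_in_itvoo; lra.
have /choice[p Hp] := hp; have /choice[q Hq] := hq.
exists (pickle (\row_j p j : 'rV[rat]_m.+1, \row_j q j : 'rV[rat]_m.+1)) => //.
rewrite /c pickleK; case: asboolP => [_ j|[]]; last first.
  move=> y hy; apply: xeU; split => // i j; rewrite (ord1 i).
  have := hy j; have := Hp j; have := Hq j; rewrite !in_itv /= !mxE.
  move=> /andP[_ h1] /andP[h2 _] /andP[h3 h4]; rewrite /ball /= ltr_distl; apply/andP; lra.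
by have := Hp j; have := Hq j; rewrite !in_itv /= !mxE => /andP[-> _] /andP[_ ->].
Qed.

Lemma open_measurable_rV (U : set E) : open U -> measurable U.
Proof.
move=> /open_union_boxes[c [-> _]]; apply: bigcup_measurable => k _.
exact: measurable_open_box.
Qed.

Lemma continuous_measurable_rV (f : E -> R) : continuous f -> measurable_fun [set: E] f.
Proof.
move=> cf; apply: (measurability _ (RGenOpens.measurableE R)) => _ [_ [a [b ->]] <-].
rewrite setTI; apply: open_measurable_rV; apply: open_comp => // x _; exact: cf.
Qed.

Lemma leb_bounded (A : set E) : bounded_set A -> (leb_outer A < +oo)%E.
Proof.
move=> [M [Mr HM]].
have /HM AM : M < `|M| + 1 by have := ler_norm M; lra.
set B := `|M| + 1 in AM.
pose c (k : nat) : E * E := if k == 0%N then (const_mx (- (B + 1)), const_mx (B + 1)) else (0, 0).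
have h1 : (leb_outer A <= \sum_(k <oo) box_volume (c k))%E.
  apply: leb_outer_cover => x Ax; exists 0%N => // j; rewrite /= !mxE -ltr_norml.
  have := AM x Ax; have : `|x 0 j| <= `|x|; last by move=> /= *; lra.
  by rewrite [leRHS]/Num.norm /= mx_normrE (le_trans _ (le_bigmax _ _ (0, j))).
apply: le_lt_trans h1 _; rewrite (nneseries_split 0 1); last by move=> *; exact: box_volume_ge0.
rewrite big_mkord big_ord_recl big_ord0 /= eseries0 ?adde0 ?ltry//.
move=> k; rewrite add0n => k1 _; rewrite /c gtn_eqF// /box_volume (bigD1 ord0)//=.
by rewrite subrr maxxx mul0r.
Qed.

Lemma leb_outer_open_approx (A : set E) (e : R) : (leb_outer A < +oo)%E -> 0 < e ->
  exists U, [/\ open U, A `<=` U & (leb_outer U <= leb_outer A + e%:E)%E].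
Proof.
move=> Aoo e0.
have fA : leb_outer A \is a fin_num by rewrite ge0_fin_numE// leb_outer_ge0.
have [_ [c Ac <-] h] := lb_ereal_inf_adherent e0 fA.
exists (\bigcup_k open_box (c k)); split => //.
  by apply: bigcup_open => k _; exact: open_box_open.
by apply: le_trans (ltW h); apply: leb_outer_cover.
Qed.

Lemma leb_outer_shift (A : set E) (h : E) : leb_outer [set x | A (x + h)] = leb_outer A.
Proof.
suff H (B : set E) (k : E) : (leb_outer [set x : E | B (x + k)%R] <= leb_outer B)%E.
  apply/eqP; rewrite eq_le H/=.
  have -> : A = [set x | [set y | A (y + h)] (x + - h)].
    by apply/seteqP; split => x /=; rewrite subrK.
  apply: le_trans (H _ _) _; apply: le_leb_outer => x /=; by rewrite addrNK.
apply: le_ereal_inf_tmp => _ [c Bc <-].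
have -> : (\sum_(j <oo) box_volume (c j) = \sum_(j <oo) box_volume ((c j).1 - k, (c j).2 - k)%R)%E.
  apply: eq_eseriesr => j _; rewrite /box_volume /=; congr EFin; apply: eq_bigr => i _.
  by congr Num.max; rewrite !mxE; ring.
apply: leb_outer_cover => x /= /Bc[j _ hj]; exists j => // i.
by have := hj i; rewrite /= !mxE ltrBlDr ltrBrDr.
Qed.

Lemma shift_caratheodory (A : set E) (h : E) : (@leb_outer R m).-caratheodory A ->
  (@leb_outer R m).-caratheodory [set x | A (x + h)].
Proof.
move=> cA X.
have S (Y : set E) : leb_outer Y = leb_outer [set x | Y (x - h)] by rewrite leb_outer_shift.
rewrite [LHS]S (cA [set x | X (x - h)]) [in RHS]S [X in (_ = _ + X)%E]S.
by congr (_ + _)%E; congr leb_outer; apply/seteqP; split => x /=; rewrite subrK.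
Qed.

Lemma measurable_shift (h : E) : measurable_fun [set: E] (fun x : E => x + h).
Proof. by move=> _ Y mY; rewrite setTI; exact: shift_caratheodory. Qed.

Lemma integral_shift (f : E -> \bar R) (h : E) : mu.-integrable [set: E] f ->
  (\int[mu]_x f (x + h)%R = \int[mu]_x f x)%E.
Proof.
apply: integral_measure_preserving; first exact: measurable_shift.
by move=> A _; exact: leb_outer_shift.
Qed.

Lemma integrable_shift (f : E -> \bar R) (h : E) : mu.-integrable [set: E] f ->
  mu.-integrable [set: E] (fun x => f (x + h)).
Proof.
apply: integrable_measure_preserving; first exact: measurable_shift.
by move=> A _; exact: leb_outer_shift.
Qed.

End lebesgue_row.

(** * Square-integrable functions *)

HB.lock Definition ip d (T : measurableType d) (R : realType)
  (mu : {measure set T -> \bar R}) (D : set T) (u v : T -> R) : R :=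
  \int[mu]_(x in D) (u x * v x).

Section square_integrable.
Context d (T : measurableType d) (R : realType).
Context (mu : {measure set T -> \bar R}) (D : set T) (mD : measurable D).
Implicit Types u v g : T -> R.

Definition sqint u :=
  measurable_fun D u /\ mu.-integrable D (fun x => (u x ^+ 2)%:E).

Local Notation ip := (ip mu D).

Lemma ip_def u v : ip u v = \int[mu]_(x in D) (u x * v x).
Proof. by rewrite unlock. Qed.

Local Notation aeD P := (\forall x \ae mu, D x -> P x).

Lemma integrable_ae_le (f g : T -> R) : measurable_fun D f ->
  mu.-integrable D (EFin \o g) -> aeD (fun x => `|f x| <= g x) ->
  mu.-integrable D (EFin \o f).
Proof.
move=> mf /integrableP[mg ig] fg; apply/integrableP; split; first exact/measurable_EFinP.
apply: le_lt_trans ig; apply: ae_ge0_le_integral => //.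
- by apply: measurableT_comp => //; exact/measurable_EFinP.
- exact: measurableT_comp.
- by apply: filterS fg => x h /h /= {}h; rewrite lee_fin (le_trans h)// ler_norm.
Qed.

Lemma sqint_ae_le u v : measurable_fun D u -> sqint v ->
  aeD (fun x => `|u x| <= `|v x|) -> sqint u.
Proof.
move=> mu_ [mv iv] uv; split => //.
apply: (@integrable_ae_le (fun x => u x ^+ 2) (fun x => v x ^+ 2)) => //.
  exact: measurable_funX.
apply: filterS uv => x h /h {}h.
by rewrite normrX -(real_normK (num_real (v x))) lerXn2r ?nnegrE.
Qed.

Lemma sqint_mul u v : sqint u -> sqint v -> mu.-integrable D (fun x => (u x * v x)%:E).
Proof.
move=> [mu_ iu] [mv iv].
apply: (@integrable_ae_le (fun x => u x * v x) (fun x => u x ^+ 2 + v x ^+ 2)).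
- exact: measurable_funM.
- rewrite (_ : _ \o _ = (fun x => (u x ^+ 2)%:E + (v x ^+ 2)%:E)%E); last first.
    by apply/funext => x; rewrite /= EFinD.
  exact: integrableD.
- apply: aeW => x _; rewrite normrM -subr_ge0.
  rewrite -(real_normK (num_real (u x))) -(real_normK (num_real (v x))).
  have := sqr_ge0 (`|u x| - `|v x|); have := normr_ge0 (u x); have := normr_ge0 (v x).
  rewrite sqrrB; nra.
Qed.

Lemma sqint_cst0 : sqint 0.
Proof.
split; first exact: measurable_cst.
by rewrite (_ : (fun _ => _) = cst 0%E) ?integrable0//; apply/funext => x; rewrite expr0n.
Qed.

Lemma sqint_subspace : subspace (sqint : set (T -> R)).
Proof.
split; first exact: sqint_cst0.
move=> c u v su sv; have [mu_ iu] := su; have [mv iv] := sv.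
have m1 : measurable_fun D (c *: u + v).
  by apply: measurable_funD => //; apply: measurable_funM => //; exact: measurable_cst.
split => //.
rewrite (_ : (fun _ => _) = (fun x => ((c ^+ 2)%:E * (u x ^+ 2)%:E +
  (2 * c)%:E * (u x * v x)%:E) + (v x ^+ 2)%:E)%E); last first.
  apply/funext => x /=; rewrite -!EFinM -!EFinD; congr EFin.
  by rewrite -[(c *: u + v) x]/(c * u x + v x); ring.
apply: integrableD => //; apply: integrableD => //; apply: integrableZl => //.
exact: sqint_mul.
Qed.

Lemma ipE u v : sqint u -> sqint v -> (ip u v)%:E = (\int[mu]_(x in D) (u x * v x)%:E)%E.
Proof. by move=> su sv; rewrite ip_def /Rintegral fineK// integrable_fin_num// sqint_mul. Qed.

Lemma ip_semi_inner : semi_inner (sqint : set (T -> R)) ip.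
Proof.
split; first exact: sqint_subspace.
- by move=> u v _ _; rewrite !ip_def; apply: eq_Rintegral => x _; rewrite mulrC.
- move=> c u v w su sv sw; rewrite !ip_def.
  rewrite -RintegralZl//; last exact: sqint_mul.
  rewrite -RintegralD//; last 2 first.
  + rewrite (_ : _ \o _ = (fun x => c%:E * (u x * w x)%:E)%E)//.
    by apply: integrableZl => //; exact: sqint_mul.
  + exact: sqint_mul.
  apply: eq_Rintegral => x _; rewrite -[(c *: u + v) x]/(c * u x + v x); ring.
- by move=> u su; rewrite ip_def; apply: Rintegral_ge0 => x _; rewrite -expr2 sqr_ge0.
Qed.

Lemma ae_eq_Rintegral (f g : T -> R) : measurable_fun D f -> measurable_fun D g ->
  aeD (fun x => f x = g x) -> \int[mu]_(x in D) f x = \int[mu]_(x in D) g x.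
Proof.
move=> mf mg fg; rewrite /Rintegral; congr fine; apply: ae_eq_integral => //.
- exact/measurable_EFinP.
- exact/measurable_EFinP.
- by apply: filterS fg => x h /h ->.
Qed.

Lemma Rintegral0_ae (f : T -> R) : mu.-integrable D (EFin \o f) ->
  aeD (fun x => 0 <= f x) -> \int[mu]_(x in D) f x <= 0 -> aeD (fun x => f x = 0).
Proof.
move=> iff f0 h; have mf := measurable_int mu iff.
have E : \int[mu]_(x in D) f x = \int[mu]_(x in D) `|f x|.
  apply: ae_eq_Rintegral; [exact/measurable_EFinP|..].
    by apply: measurableT_comp => //; exact/measurable_EFinP.
  by apply: filterS f0 => x H /H {}H; rewrite ger0_norm.
have /(ae_eq_integral_abs mu mD mf) : (\int[mu]_(x in D) `|(EFin \o f) x|)%E = 0%E.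
  have : 0 = \int[mu]_(x in D) `|f x|.
    by apply/eqP; rewrite eq_le -{2}E h andbT; apply: Rintegral_ge0.
  move=> h0; have := congr1 EFin h0; rewrite /Rintegral fineK//.
  by apply: integrable_fin_num => //; exact: integrable_abse iff.
by apply: filterS => x H /H /= [].
Qed.

Lemma ip_eq0 u : sqint u -> ip u u <= 0 -> aeD (fun x => u x = 0).
Proof.
rewrite ip_def => su h; have := Rintegral0_ae (sqint_mul su su).
have /[swap] /[apply] := h; move=> H.
have : aeD (fun x => 0 <= u x * u x) by apply: aeW => x _; rewrite -expr2 sqr_ge0.
by move/H; apply: filterS => x h' /h' /eqP; rewrite mulf_eq0 orbb => /eqP.
Qed.

Lemma ae_eq_ip u u' v v' : measurable_fun D u -> measurable_fun D u' ->
  measurable_fun D v -> measurable_fun D v' ->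
  aeD (fun x => u x = u' x) -> aeD (fun x => v x = v' x) -> ip u v = ip u' v'.
Proof.
move=> mu1 mu2 mv1 mv2 uu vv; rewrite !ip_def; apply: ae_eq_Rintegral; try exact: measurable_funM.
by apply: filterS2 uu vv => x h1 h2 Dx; rewrite h1// h2.
Qed.

(** By monotone convergence the sum of the series is integrable, hence finite a.e., and it dominates
    every term. [fine] replaces the value [+oo] on a null set. *)
Lemma integrable_EFin_series (g : nat -> T -> R) (C : R) :
  (forall n x, 0 <= g n x) -> (forall n, mu.-integrable D (EFin \o g n)) ->
  (forall N, \sum_(n < N) \int[mu]_(x in D) g n x <= C) ->
  exists H : T -> R, [/\ mu.-integrable D (EFin \o H), forall x, 0 <= H x &
    aeD (fun x => forall n, g n x <= H x)].
Proof.
move=> g0 ig gC.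
have mg n : measurable_fun D (EFin \o g n) by exact: measurable_int (ig n).
pose S x := (\sum_(0 <= n <oo) (g n x)%:E)%E.
have S0 x : (0 <= S x)%E by apply: nneseries_ge0 => n _ _; rewrite lee_fin.
have mS : measurable_fun D S.
  apply: (@ge0_emeasurable_sum _ _ _ D (fun n x => (g n x)%:E) predT).
    by move=> n x _ _; rewrite lee_fin.
  by move=> n _; exact: mg.
have iS : mu.-integrable D S.
  apply/integrableP; split => //.
  under eq_integral => x _ do rewrite gee0_abs//.
  rewrite integral_nneseries//; last by move=> n x _; rewrite lee_fin.
  apply: (@le_lt_trans _ _ C%:E); last by rewrite ltry.
  apply: lime_le.
    by apply: is_cvg_nneseries => n _ _; apply: integral_ge0 => x _; rewrite lee_fin.
  apply: nearW => N; rewrite big_mkord.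
  have -> : (\sum_(n < N) \int[mu]_(x in D) (g n x)%:E)%E =
      (\sum_(n < N) \int[mu]_(x in D) g n x)%:E.
    rewrite -sumEFin; apply: eq_bigr => n _; rewrite /Rintegral fineK//.
    exact: (integrable_fin_num mD (ig n)).
  by rewrite lee_fin.
have fS := integrable_ae mD iS.
exists (fine \o S); split.
- have mfS : measurable_fun D (fine \o S).
    by apply: measurableT_comp => //; exact: fine_measurable.
  apply/integrableP; split; first exact/measurable_EFinP.
  have /integrableP[_] := iS; apply: le_lt_trans.
  apply: ae_ge0_le_integral => //.
  + by apply: measurableT_comp => //; exact/measurable_EFinP.
  + exact: measurableT_comp.
  + by apply: filterS fS => x h /h {}h /=; rewrite -abse_EFin fineK.
- by move=> x; rewrite /= fine_ge0.
- apply: filterS fS => x h /h {}h n; rewrite -lee_fin fineK//.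
  apply: le_trans (nneseries_lim_ge n.+1 _); last by move=> k _ _; rewrite lee_fin.
  rewrite big_mkord big_ord_recr /= leeDr// sume_ge0// => i _.
  by rewrite lee_fin.
Qed.

Lemma sqrt_sqint (H : T -> R) : mu.-integrable D (EFin \o H) -> (forall x, 0 <= H x) ->
  sqint (fun x => Num.sqrt (H x)).
Proof.
move=> iH H0; have mH : measurable_fun D H by apply/measurable_EFinP; exact: measurable_int iH.
split.
  have ms : measurable_fun [set: R] (@Num.sqrt R).
    by apply: continuous_measurable_fun; exact: sqrt_continuous.
  exact: measurableT_comp ms mH.
by under eq_fun do rewrite sqr_sqrtr//.
Qed.

(** The upper limit in the extended reals is measurable without any convergence, and agrees with the
    limit wherever it exists. *)
Lemma ae_cvg_measurable (w : nat -> T -> R) : (forall n, measurable_fun D (w n)) ->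
  aeD (fun x => cvgn (w^~ x)) ->
  exists2 u : T -> R, measurable_fun D u & aeD (fun x => w n x @[n --> \oo] --> u x).
Proof.
move=> mw cw; exists (fun x => fine (limn_esup (fun n => (w n x)%:E))).
  apply: measurableT_comp; first exact: fine_measurable.
  by apply: measurable_fun_limn_esup => n; exact/measurable_EFinP.
apply: filterS cw => x h /h {}h.
have hE : (w n x)%:E @[n --> \oo] --> (limn (w^~ x))%:E by apply: cvg_EFin => //; exact: nearW.
by rewrite is_cvg_limn_esupE ?(cvg_lim _ hE)//; apply/cvg_ex; exists (limn (w^~ x))%:E.
Qed.

Lemma sqint_dominated (w : nat -> T -> R) u g : (forall n, measurable_fun D (w n)) ->
  measurable_fun D u -> sqint g ->
  (forall n, aeD (fun x => `|w n x| <= `|g x|)) ->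
  aeD (fun x => w n x @[n --> \oo] --> u x) ->
  [/\ forall n, sqint (w n), sqint u & form_cvg ip w u].
Proof.
move=> mw mu_ sg wg wu.
have sw n : sqint (w n) by exact: sqint_ae_le sg (wg n).
have su : sqint u.
  apply: sqint_ae_le sg _ => //.
  have := ae_foralln wg; apply: filterS2 wu => x h1 h2 Dx.
  have h : `|w n x| @[n --> \oo] --> `|u x| by apply: cvg_norm; exact: h1.
  have c : (fun=> `|g x|) @ \oo --> `|g x| by exact: cvg_cst.
  by apply: (ler_cvg_to h c); apply: nearW => n; exact: h2.
split => // e e0.
have [|||||iF _] := @dominated_convergence _ _ _ mu D mD
  (fun n x => ((w n x - u x) ^+ 2)%:E) (cst 0%E) (fun x => (4 * g x ^+ 2)%:E).
- move=> n; apply/measurable_EFinP; apply: measurable_funX; exact: measurable_funB.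
- exact: measurable_cst.
- apply: filterS wu => x h /h {}h; apply: cvg_EFin; first exact: nearW.
  have c : (fun=> u x) @ \oo --> u x by exact: cvg_cst.
  have h2 : w n x - u x @[n --> \oo] --> u x - u x by exact: cvgB.
  rewrite subrr in h2.
  have h3 : (w n x - u x) * (w n x - u x) @[n --> \oo] --> (0 * 0 : R) by exact: cvgM.
  by rewrite mulr0 in h3; exact: h3.
- rewrite (_ : (fun _ => _) = (fun x => 4%:E * (g x ^+ 2)%:E)%E)//.
  by apply: integrableZl => //; exact: sg.2.
- have := ae_foralln wg; apply: filterS2 wu => x h1 h2 n Dx.
  rewrite abse_EFin lee_fin ger0_norm ?sqr_ge0//.
  have hn := h2 n Dx.
  have h : `|w n x| @[n --> \oo] --> `|u x| by apply: cvg_norm; exact: h1.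
  have c : (fun=> `|g x|) @ \oo --> `|g x| by exact: cvg_cst.
  have hu : `|u x| <= `|g x| by apply: (ler_cvg_to h c); apply: nearW => k; exact: h2.
  have := ler_normB (w n x) (u x) => h3.
  rewrite -(real_normK (num_real (w n x - u x))) -(real_normK (num_real (g x))).
  have -> : 4 * `|g x| ^+ 2 = (2 * `|g x|) ^+ 2 by ring.
  by rewrite lerXn2r ?nnegrE// ?mulr_ge0//; lra.
rewrite integral0 => h.
move/fine_cvg/cvgrPdist_lt : h => /(_ e e0) [N _ HN].
exists N => n Nn; have := HN n Nn; rewrite /= sub0r normrN => /(le_lt_trans (ler_norm _)) h.
by rewrite ip_def; exact: h.
Qed.

Lemma sum_half N : \sum_(n < N) (2^-1 : R) ^+ n <= 2.
Proof.
suff -> : \sum_(n < N) (2^-1 : R) ^+ n = 2 - 2 * 2^-1 ^+ N.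
  by rewrite gerBl mulr_ge0// exprn_ge0.
elim: N => [|N IH]; first by rewrite big_ord0 expr0; ring.
by rewrite big_ord_recr /= IH exprS; field.
Qed.

(** The weight [c ^+ n] uses up all but a factor [2^-1 ^+ n] of the decay, so the weighted squares
    are summable. The conclusion is a pointwise geometric decay of [v n] with one dominating
    function. *)
Lemma sum_weighted_sq_dominated (c : R) (v : nat -> T -> R) : 1 < c ->
  (forall n, sqint (v n)) -> (forall n, ip (v n) (v n) <= (2 * c)^-1 ^+ n) ->
  exists2 H : T -> R, sqint H & (forall x, 0 <= H x) /\
    aeD (fun x => forall n, c ^+ n * v n x ^+ 2 <= H x ^+ 2).
Proof.
move=> c1 sv hv; have c0 : 0 < c by lra.
have [|||H [iH H0 hH]] := @integrable_EFin_series (fun n x => c ^+ n * v n x ^+ 2) 2.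
- by move=> n x; rewrite mulr_ge0 ?sqr_ge0// exprn_ge0// ltW.
- move=> n; rewrite (_ : _ \o _ = (fun x => (c ^+ n)%:E * (v n x ^+ 2)%:E)%E)//.
  by apply: integrableZl => //; exact: (sv n).2.
- move=> N; apply: le_trans (sum_half N); apply: ler_sum => n _.
  rewrite RintegralZl//; last exact: (sv n).2.
  under eq_Rintegral => x _ do rewrite expr2.
  rewrite -ip_def.
  apply: le_trans (ler_wpM2l _ (hv n)) _; first by rewrite exprn_ge0// ltW.
  by rewrite -exprMn invfM mulrCA divff ?gt_eqF// mulr1.
exists (fun x => Num.sqrt (H x)); first exact: sqrt_sqint.
split => [x|]; first exact: sqrtr_ge0.
by apply: filterS hH => x h /h {}h n; rewrite sqr_sqrtr.
Qed.

(** Indices with squared distance at most [4^-1 ^+ n] are selected. The condition [n <= s n]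
    replaces strict monotonicity: it is enough for limits to be preserved. *)
Lemma form_cvg_ae_subseq (w : nat -> T -> R) u : (forall n, sqint (w n)) -> sqint u ->
  form_cvg ip w u ->
  exists2 s : nat -> nat, (forall n, (n <= s n)%N) &
    aeD (fun x => w (s n) x @[n --> \oo] --> u x).
Proof.
move=> sw su wu.
have ch n : exists k, (n <= k)%N /\ ip (w k - u) (w k - u) <= (2 * 2)^-1 ^+ n.
  have [|N HN] := wu ((2 * 2)^-1 ^+ n); first by rewrite exprn_gt0// invr_gt0.
  exists (maxn n N); split; [exact: leq_maxl|apply/ltW/HN; exact: leq_maxr].
have /choice[s Hs] := ch.
exists s => [n|]; first exact: (Hs n).1.
have [|||H sH [H0 hH]] := @sum_weighted_sq_dominated 2 (fun n => w (s n) - u).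
- by lra.
- by move=> n; apply: subB; [exact: sqint_subspace|exact: sw|exact: su].
- by move=> n; exact: (Hs n).2.
apply: filterS hH => x h /h {}h.
apply/cvgrPdist_lt => e e0.
have q : geometric (H x ^+ 2) 2^-1 @ \oo --> (0 : R).
  by apply: cvg_geometric; rewrite gtr0_norm ?invr_gt0//; lra.
have [N _ HN] := (cvgrPdist_lt _ _).1 q (e ^+ 2) (exprn_gt0 2 e0).
exists N => // n /= Nn; have := HN n Nn; rewrite /= sub0r normrN => hn.
rewrite distrC -(@ltr_pXn2r _ 2) ?nnegrE// ?(ltW e0)// real_normK ?num_real//.
apply: le_lt_trans hn; rewrite (le_trans _ (ler_norm _))//.
by rewrite exprVn ler_pdivlMr ?exprn_gt0// mulrC; exact: h.
Qed.

Lemma ip_complete : form_complete (sqint : set (T -> R)) ip.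
Proof.
have ss := sqint_subspace.
move=> v sv cv.
have ch n : exists N, forall i j, (N <= i)%N -> (N <= j)%N ->
    ip (v i - v j) (v i - v j) < (2 * 4)^-1 ^+ n.
  by apply: cv; rewrite exprn_gt0// invr_gt0.
have /choice[N HN] := ch.
(* The sum makes [s] at once nondecreasing, at least [N n] and at least [n]. *)
pose s n := (n + \sum_(i < n.+1) N i)%N.
have Ns n : (N n <= s n)%N.
  by rewrite /s big_ord_recr /= addnA leq_addl.
have s1 n : (s n <= s n.+1)%N.
  by rewrite /s [in leqRHS]big_ord_recr /= addSn addnA leqW// leq_addr.
pose w n := v (s n).
have sw n : sqint (w n) by exact: sv.
(* From the rate [8^-1 ^+ n] the weight [4 ^+ n] can be extracted; its square root bounds the
   increments by [2^-1 ^+ n * H], which telescope to [2 * 2^-1 ^+ n * H]. *)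
have [|||H sH [H0 hH]] := @sum_weighted_sq_dominated 4 (fun n => w n.+1 - w n).
- by lra.
- by move=> n; exact: subB.
- by move=> n; apply/ltW/HN; [exact: leq_trans (Ns n) (s1 n)|exact: Ns].
have step x n : 4 ^+ n * (w n.+1 - w n) x ^+ 2 <= H x ^+ 2 ->
    `|w n.+1 x - w n x| <= 2^-1 ^+ n * H x.
  move=> h; rewrite exprVn mulrC ler_pdivlMr ?exprn_gt0//.
  rewrite -(@ler_pXn2r _ 2) ?nnegrE// ?mulr_ge0// exprMn real_normK ?num_real//.
  by rewrite -exprM mulnC exprM mulrC; have -> : (2 ^+ 2 = 4 :> R) by ring.
have tel x : (forall n, 4 ^+ n * (w n.+1 - w n) x ^+ 2 <= H x ^+ 2) ->
    forall n k, `|w (n + k)%N x - w n x| <= 2 * 2^-1 ^+ n * H x.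
  move=> h n k.
  suff : `|w (n + k)%N x - w n x| <= (2 * 2^-1 ^+ n - 2 * 2^-1 ^+ (n + k)) * H x.
    move=> /le_trans; apply; rewrite ler_wpM2r// gerBl mulr_ge0// exprn_ge0//.
  elim: k => [|k IH]; first by rewrite addn0 !subrr normr0 mul0r.
  rewrite addnS -(subrKA (w (n + k)%N x)); apply: le_trans (ler_normD _ _) _.
  apply: le_trans (lerD (step _ _ (h _)) IH) _.
  by rewrite -mulrDl ler_wpM2r// exprS; lra.
have cw : aeD (fun x => cvgn (w^~ x)).
  apply: filterS hH => x h /h /tel {}h; apply: cauchy_cvg; apply: cauchy_exP => e e0.
  have q : geometric (2 * H x) 2^-1 @ \oo --> (0 : R).
    by apply: cvg_geometric; rewrite gtr0_norm ?invr_gt0//; lra.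
  have [M _ HM] := (cvgrPdist_lt _ _).1 q e e0.
  exists (w M x); exists M => // n /= Mn; rewrite /ball /=.
  have := h M (n - M)%N; rewrite subnKC// distrC => /le_lt_trans; apply.
  have := HM M (leqnn M); rewrite /= sub0r normrN => /(le_lt_trans (ler_norm _)).
  by rewrite mulrAC.
have [u mu_ wu] := ae_cvg_measurable (fun n => (sw n).1) cw.
pose g : T -> R := (fun x => `|w 0%N x|) + 2 *: H.
have sg : sqint g.
  apply: (subD ss); last exact: (subZ ss).
  apply: sqint_ae_le (sw 0%N) _.
    by apply: measurableT_comp => //; exact: (sw 0%N).1.
  by apply: aeW => x _; rewrite normr_id.
have [|||||_ su wcvg] := @sqint_dominated w u g => //.
- by move=> n; exact: (sw n).1.
- move=> n; apply: filterS hH => x h /h /tel /(_ 0%N n); rewrite add0n expr0 mulr1 => {}h.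
  rewrite -[g x]/(`|w 0%N x| + 2 * H x) [leRHS]ger0_norm ?addr_ge0// ?mulr_ge0//.
  rewrite -[w n x](subrK (w 0%N x)) addrC; apply: le_trans (ler_normD _ _) _.
  by rewrite lerD2l.
exists u => //; apply: (form_cauchy_subseq ip_semi_inner sv su _ cv wcvg) => n.
exact: leq_addr.
Qed.

End square_integrable.

(** * Smooth functions *)

Section line_derivative.
Context {R : realType} {V : normedModType R}.

Lemma line_quotient (f : V -> R) x v (t0 : R) :
  (fun h : R => h^-1 *: (((fun t : R => f (t *: v + x)) \o shift t0) (h *: (1 : R)) -
     (fun t : R => f (t *: v + x)) t0)) =
  (fun h : R => h^-1 *: ((f \o shift (t0 *: v + x)) (h *: v) - f (t0 *: v + x))).
Proof.
apply/funext => h /=; rewrite -[h *: (1 : R)]/(h * 1) mulr1.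
by rewrite scalerDl addrA.
Qed.

Lemma is_derive_line_at (f : V -> R) x v a (t0 : R) :
  is_derive (t0 *: v + x) v f a <-> is_derive t0 (1 : R) (fun t => f (t *: v + x)) a.
Proof.
split => -[d1 d2]; split.
- by move: d1; rewrite /derivable line_quotient.
- by move: d2; rewrite /derive line_quotient.
- by move: d1; rewrite /derivable line_quotient.
- by move: d2; rewrite /derive line_quotient.
Qed.

Lemma is_derive_line (f : V -> R) x v a :
  is_derive x v f a <-> is_derive (0 : R) (1 : R) (fun t => f (t *: v + x)) a.
Proof. by rewrite -is_derive_line_at scale0r add0r. Qed.

(** Restriction to the line through [x] reduces this to one variable. Only derivability of [g] along
    [v] is assumed, because [smooth] provides nothing but partial derivatives. *)
Lemma is_derive_comp (f : R -> R) (g : V -> R) x v (a b : R) :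
  is_derive (g x) 1 f a -> is_derive x v g b -> is_derive x v (f \o g) (a * b).
Proof.
move=> h1 /is_derive_line h2; apply/is_derive_line.
apply: (@is_derive1_comp _ f (fun t => g (t *: v + x))) => //.
by rewrite scale0r add0r.
Qed.

End line_derivative.

Section smooth_functions.
Context {R : realType} {m : nat}.
Local Notation E := 'rV[R]_m.+1.
Implicit Types (f g phi : E -> R) (P G : set (E -> R)).

(** A coinduction principle: [smooth] contains every class that is stable under partial derivatives
    and whose members are continuous and derivable along the axes. *)
Lemma smooth_coind P :
  (forall f, P f -> continuous f /\ forall i x, derivable f x (basis_vec i)) ->
  (forall f i, P f -> P (partial i f)) -> P `<=` smooth.
Proof.
move=> H1 H2 f Pf s; apply: H1; elim: s => //= i s IH; exact: H2.
Qed.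

Lemma smooth_partial i phi : smooth phi -> smooth (partial i phi).
Proof.
move=> sp s; have := sp (rcons s i).
by rewrite /iter_partial foldr_rcons.
Qed.

Lemma smooth_continuous phi : smooth phi -> continuous phi.
Proof. by move=> /(_ [::])[]. Qed.

Lemma smooth_derivable phi i x : smooth phi -> derivable phi x (basis_vec i).
Proof. by move=> /(_ [::])[_]; exact. Qed.

(** The closure of [G] under sums and products. By the Leibniz rule it is stable under partial
    derivatives as soon as it contains those of the generators, so smoothness is checked on
    generators only. *)
Inductive generated G : set (E -> R) :=
| gen_base g : G g -> generated G g
| gen_add f g : generated G f -> generated G g -> generated G (f + g)
| gen_mul f g : generated G f -> generated G g -> generated G (f * g).

Lemma generated_smooth G :
  (forall g, G g -> continuous g /\ forall i, (forall x, derivable g x (basis_vec i)) /\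
    generated G (partial i g)) -> generated G `<=` smooth.
Proof.
move=> HG.
have C g : generated G g -> continuous g.
  elim=> [{}g /HG[]//|f h _ cf _ ch x|f h _ cf _ ch x].
  - by apply: continuousD; [exact: cf|exact: ch].
  - by apply: continuousM; [exact: cf|exact: ch].
have D g : generated G g -> forall i x, derivable g x (basis_vec i).
  elim=> [{}g /HG[_ H] i x|f h _ cf _ ch i x|f h _ cf _ ch i x].
  - exact: (H i).1.
  - by apply: derivableD; [exact: cf|exact: ch].
  - by apply: derivableM; [exact: cf|exact: ch].
apply: smooth_coind => [f Gf|f i]; first by split; [exact: C|exact: D].
elim=> [{}g /HG[_ H]|{}f h Gf If Gh Ih|{}f h Gf If Gh Ih].
- exact: (H i).2.
- have -> : partial i (f + h) = partial i f + partial i h.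
    by apply/funext => x; apply: deriveD; exact: D.
  exact: gen_add.
- have -> : partial i (f * h) = f * partial i h + h * partial i f.
    by apply/funext => x; rewrite /partial deriveM//; exact: D.
  by apply: gen_add; apply: gen_mul.
Qed.

Let generated_smoothP : generated smooth `<=` smooth.
Proof.
apply: generated_smooth => g sg; split; first exact: smooth_continuous.
move=> i; split => [x|]; first exact: smooth_derivable.
by apply: gen_base; exact: smooth_partial.
Qed.

Lemma smoothD f g : smooth f -> smooth g -> smooth (f + g).
Proof. by move=> sf sg; apply: generated_smoothP; apply: gen_add; exact: gen_base. Qed.

Lemma smoothM f g : smooth f -> smooth g -> smooth (f * g).
Proof. by move=> sf sg; apply: generated_smoothP; apply: gen_mul; exact: gen_base. Qed.

Lemma partial_cst i (c : R) : partial i (cst c : E -> R) = cst 0.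
Proof. by apply/funext => x; exact: derive_cst. Qed.

Lemma smooth_cst (c : R) : smooth (cst c : E -> R).
Proof.
apply: (@smooth_coind [set f | exists c, f = cst c]); last by exists c.
- move=> _ [a ->]; split; first by move=> x; exact: cst_continuous.
  by move=> i x; exact: derivable_cst.
- by move=> _ i [a ->]; exists 0; rewrite partial_cst.
Qed.

Lemma smoothN f : smooth f -> smooth (- f).
Proof.
move=> sf; have -> : - f = (cst (-1)) * f by apply/funext => x; rewrite mulN1r.
exact: smoothM (smooth_cst _) sf.
Qed.

Lemma smoothB f g : smooth f -> smooth g -> smooth (f - g).
Proof. by move=> sf sg; exact: smoothD sf (smoothN sg). Qed.

Lemma smoothZ (c : R) f : smooth f -> smooth (c *: f).
Proof.
move=> sf; have -> : c *: f = (cst c) * f by apply/funext => x.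
exact: smoothM (smooth_cst _) sf.
Qed.

Lemma smoothX f n : smooth f -> smooth (f ^+ n).
Proof.
move=> sf; elim: n => [|n IH]; first by rewrite expr0; exact: smooth_cst.
by rewrite exprS; exact: smoothM.
Qed.

Lemma smooth_prod (I : Type) (r : seq I) (p : pred I) (F : I -> E -> R) :
  (forall i, smooth (F i)) -> smooth (\prod_(i <- r | p i) F i).
Proof.
move=> sF; elim/big_ind: _; first exact: smooth_cst.
- by move=> f g sf sg; exact: smoothM sf sg.
- by move=> i _; exact: sF.
Qed.

Lemma is_derive_coord i j (x : E) : is_derive x (basis_vec i) (fun y : E => y 0 j) (i == j)%:R.
Proof.
apply/is_derive_line.
rewrite (_ : (fun t : R => _) = id * cst (i == j)%:R + cst (x 0 j)); last first.
  by apply/funext => t; rewrite !mxE eqxx eq_sym.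
apply: is_derive_eq.
rewrite -![_ *: _]/(_ * _) /=; ring.
Qed.

Section smooth_sqrt.
Context (phi : E -> R) (sphi : smooth phi) (e : R) (e0 : 0 < e).
Let s := (fun x => Num.sqrt (phi x ^+ 2 + e ^+ 2)).
Let s1 := (fun x => (Num.sqrt (phi x ^+ 2 + e ^+ 2))^-1).
(** The derivatives of [s] and of its inverse [s1] are polynomials in [phi], [s1] and a partial
    derivative of [phi], so no further generator arises. *)
Let G := smooth `|` [set s; s1].

Let arg_gt0 x : 0 < phi x ^+ 2 + e ^+ 2.
Proof. by rewrite ltr_wpDl ?sqr_ge0// exprn_gt0. Qed.

Let s_gt0 x : 0 < s x. Proof. by rewrite sqrtr_gt0. Qed.

Let der_s i x : is_derive x (basis_vec i) s (phi x * s1 x * partial i phi x).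
Proof.
have h1 : is_derive x (basis_vec i) (fun x => phi x ^+ 2 + e ^+ 2) (2 * phi x * partial i phi x).
  have h : is_derive x (basis_vec i) phi (partial i phi x).
    by apply: derivableP; exact: smooth_derivable.
  have -> : (fun x => phi x ^+ 2 + e ^+ 2) = phi * phi + cst (e ^+ 2).
    by apply/funext => y; rewrite expr2.
  by apply: is_derive_eq; rewrite addr0 -![_ *: _]/(_ * _); ring.
have h2 := @is_derive_comp _ _ Num.sqrt (fun x => phi x ^+ 2 + e ^+ 2) _ _ _ _ (is_derive1_sqrt (arg_gt0 x)) h1.
apply: (is_derive_eq h2).
by rewrite /s1; field; rewrite gt_eqF// s_gt0.
Qed.

Let der_s1 i x : is_derive x (basis_vec i) s1 (- phi x * s1 x * s1 x * s1 x * partial i phi x).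
Proof.
have h : is_derive x (basis_vec i) s _ := der_s i x.
have hV : is_derive (s x) (1 : R) (fun y : R => y^-1) (- (s x) ^- 2).
  apply: is_derive_eq; first by apply: is_deriveV; rewrite gt_eqF ?s_gt0.
  by rewrite -![_ *: _]/(_ * _) mulr1.
have h2 := @is_derive_comp _ _ (fun y : R => y^-1) s _ _ _ _ hV h.
apply: (is_derive_eq h2).
by rewrite /s1 -/(s x); field; rewrite gt_eqF// s_gt0.
Qed.

Let generated_sqrt : generated G `<=` smooth.
Proof.
have cphi : continuous phi := smooth_continuous sphi.
have cs : continuous s.
  move=> x; apply: (@continuous_comp _ _ _ (fun x => phi x ^+ 2 + e ^+ 2) Num.sqrt); last exact: sqrt_continuous.
  apply: continuousD; last exact: cst_continuous.
  by apply: (@continuousM _ _ phi phi); exact: cphi.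
have Gs : generated G s by apply: gen_base; right; left.
have Gs1 : generated G s1 by apply: gen_base; right; right.
have Gp : generated G phi by apply: gen_base; left.
have Gpi i : generated G (partial i phi) by apply: gen_base; left; exact: smooth_partial.
apply: generated_smooth => g [sg|[->|->]].
- split; first exact: smooth_continuous.
  move=> i; split => [x|]; first exact: smooth_derivable.
  by apply: gen_base; left; exact: smooth_partial.
- split => // i; split => [x|]; first exact: (@ex_derive _ _ _ _ _ _ _ (der_s i x)).
  have -> : partial i s = phi * s1 * partial i phi.
    by apply/funext => x; exact: (@derive_val _ _ _ _ _ _ _ (der_s i x)).
  by apply: gen_mul => //; apply: gen_mul.
- split; first by move=> x; apply: (@continuousV _ _ s); [rewrite gt_eqF ?s_gt0|exact: cs].
  move=> i; split => [x|]; first exact: (@ex_derive _ _ _ _ _ _ _ (der_s1 i x)).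
  have -> : partial i s1 = (cst (-1)) * phi * s1 * s1 * s1 * partial i phi.
    apply/funext => x; rewrite [LHS](@derive_val _ _ _ _ _ _ _ (der_s1 i x)).
    by rewrite /GRing.mul /= mulN1r.
  do 5 (apply: gen_mul => //).
  by apply: gen_base; left; exact: smooth_cst.
Qed.

Lemma smooth_sqrt : smooth (fun x => Num.sqrt (phi x ^+ 2 + e ^+ 2)).
Proof. by apply: generated_sqrt; apply: gen_base; right; left. Qed.

End smooth_sqrt.

End smooth_functions.

(** * Functions that are flat at the origin *)

Section flat_functions.
Context {R : realType}.
Implicit Types (s : R) (k : nat).

(** For [k = 0] this is the classical smooth function that vanishes on the negative axis. The powers
    [s ^- k] are included because the family is then stable, up to linear combinations, under
    derivation. *)
Definition flat k s : R := if 0 < s then s ^- k * expR (- s^-1) else 0.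

Lemma flat_gt0 k s : 0 < s -> 0 < flat k s.
Proof. by move=> s0; rewrite /flat s0 mulr_gt0 ?expR_gt0// invr_gt0 exprn_gt0. Qed.

Lemma flat_le0 k s : s <= 0 -> flat k s = 0.
Proof. by rewrite /flat leNgt => /negbTE ->. Qed.

Lemma flat_ge0 k s : 0 <= flat k s.
Proof. by have [s0|s0] := ltP 0 s; [exact/ltW/flat_gt0|rewrite flat_le0]. Qed.

Lemma flat0_lt1 s : flat 0 s < 1.
Proof.
rewrite /flat; case: ifPn => // s0; rewrite expr0 invr1 mul1r.
by rewrite -expR0 ltr_expR oppr_lt0 invr_gt0.
Qed.

(** Write [expR s^-1] as the [n]-th power of [expR (1 / (n s))], which is at least [1 / (n s)]. *)
Lemma expR_invN_le s n : 0 < s -> expR (- s^-1) <= (n%:R * s) ^+ n.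
Proof.
move=> s0; case: n => [|n]; first by rewrite expr0 -expR0 ler_expR oppr_le0 invr_ge0 ltW.
have h0 : 0 < n.+1%:R * s :> R by rewrite mulr_gt0.
rewrite expRN -[leRHS]invrK lef_pV2 ?posrE ?expR_gt0 ?invr_gt0 ?exprn_gt0//.
rewrite -exprVn invfM.
have -> : expR s^-1 = expR (n.+1%:R^-1 * s^-1) ^+ n.+1.
  by rewrite -expRM_natl mulrA divff ?mul1r// pnatr_eq0.
rewrite lerXn2r ?nnegrE ?expR_ge0//; first by rewrite mulr_ge0 ?invr_ge0// ltW.
by apply: le_trans (expR_ge1Dx _); rewrite lerDr.
Qed.

(** Two powers of [s] beyond [s ^- k] are taken from the exponential. A quadratic bound is what
    makes the derivative at the origin exist and vanish. *)
Lemma flat_quadratic k s : flat k s <= k.+2%:R ^+ k.+2 * s ^+ 2.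
Proof.
have [s0|s0] := ltP 0 s; last by rewrite flat_le0// mulr_ge0 ?sqr_ge0// exprn_ge0.
rewrite /flat s0 mulrC ler_pdivrMr ?exprn_gt0//.
apply: le_trans (expR_invN_le k.+2 s0) _.
by rewrite exprMn -[leRHS]mulrA -exprD add2n.
Qed.

Lemma is_derive_flat k s :
  is_derive s (1 : R) (flat k) (- k%:R * flat k.+1 s + flat k.+2 s).
Proof.
have [s0|s0|->] := ltgtP s 0.
- rewrite !flat_le0 ?ltW// mulr0 addr0.
  have h : is_derive s (1 : R) (cst 0 : R -> R) 0 by exact: is_derive_cst.
  apply: near_eq_is_derive h.
  by near=> t; rewrite flat_le0//; apply: ltW; near: t; exact: lt_nbhsl.
- apply: (@near_eq_is_derive _ _ _ (fun t : R => t ^- k * expR (- t^-1))).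
    by near=> t; rewrite /flat ifT//; near: t; exact: lt_nbhsr.
  have hV : is_derive s (1 : R) (fun y : R => y^-1) (- s ^- 2).
    apply: is_derive_eq; first by apply: is_deriveV; rewrite gt_eqF.
    by rewrite -![_ *: _]/(_ * _) mulr1.
  have hk : is_derive s (1 : R) (fun y : R => y ^- k) (- k%:R * s ^- k.+1).
    have hX : is_derive s (1 : R) (fun y : R => y ^+ k) (k%:R * s ^+ k.-1).
      have -> : (fun y : R => y ^+ k) = (id : R -> R) ^+ k.
        by apply/funext => y; elim: k => // j IH; rewrite exprS IH exprS.
      by apply: is_derive_eq; rewrite -![_ *: _]/(_ * _) mulr1.
    apply: is_derive_eq; first by apply: is_deriveV; rewrite expf_neq0// gt_eqF.
    rewrite -![_ *: _]/(_ * _); case: k {hX} => [|k]; first by rewrite !mul0r oppr0 mulr0 mul0r.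
    rewrite /= !exprS; field; rewrite expf_neq0 ?andbT gt_eqF//.
  have he : is_derive s (1 : R) (fun y : R => expR (- y^-1)) (expR (- s^-1) * s ^- 2).
    have hN : is_derive s (1 : R) (fun y : R => - y^-1) (s ^- 2).
      by apply: is_derive_eq; rewrite opprK.
    exact: is_derive1_comp (is_derive_expR _) hN.
  have -> : (fun t : R => t ^- k * expR (- t^-1)) =
     (fun t : R => t ^- k) * (fun t : R => expR (- t^-1)) by [].
  apply: is_derive_eq; rewrite -![_ *: _]/(_ * _) /flat s0 !exprS; field.
  by rewrite expf_neq0 ?andbT gt_eqF.
- rewrite !(@flat_le0 _ 0)// mulr0 addr0.
  set C := k.+2%:R ^+ k.+2 : R.
  have C0 : 0 <= C by rewrite exprn_ge0.
  have H : h^-1 *: ((flat k \o shift 0) (h *: (1 : R)) - flat k 0) @[h --> 0^'] --> (0 : R).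
    apply/cvgrPdist_lt => e e0.
    have d0 : 0 < e / (C + 1) by rewrite divr_gt0//; lra.
    exists (e / (C + 1)) => // h he hn0.
    have {}he : `|h| < e / (C + 1) by move: he; rewrite /ball_ /= sub0r normrN.
    rewrite /= (@flat_le0 _ 0)// subr0 sub0r normrN addr0 -![_ *: _]/(_ * _) mulr1 normrM.
    rewrite (ger0_norm (flat_ge0 _ _)).
    have := flat_quadratic k h; rewrite -/C => hq.
    have hh : 0 < `|h| by rewrite normr_gt0.
    rewrite normfV ltr_pdivrMl//; apply: le_lt_trans hq _.
    rewrite -(real_normK (num_real h)) expr2 mulrA mulrC ltr_pM2l//.
    apply: (@le_lt_trans _ _ ((C + 1) * `|h|)); first by rewrite ler_wpM2r// lerDl.
    by rewrite mulrC -ltr_pdivlMr//; lra.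
  by split; [apply/cvg_ex; exists 0|apply/cvg_lim].
Unshelve. all: by end_near. Qed.

End flat_functions.

(** * Bump functions on boxes and cut-offs of open sets *)

Section cutoff.
Context {R : realType} {m : nat}.
Local Notation E := 'rV[R]_m.+1.
Implicit Types (f g phi : E -> R) (U Omega : set E).

Lemma smooth_flat k (s a : R) (j : 'I_m.+1) : smooth (fun x : E => flat k (s * x 0 j + a)).
Proof.
pose F k : E -> R := fun x => flat k (s * x 0 j + a).
pose G := [set g : E -> R | (exists c, g = cst c) \/ (exists k, g = F k)].
have harg i (x : E) : is_derive x (basis_vec i) (fun x : E => s * x 0 j + a) (s * (i == j)%:R).
  have h := is_derive_coord i j x.
  have -> : (fun x : E => s * x 0 j + a) = cst s * (fun x : E => x 0 j) + cst a by [].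
  by apply: is_derive_eq; rewrite addr0 -![_ *: _]/(_ * _) mulr0 addr0.
have dF l i x : is_derive x (basis_vec i) (F l)
    ((- l%:R * F l.+1 x + F l.+2 x) * (s * (i == j)%:R)).
  exact: (@is_derive_comp _ _ (flat l) (fun x : E => s * x 0 j + a) _ _ _ _ (is_derive_flat _ _) (harg i x)).
suff H : generated G `<=` smooth by apply: H; apply: gen_base; right; exists k.
apply: generated_smooth => _ [[c ->]|[l ->]].
  split; first by move=> x; exact: cst_continuous.
  move=> i; split; first by move=> x; exact: derivable_cst.
  by rewrite partial_cst; apply: gen_base; left; exists 0.
split.
  move=> x; apply: (@continuous_comp _ _ _ (fun x : E => s * x 0 j + a) (flat l)).
    apply: continuousD; last exact: cst_continuous.
    apply: (@continuousM _ _ (cst s) (fun x : E => x 0 j)); first exact: cst_continuous.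
    exact: coord_continuous.
  apply: differentiable_continuous; apply/derivable1_diffP.
  exact: (@ex_derive _ _ _ _ _ _ _ (is_derive_flat l _)).
move=> i; split => [x|]; first exact: (@ex_derive _ _ _ _ _ _ _ (dF l i x)).
have -> : partial i (F l) = (cst (- l%:R) * F l.+1 + F l.+2) * cst (s * (i == j)%:R).
  by apply/funext => x; exact: (@derive_val _ _ _ _ _ _ _ (dF l i x)).
apply: gen_mul; last by apply: gen_base; left; eexists.
apply: gen_add; last by apply: gen_base; right; eexists.
by apply: gen_mul; apply: gen_base; [left|right]; eexists.
Qed.

Lemma fct_prodE (T I : Type) (r : seq I) (p : pred I) (F : I -> T -> R) x :
  (\prod_(i <- r | p i) F i) x = \prod_(i <- r | p i) F i x.
Proof.
by apply: (big_morph (fun f : T -> R => f x)).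
Qed.

(** The arguments are kept in the affine shape [s * x 0 i + a] of [smooth_flat]; [bumpE] gives the
    simplified expression. *)
Definition bump (c : E * E) : E -> R :=
  \prod_(i < m.+1) ((fun x : E => flat 0 (1 * x 0 i + - c.1 0 i)) *
                    (fun x : E => flat 0 (-1 * x 0 i + c.2 0 i))).

Lemma bumpE c x : bump c x =
  \prod_(i < m.+1) (flat 0 (x 0 i - c.1 0 i) * flat 0 (c.2 0 i - x 0 i)).
Proof.
rewrite /bump fct_prodE; apply: eq_bigr => i _.
rewrite -[LHS]/(flat 0 (1 * x 0 i + - c.1 0 i) * flat 0 (-1 * x 0 i + c.2 0 i)).
by rewrite mul1r mulN1r [- _ + _]addrC.
Qed.

Lemma smooth_bump c : smooth (bump c).
Proof. by apply: smooth_prod => i; apply: smoothM; exact: smooth_flat. Qed.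

Lemma bump_gt0 c x : open_box c x -> 0 < bump c x.
Proof.
move=> cx; rewrite bumpE; apply: prodr_gt0 => i _.
by have /andP[h1 h2] := cx i; rewrite mulr_gt0// flat_gt0// subr_gt0.
Qed.

Lemma bump_eq0 c x : ~ open_box c x -> bump c x = 0.
Proof.
move=> /existsNP[i /negP]; rewrite negb_and -!leNgt => h.
rewrite bumpE (bigD1 i)//=; case/orP: h => h.
- by rewrite (@flat_le0 _ 0 (x 0 i - _)) ?subr_le0// !mul0r.
- by rewrite (@flat_le0 _ 0 (_ - x 0 i)) ?subr_le0// mulr0 mul0r.
Qed.

Lemma bump_le1 c x : 0 <= bump c x <= 1.
Proof.
rewrite bumpE; apply/andP; split.
  by apply: prodr_ge0 => i _; rewrite mulr_ge0// flat_ge0.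
apply: prodr_ile1 => i _; rewrite mulr_ge0 ?flat_ge0//=.
by rewrite mulr_ile1 ?flat_ge0// ltW// flat0_lt1.
Qed.

Lemma closed_box_compact (c : E * E) : compact (closed_box c).
Proof.
apply: bounded_closed_compact.
  exists (\sum_i (`|c.1 0 i| + `|c.2 0 i|)); split; first exact: num_real.
  move=> M hM x cx /=; rewrite [leLHS]/Num.norm /= mx_normrE.
  apply: bigmax_le => [|[i j] _ /=].
    by apply: le_trans (ltW hM); apply: sumr_ge0 => j _; rewrite addr_ge0.
  rewrite (ord1 i); apply: le_trans (ltW hM); rewrite (bigD1 j)//=.
  apply: (@le_trans _ _ (`|c.1 0 j| + `|c.2 0 j|)); last first.
    by rewrite lerDl sumr_ge0// => l _; rewrite addr_ge0.
  have /andP[h1 h2] := cx j.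
  have := ler_norm (c.2 0 j); have := ler_norm (- c.1 0 j); rewrite normrN.
  have := normr_ge0 (c.1 0 j); have := normr_ge0 (c.2 0 j).
  by rewrite ler_norml => *; apply/andP; split; lra.
have -> : closed_box c =
  \bigcap_(i in [set: 'I_m.+1]) ((fun x : E => x 0 i) @^-1` `[c.1 0 i, c.2 0 i]%classic).
  apply/seteqP; split => x h i; first by move=> _; have := h i; rewrite /= in_itv.
  by have := h i I; rewrite /= in_itv.
apply: closed_bigI => i _; apply: closed_comp; last exact: itv_closed.
by move=> x _; exact: coord_continuous.
Qed.

(** Take one minus the product over [k < j] of [(1 - bump (c k)) ^+ j]. Finitely many boxes give a
    compact support; the exponent [j] drives the product to zero at every point where some bump is
    positive. *)
Lemma cutoff_sequence U : open U -> exists chi : nat -> E -> R,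
  [/\ forall j, test_function U (chi j), forall j x, 0 <= chi j x <= 1 &
      forall x, U x -> chi j x @[j --> \oo] --> (1 : R)].
Proof.
move=> /open_union_boxes[c [Uc cU]].
pose P j : E -> R := \prod_(k < j) (1 - bump (c k)) ^+ j.
have PE j x : P j x = \prod_(k < j) (1 - bump (c k) x) ^+ j.
  rewrite /P fct_prodE; apply: eq_bigr => k _.
  by elim: {2 4}j => [//|l IH]; rewrite !exprS -IH.
have b01 k x : 0 <= 1 - bump (c k) x <= 1.
  by have /andP[h1 h2] := bump_le1 (c k) x; apply/andP; split; lra.
have P01 j x : 0 <= P j x <= 1.
  rewrite PE; apply/andP; split.
    by apply: prodr_ge0 => k _; rewrite exprn_ge0//; case/andP: (b01 k x).
  apply: prodr_ile1 => k _; case/andP: (b01 k x) => h1 h2.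
  by rewrite exprn_ge0//= exprn_ile1.
exists (fun j => 1 - P j); split.
- move=> j; split.
    apply: smoothB; first exact: smooth_cst.
    apply: smooth_prod => k; apply: smoothX; apply: smoothB; first exact: smooth_cst.
    exact: smooth_bump.
  exists (\big[setU/set0]_(k < j) closed_box (c k)); split.
  + by apply: bigsetU_compact => k _; exact: closed_box_compact.
  + by rewrite -(bigcup_mkord j (fun k => closed_box (c k))) => x [k /= kj]; exact: cU.
  + move=> x hx; rewrite -[LHS]/(1 - P j x) PE big1 ?subrr// => k _.
    rewrite bump_eq0 ?subr0 ?expr1n// => h; apply: hx; rewrite -(bigcup_mkord j (fun k => closed_box (c k))).
    by exists k => //=; exact: open_closed_box.
- by move=> j x; have /andP[h1 h2] := P01 j x; rewrite -![(1 - P j) x]/(1 - P j x); apply/andP; split; lra.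
- rewrite Uc => x [k0 _ xk0].
  have b0 := bump_gt0 xk0; have /andP[h1 h2] := b01 k0 x.
  have q : geometric 1 (1 - bump (c k0) x) @ \oo --> (0 : R).
    by apply: cvg_geometric; rewrite ger0_norm//; lra.
  apply/cvgrPdist_lt => e e0.
  have [N _ HN] := (cvgrPdist_lt _ _).1 q e e0.
  exists (maxn N k0.+1) => // j /=; rewrite geq_max => /andP[Nj kj].
  rewrite -[(1 - P j) x]/(1 - P j x) subKr.
  have := HN j Nj; rewrite /= sub0r normrN mul1r => /(le_lt_trans (ler_norm _)); apply: le_lt_trans.
  have /andP[p0 _] := P01 j x; rewrite ger0_norm// PE (bigD1 (Ordinal kj))//=.
  rewrite ler_piMr ?exprn_ge0//; apply: prodr_ile1 => k _.
  by case/andP: (b01 k x) => h3 h4; rewrite exprn_ge0//= exprn_ile1.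
Qed.

End cutoff.

(** * Test functions and the sign of a function from its integrals against them *)

Section test_functions.
Context {R : realType} {m : nat}.
Local Notation E := 'rV[R]_m.+1.
Local Notation mu := (@leb R m).
Implicit Types (f g phi : E -> R) (U Omega : set E).

Lemma ae_inW Omega (P : E -> Prop) : (forall x, Omega x -> P x) -> ae_in Omega P.
Proof. by move=> h; apply: aeW. Qed.

Lemma ae_in1 Omega (P Q : E -> Prop) : (forall x, Omega x -> P x -> Q x) ->
  ae_in Omega P -> ae_in Omega Q.
Proof. by move=> h; rewrite /ae_in; apply: filterS => x hP Ox; exact: (h x Ox (hP Ox)). Qed.

Lemma ae_in2 Omega (P Q S : E -> Prop) : (forall x, Omega x -> P x -> Q x -> S x) ->
  ae_in Omega P -> ae_in Omega Q -> ae_in Omega S.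
Proof. by move=> h; rewrite /ae_in; apply: filterS2 => x hP hQ Ox; exact: (h x Ox (hP Ox) (hQ Ox)). Qed.

Lemma ae_in3 Omega (P Q S U : E -> Prop) : (forall x, Omega x -> P x -> Q x -> S x -> U x) ->
  ae_in Omega P -> ae_in Omega Q -> ae_in Omega S -> ae_in Omega U.
Proof.
by move=> h; rewrite /ae_in; apply: filterS3 => x hP hQ hS Ox; exact: (h x Ox (hP Ox) (hQ Ox) (hS Ox)).
Qed.

Lemma ae_in_forall Omega (P : nat -> E -> Prop) : (forall n, ae_in Omega (P n)) ->
  ae_in Omega (fun x => forall n, P n x).
Proof. by rewrite /ae_in => /ae_foralln; apply: filterS => x h Ox n; exact: h. Qed.

Lemma partial_cvg phi i (x : E) : smooth phi ->
  h^-1 * (phi (h *: basis_vec i + x) - phi x) @[h --> (0 : R)^'] --> partial i phi x.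
Proof. by move=> sp; exact: (@smooth_derivable _ _ phi i x sp). Qed.

Lemma test_smooth Omega phi : test_function Omega phi -> smooth phi.
Proof. by case. Qed.

Lemma test_out Omega phi x : test_function Omega phi -> ~ Omega x -> phi x = 0.
Proof. by move=> [_ [K [_ KO K0]]] Ox; apply: K0 => /KO. Qed.

Lemma test_support Omega phi : test_function Omega phi ->
  exists K, [/\ compact K, K `<=` Omega & forall x, ~ K x -> phi x = 0].
Proof. by case. Qed.

Lemma test_sub U Omega phi : U `<=` Omega -> test_function U phi -> test_function Omega phi.
Proof.
by move=> UO [sp [K [cK KU K0]]]; split => //; exists K; split => //; exact: subset_trans UO.
Qed.

Lemma test_partial Omega i phi : test_function Omega phi -> test_function Omega (partial i phi).
Proof.
move=> [sp [K [cK KO K0]]]; split; first exact: smooth_partial.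
exists K; split => // x Kx.
have oK : open (~` K) by apply: closed_openC; apply: compact_closed => //; exact: norm_hausdorff.
rewrite /partial (@near_eq_derive _ _ _ phi (cst 0)) ?derive_cst//.
by apply: filterS (open_nbhs_nbhs (conj oK Kx)) => y /K0.
Qed.

Lemma testZD Omega (c : R) phi g : test_function Omega phi -> test_function Omega g ->
  test_function Omega (c *: phi + g).
Proof.
move=> [sp [K [cK KO K0]]] [sg [L [cL LO L0]]]; split.
  exact: smoothD (smoothZ c sp) sg.
exists (K `|` L); split; [exact: compactU|by move=> x []; [exact: KO|exact: LO]|].
move=> x /not_orP[Kx Lx].
by rewrite -[LHS]/(c * phi x + g x) K0// L0// mulr0 addr0.
Qed.

Lemma test0 Omega : test_function Omega (0 : E -> R).
Proof. by split; [exact: smooth_cst|exists set0; split => //; exact: compact0]. Qed.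

Lemma testM Omega g phi : smooth g -> test_function Omega phi -> test_function Omega (g * phi).
Proof.
move=> sg [sp [K [cK KO K0]]]; split; first exact: smoothM.
by exists K; split => // x /K0; rewrite -[(g * phi) x]/(g x * phi x) => ->; rewrite mulr0.
Qed.

Lemma test_comp Omega (T : R -> R) phi : T 0 = 0 -> smooth (T \o phi) ->
  test_function Omega phi -> test_function Omega (T \o phi).
Proof.
move=> T0 sT [sp [K [cK KO K0]]]; split=> //.
by exists K; split => // x /K0 /= ->.
Qed.

Lemma test_bounded Omega phi : test_function Omega phi -> exists2 M : R, 0 < M & forall x, `|phi x| <= M.
Proof.
move=> [sp [K [cK KO K0]]].
have cphi := smooth_continuous sp.
have /compact_bounded[M [Mr HM]] : compact (phi @` K).
  by apply: continuous_compact => //; exact: continuous_subspaceT.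
exists (`|M| + 1); first by have := normr_ge0 M; lra.
move=> x; have [Kx|/K0 ->] := pselect (K x); last by rewrite normr0 addr_ge0.
by apply: (HM (`|M| + 1)); [have := ler_norm M; lra|exists x].
Qed.

Lemma test_support_bounded Omega phi : test_function Omega phi ->
  exists2 M : R, 0 < M & forall x, M < `|x| -> phi x = 0.
Proof.
move=> [sp [K [/compact_bounded[M [Mr HM]] KO K0]]].
exists (`|M| + 1); first by have := normr_ge0 M; lra.
move=> x xM; apply: K0 => Kx.
have h : M < `|M| + 1 by have := ler_norm M; lra.
by have := HM _ h x Kx; rewrite /= leNgt xM.
Qed.

Lemma test_measurable Omega phi D : test_function Omega phi -> measurable_fun D phi.
Proof.
move=> tp; apply: measurable_funS (measurableT) (@subsetT _ D) _.
by apply: continuous_measurable_rV; exact: smooth_continuous (test_smooth tp).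
Qed.

Definition nball (M : R) : set E := [set x | `|x| <= M].

Lemma nball_measurable M : measurable (nball M).
Proof.
have -> : nball M = ~` [set x : E | M < `|x|].
  by apply/seteqP; split => x; rewrite /nball /= leNgt => /negP.
apply: measurableC; apply: open_measurable_rV.
rewrite (_ : [set x | _] = (fun x : E => `|x|) @^-1` [set y | M < y]); last by [].
apply: open_comp; last exact: open_gt.
by move=> x _; exact: norm_continuous.
Qed.

Lemma nball_finite M : (mu (nball M) < +oo)%E.
Proof.
apply: leb_bounded; exists M; split; first exact: num_real.
by move=> y My x /le_trans; apply; exact: ltW.
Qed.

Lemma integrable_cst_nball (c M : R) : mu.-integrable [set: E] (EFin \o (cst c \_ (nball M))).
Proof.
rewrite -restrict_EFin; apply/(integrable_mkcond _ (nball_measurable M)).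
apply: measurable_bounded_integrable; first exact: nball_measurable.
- exact: nball_finite.
- exact: measurable_cst.
- exists `|c|; split; first exact: num_real.
  by move=> y cy x _; exact: ltW.
Qed.

Lemma test_integrable Omega phi : test_function Omega phi -> mu.-integrable [set: E] (EFin \o phi).
Proof.
move=> tp; have [M M0 HM] := test_bounded tp; have [N N0 HN] := test_support_bounded tp.
apply: (integrable_ae_le measurableT _ (integrable_cst_nball M N)); first exact: test_measurable tp.
apply: aeW => x _; rewrite patchE; case: ifPn => [_|]; first exact: HM.
by rewrite notin_setE /nball /= => /negP; rewrite -ltNge => /HN ->; rewrite normr0.
Qed.

Lemma test_lipschitz Omega phi i : test_function Omega phi ->
  exists2 M : R, 0 < M & forall (h : R) x, 0 < h -> `|phi (h *: basis_vec i + x) - phi x| <= M * h.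
Proof.
move=> tp; have [M M0 HM] := test_bounded (test_partial i tp); exists M => // h x h0.
pose F (t : R) := phi (t *: basis_vec i + x).
have dF t : is_derive t (1 : R) F (partial i phi (t *: basis_vec i + x)).
  have h1 : is_derive (t *: basis_vec i + x) (basis_vec i) phi (partial i phi (t *: basis_vec i + x)).
    by apply: derivableP; exact: smooth_derivable (test_smooth tp).
  exact: (iffLR (is_derive_line_at phi x (basis_vec i) _ t) h1).
have [|c _] := @MVT R F (fun t => partial i phi (t *: basis_vec i + x)) 0 h h0.
  apply: continuous_subspaceT => t; apply: differentiable_continuous; apply/derivable1_diffP.
  exact: (@ex_derive _ _ _ _ _ _ _ (dF t)).
rewrite /F scale0r add0r subr0 => ->; rewrite normrM (gtr0_norm h0).
by rewrite ler_wpM2r// ltW.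
Qed.

Lemma harmonic_dnbhs0 : harmonic @ \oo --> (0 : R)^'.
Proof.
move=> A [e /= e0 HA].
have [N _ HN] := (cvgrPdist_lt _ _).1 (@cvg_harmonic R) e e0.
by exists N => // n /HN hn; apply: HA => //=; rewrite gt_eqF// invr_gt0.
Qed.

Lemma norm_basis_vec i : `|basis_vec i : E| <= 1.
Proof.
rewrite [leLHS]/Num.norm /= mx_normrE; apply: bigmax_le => // -[j k] _ /=.
by rewrite mxE; case: (_ && _); rewrite ?normr1 ?normr0.
Qed.

(* Difference quotients of [phi] integrate to zero by translation invariance. *)
Lemma integral_partial0 Omega phi i : test_function Omega phi ->
  \int[mu]_x partial i phi x = 0.
Proof.
move=> tp; have [M M0 HM] := test_lipschitz i tp; have [N N0 HN] := test_support_bounded tp.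
have ip := test_integrable tp.
pose sphi k : E -> R := fun x => phi (harmonic k *: basis_vec i + x).
pose D k x := (harmonic k)^-1 * (sphi k x - phi x) : R.
have hk0 k : 0 < @harmonic R k by rewrite invr_gt0.
have hk1 k : @harmonic R k <= 1 by rewrite invf_le1 ?ler1n.
have mp := test_measurable (D := setT) tp.
have ips k : mu.-integrable setT (EFin \o sphi k).
  rewrite (_ : _ \o _ = (fun x => (EFin \o phi) (x + harmonic k *: basis_vec i))); last first.
    by apply/funext => x; rewrite /sphi /= addrC.
  exact: integrable_shift.
have iD k : \int[mu]_x D k x = 0.
  rewrite /D RintegralZl//; last first.
    rewrite (_ : _ \o _ = (EFin \o sphi k) \- (EFin \o phi))%E//.
    exact: integrableB.
  rewrite RintegralB//.
  rewrite (_ : Rintegral mu setT (sphi k) = Rintegral mu setT phi).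
    by rewrite subrr mulr0.
  rewrite /Rintegral; congr fine; rewrite -[RHS](integral_shift (harmonic k *: basis_vec i))//.
  by apply: eq_integral => x _; rewrite /sphi /= addrC.
have mpi := test_measurable (D := setT) (test_partial i tp).
(* The shifts have length at most [1], so all difference quotients vanish outside of the ball of
   radius [N + 1], and there the Lipschitz constant dominates them. *)
have [|||||_ _ H] := @dominated_convergence _ _ _ mu setT measurableT (fun k x => (D k x)%:E)
  (fun x => (partial i phi x)%:E) (fun x => ((cst M) \_ (nball (N + 1)) x)%:E).
- move=> k; apply/measurable_EFinP; apply: measurable_funM; first exact: measurable_cst.
  apply: measurable_funB => //; apply/measurable_EFinP; exact: measurable_int (ips k).
- exact/measurable_EFinP.
- apply: aeW => x _; apply: cvg_EFin; first exact: nearW.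
  have dl := @partial_cvg phi i x (test_smooth tp).
  exact: (cvg_comp _ _ harmonic_dnbhs0 dl).
- exact: integrable_cst_nball.
- apply: aeW => x k _; rewrite abse_EFin lee_fin patchE; case: ifPn => [_|].
    rewrite /D normrM normfV (gtr0_norm (hk0 k)) ler_pdivrMl// mulrC; exact: HM.
  rewrite notin_setE /nball /= => /negP; rewrite -ltNge => hx.
  rewrite /D /sphi !HN ?subrr ?mulr0 ?normr0//; first by lra.
  have := ler_normB (harmonic k *: basis_vec i + x) (harmonic k *: basis_vec i).
  rewrite addrAC subrr add0r normrZ (gtr0_norm (hk0 k)).
  have := norm_basis_vec i => hb h.
  have : harmonic k * `|basis_vec i : E| <= 1 by rewrite mulr_ile1// ltW.
  by lra.
have H0 : (\int[mu]_x (D k x)%:E)%E @[k --> \oo] --> (0%R%:E).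
  apply: cvg_near_cst; apply: nearW => k.
  have := iD k; rewrite /Rintegral => <-; rewrite fineK//.
  apply: integrable_fin_num => //.
  rewrite (_ : (fun _ => _) = (fun x => ((harmonic k)^-1)%:E * ((EFin \o sphi k) \- (EFin \o phi)) x)%E)//.
  by apply: integrableZl => //; exact: integrableB.
by have := cvg_unique _ H H0; rewrite /Rintegral => ->.
Qed.

(** Cut-off sequences show that [g] has a nonnegative integral over every open subset. If the
    integral over [A], the set where [g < 0], were negative, it would remain so on an open set
    containing [A] and close to it in measure, by absolute continuity of the integral. *)
Lemma nonneg_of_tests Omega g : open Omega -> (mu Omega < +oo)%E ->
  mu.-integrable Omega (EFin \o g) ->
  (forall phi, test_function Omega phi -> (forall x, 0 <= phi x) ->
     0 <= \int[mu]_(x in Omega) (g x * phi x)) ->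
  ae_in Omega (fun x => 0 <= g x).
Proof.
move=> oO fO ig Hg; have mO := open_measurable_rV oO.
have mg : measurable_fun Omega g by apply/measurable_EFinP; exact: measurable_int ig.
have HU U : open U -> U `<=` Omega -> 0 <= \int[mu]_(x in U) g x.
  move=> oU UO; have mU := open_measurable_rV oU.
  have [chi [tchi chi01 chi1]] := cutoff_sequence oU.
  have -> : \int[mu]_(x in U) g x = \int[mu]_(x in Omega) (g \_ U) x.
    by rewrite -Rintegral_mkcondr setIidr.
  have [|||||_ _ H] := @dominated_convergence _ _ _ mu Omega mO
     (fun k x => (g x * chi k x)%:E) (fun x => ((g \_ U) x)%:E) (fun x => `|g x|%:E).
  - move=> k; apply/measurable_EFinP; apply: measurable_funM => //.
    exact: test_measurable (tchi k).
  - apply/measurable_EFinP; apply/measurable_restrict => //.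
    by apply: measurable_funS mO _ mg; exact: subIsetl.
  - apply: aeW => x Ox; apply: cvg_EFin; first exact: nearW.
    rewrite patchE; case: ifPn => [/set_mem Ux|/negP Ux].
      rewrite -[X in _ --> X]mulr1.
      by apply: cvgM; [exact: cvg_cst|exact: chi1].
    apply: cvg_near_cst; apply: nearW => k /=; rewrite (test_out (tchi k)) ?mulr0//.
    by move=> Ux'; apply: Ux; exact: mem_set.
  - exact: integrable_abse ig.
  - apply: aeW => x k _; rewrite abse_EFin lee_fin normrM ler_piMr//.
    by have /andP[c0 c1] := chi01 k x; rewrite ger0_norm.
  have gU0 : (0 <= \int[mu]_(x in Omega) ((g \_ U) x)%:E)%E.
    rewrite -(cvg_lim _ H)//; apply: lime_ge; first by apply/cvg_ex; eexists; exact: H.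
    apply: nearW => k /=; rewrite -[X in (_ <= X)%E]fineK.
      rewrite lee_fin; apply: Hg; first exact: test_sub UO (tchi k).
      by move=> x; case/andP: (chi01 k x).
    apply: integrable_fin_num => //.
    apply: (integrable_ae_le mO (g := (fun x => `|g x|))).
    - apply: measurable_funM => //; exact: test_measurable (tchi k).
    - exact: integrable_abse ig.
    - apply: aeW => x _; rewrite normrM ler_piMr//.
      by have /andP[c0 c1] := chi01 k x; rewrite ger0_norm.
  by rewrite /Rintegral fine_ge0.
pose A := Omega `&` g @^-1` `]-oo, 0[%classic.
have mA : measurable A by exact: mg.
have AO : A `<=` Omega by exact: subIsetl.
have iA : mu.-integrable A (EFin \o g) by exact: integrableS ig.
have ifT : mu.-integrable setT (EFin \o (g \_ Omega)).
  by rewrite -restrict_EFin; apply/(integrable_mkcond _ mO).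
have fA : (mu A < +oo)%E by apply: le_lt_trans fO; apply: le_measure => //; rewrite inE.
have A0 : 0 <= \int[mu]_(x in A) g x.
  rewrite leNgt; apply/negP => A0; set e := - \int[mu]_(x in A) g x.
  have e0 : 0 < e by rewrite oppr_gt0.
  have [dl [dl0 Hdl]] := integral_normr_continuous ifT e0.
  have [V [oV AV hV]] := leb_outer_open_approx fA (divr_gt0 dl0 (ltr0Sn R 1)).
  pose U := V `&` Omega.
  have oU : open U by exact: openI.
  have mU := open_measurable_rV oU.
  have AU : A `<=` U by move=> x Ax; split; [exact: AV|exact: AO].
  have UO : U `<=` Omega by exact: subIsetr.
  have mUA : measurable (U `\` A) by exact: measurableD.
  have hUA : (mu (U `\` A) < dl%:E)%E.
    rewrite measureD//=; last by apply: le_lt_trans fO; apply: le_measure => //; rewrite inE.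
    rewrite (setIidr AU) lteBlDr; last by rewrite ge0_fin_numE// measure_ge0.
    apply: (@le_lt_trans _ _ (mu A + (dl / 2)%:E)%E).
      by apply: le_trans hV; apply: le_leb_outer; exact: subIsetl.
    by rewrite addeC lteD2rE ?lte_fin; [lra|rewrite ge0_fin_numE// measure_ge0].
  have := Hdl _ mUA hUA.
  have -> : \int[mu]_(x in U `\` A) `|(g \_ Omega) x| = \int[mu]_(x in U `\` A) `|g x|.
    by apply: eq_Rintegral => x /set_mem[/UO Ox _]; rewrite patchE mem_set.
  have iUA : mu.-integrable (U `\` A) (EFin \o g).
    by apply: integrableS ig => // x [/UO].
  have := le_normr_Rintegral mUA iUA.
  have := HU _ oU UO.
  rewrite -{1}(setDKU AU) setUC Rintegral_setU//.
  - have := ler_norm (\int[mu]_(x in U `\` A) g x); rewrite /e.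
    by move: (Rintegral _ _ _) (Rintegral _ A _) (Rintegral _ (U `\` A) (fun x => `|g x|)); clear; move=> *; lra.
  - by rewrite setUC setDKU//; exact: integrableS ig.
  - by apply/disj_setPS => x [Ax [_ /(_ Ax)]].
have NgA : \forall x \ae mu, A x -> - g x = 0.
  apply: (Rintegral0_ae mA).
  - exact: integrableN iA.
  - by apply: aeW => x [_]; rewrite /= in_itv /= => /ltW; rewrite oppr_ge0.
  - have -> : (fun x => - g x) = (fun x => -1 * g x) by apply/funext => x; rewrite mulN1r.
    by rewrite RintegralZl// mulN1r oppr_le0.
apply: filterS NgA => x h Ox; rewrite leNgt; apply/negP => gx.
have /h/eqP : A x by split => //; rewrite /= in_itv.
by rewrite oppr_eq0 lt_eqF.
Qed.

Lemma zero_of_tests Omega g : open Omega -> (mu Omega < +oo)%E ->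
  mu.-integrable Omega (EFin \o g) ->
  (forall phi, test_function Omega phi -> \int[mu]_(x in Omega) (g x * phi x) = 0) ->
  ae_in Omega (fun x => g x = 0).
Proof.
move=> oO fO ig Hg; have mO := open_measurable_rV oO.
have h1 : ae_in Omega (fun x => 0 <= g x).
  by apply: nonneg_of_tests => // phi tp _; rewrite Hg.
have h2 : ae_in Omega (fun x => 0 <= - g x).
  apply: nonneg_of_tests => //; first exact: integrableN ig.
  move=> phi tp _; under eq_Rintegral => x _ do rewrite mulNr -mulrN.
  have -> : (fun x => g x * - phi x) = (fun x => g x * (-1 *: phi + 0) x).
    by apply/funext => x; rewrite -[(_ + _) x]/(-1 * phi x + 0) addr0 mulN1r.
  by rewrite Hg//; apply: testZD => //; exact: test0.
by apply: ae_in2 h1 h2 => x Ox a b; apply/eqP; rewrite eq_le -oppr_ge0 b//= a.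
Qed.

End test_functions.

(** * Sobolev spaces *)

Definition bounded_open {R : realType} {m : nat} (Omega : set 'rV[R]_m.+1) : Prop :=
  open Omega /\ bounded_set Omega.

HB.lock Definition dirichlet {R : realType} {m : nat} (Omega : set 'rV[R]_m.+1)
  (u v : 'rV[R]_m.+1 -> R) : R := innerL2_vec Omega (wgrad Omega u) (wgrad Omega v).

HB.lock Definition sobolev_ip {R : realType} {m : nat} (Omega : set 'rV[R]_m.+1)
  (u v : 'rV[R]_m.+1 -> R) : R := ip leb Omega u v + dirichlet Omega u v.

Section sobolev_basics.
Context {R : realType} {m : nat}.
Local Notation E := 'rV[R]_m.+1.
Local Notation mu := (@leb R m).
Context (Omega : set E) (dO : bounded_open Omega).
Implicit Types (u v phi : E -> R) (g h : E -> E).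
Local Notation sq := (sqint mu Omega : set (E -> R)).
Local Notation ip := (ip mu Omega).

Lemma domain_measurable : measurable Omega.
Proof. exact: open_measurable_rV dO.1. Qed.
Let mO := domain_measurable.

Lemma domain_finite : (mu Omega < +oo)%E.
Proof. exact: leb_bounded dO.2. Qed.
Let fO := domain_finite.

Definition ip_form : semi_inner sq ip := ip_semi_inner mu mO.
Let sF := ip_form.
Let ss : subspace sq := si_sub sF.

Lemma L2P u : L2 Omega u <-> sq u.
Proof.
rewrite /L2; split => [h|[mu_ iu]].
  have mf : measurable_fun setT (u \_ Omega).
    by move: h; rewrite inE => /andP[+ _]; rewrite inE.
  split; first by move: mf => /(measurable_restrict _ mO measurableT); rewrite setTI.
  have := Lfun2_integrable_sqr h.
  rewrite (_ : _ \o _ = (fun x => (u x ^+ 2)%:E) \_ Omega); last first.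
    apply/funext => x /=; rewrite !patchE; case: ifPn => // _; by rewrite expr0n.
  by move/(integrable_mkcond _ mO).
rewrite inE; apply/andP; split; rewrite inE /=.
  by apply/measurable_restrict => //; rewrite setTI.
rewrite /finite_norm unlock /=; apply: poweR_lty.
have /integrableP[_] := iu; apply: le_lt_trans.
rewrite [leRHS]integral_mkcond; apply: ge0_le_integral => //.
- under eq_fun do rewrite powR_mulrn//.
  apply/measurable_EFinP; apply: measurable_funX; apply: measurableT_comp => //.
  by apply/measurable_restrict => //; rewrite setTI.
- apply/(measurable_restrict _ mO measurableT); rewrite setTI.
  by apply: measurableT_comp => //; exact: measurable_int iu.
- move=> x _; rewrite !patchE; case: ifPn => _ /=.
    by rewrite powR_mulrn// lee_fin normrX.
  have -> : (point : R) = 0 by [].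
  by rewrite normr0 powR0.
Qed.

Lemma sq_bounded u (M : R) : measurable_fun Omega u ->
  ae_in Omega (fun x => `|u x| <= M) -> sq u.
Proof.
move=> mu_ uM; apply: (@sqint_ae_le _ _ _ mu _ mO u (cst M)) => //.
  split; first exact: measurable_cst.
  rewrite (_ : (fun _ => _) = EFin \o cst (M ^+ 2))//.
  apply: (measurable_bounded_integrable mO fO); first exact: measurable_cst.
  exists (`|M ^+ 2|); split; first exact: num_real.
  by move=> y hy x _; exact: ltW.
by apply: ae_in1 uM => x _ h; rewrite (le_trans h)// ler_norm.
Qed.

Lemma sq_cst (c : R) : sq (cst c).
Proof. by apply: (@sq_bounded _ `|c|); [exact: measurable_cst|exact: ae_inW]. Qed.

Lemma sq_integrable u : sq u -> mu.-integrable Omega (EFin \o u).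
Proof.
move=> su; have := sqint_mul mO su (sq_cst 1).
by under eq_fun do rewrite mulr1.
Qed.

Lemma test_sq phi : test_function Omega phi -> sq phi.
Proof.
move=> tp; have [M _ HM] := test_bounded tp.
by apply: (@sq_bounded _ M); [exact: test_measurable tp|apply: ae_inW => x _].
Qed.

Definition cmp (i : 'I_m.+1) g : E -> R := fun x => g x 0 i.

Definition sqv g := forall i, sq (cmp i g).

Lemma innerL2_vecE g h : sqv g -> sqv h ->
  innerL2_vec Omega g h = \sum_i ip (cmp i g) (cmp i h).
Proof.
move=> sg sh; rewrite /innerL2_vec /Rintegral.
under eq_integral => x _ do rewrite /dot -sumEFin.
rewrite (integral_sum mO); last by move=> i; exact: (sqint_mul mO (sg i) (sh i)).
rewrite (_ : (\sum_(i < m.+1) _)%E = (\sum_i ip (cmp i g) (cmp i h))%:E)//.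
by rewrite -sumEFin; apply: eq_bigr => i _; rewrite (ipE mO (sg i) (sh i)).
Qed.

Lemma innerL2_vec_ge0 g h : sqv g -> sqv h ->
  ae_in Omega (fun x => 0 <= dot (g x) (h x)) -> 0 <= innerL2_vec Omega g h.
Proof.
move=> sg sh gh.
have mD : measurable_fun Omega (fun x => dot (g x) (h x)).
  apply: measurable_sum => i.
  by apply: measurable_funM; [exact: (sg i).1|exact: (sh i).1].
rewrite /innerL2_vec (@ae_eq_Rintegral _ _ _ mu _ mO _ (fun x => Num.max (dot (g x) (h x)) 0)) => //.
- by apply: Rintegral_ge0 => x _; rewrite le_max lexx orbT.
- by apply: measurable_maxr => //; exact: measurable_cst.
- by apply: ae_in1 gh => x _ h0; rewrite max_l.
Qed.

Lemma test_ip_partial phi psi i : test_function Omega phi -> test_function Omega psi ->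
  ip phi (partial i psi) = - ip (partial i phi) psi.
Proof.
move=> tp tq.
have tpq : test_function Omega (phi * psi) by apply: testM => //; exact: test_smooth tp.
rewrite !ip_def; have := integral_partial0 i tpq.
have E1 x : partial i (phi * psi) x = phi x * partial i psi x + partial i phi x * psi x.
  rewrite /partial deriveM; [|exact: (smooth_derivable (test_smooth tp))|exact: (smooth_derivable (test_smooth tq))].
  by rewrite -![_ *: _]/(_ * _) [X in _ + X]mulrC.
have -> : \int[mu]_x partial i (phi * psi) x = \int[mu]_(x in Omega) partial i (phi * psi) x.
  rewrite [RHS]Rintegral_mkcond; apply: eq_Rintegral => x _; rewrite patchE.
  case: ifPn => //; rewrite notin_setE => Ox.
  exact: test_out (test_partial i tpq) Ox.
under eq_Rintegral => x _ do rewrite E1.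
rewrite RintegralD//.
- by move/eqP; rewrite addr_eq0 => /eqP.
- by apply: sqint_mul => //; [exact: test_sq|apply: test_sq; exact: test_partial].
- by apply: sqint_mul => //; [apply: test_sq; exact: test_partial|exact: test_sq].
Qed.

Definition has_weak_grad u g := forall i, sq (cmp i g) /\
  forall phi, test_function Omega phi -> ip u (partial i phi) = - ip (cmp i g) phi.

Lemma is_weak_gradP u g : is_weak_grad Omega u g <-> has_weak_grad u g.
Proof.
by split => h i; have [h1 h2] := h i; split => [|phi tp]; try (by apply/L2P);
  have := h2 phi tp; rewrite !ip_def.
Qed.

Lemma H1P u : H1 Omega u <-> sq u /\ exists g, is_weak_grad Omega u g.
Proof. by rewrite /H1 L2P. Qed.

Lemma wgrad_xget u g : is_weak_grad Omega u g -> is_weak_grad Omega u (wgrad Omega u).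
Proof. by move=> ug; exact: (xgetPex (cst 0) (ex_intro [set g | is_weak_grad Omega u g] g ug)). Qed.

Lemma innerL2E u v : innerL2 Omega u v = ip u v. Proof. by rewrite ip_def. Qed.

Lemma dirichlet_wgrad u v : sqv (wgrad Omega u) -> sqv (wgrad Omega v) ->
  dirichlet Omega u v = \sum_i ip (cmp i (wgrad Omega u)) (cmp i (wgrad Omega v)).
Proof. by rewrite dirichlet.unlock; exact: innerL2_vecE. Qed.

Lemma sobolev_ipE u v : sobolev_ip Omega u v = ip u v + dirichlet Omega u v.
Proof. by rewrite sobolev_ip.unlock. Qed.

Lemma H1_normE u : H1_norm Omega u = Num.sqrt (sobolev_ip Omega u u).
Proof. by rewrite sobolev_ipE dirichlet.unlock ip_def. Qed.

End sobolev_basics.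

(* Unification would otherwise unfold integrals over [leb]. *)
Global Opaque leb leb_outer L2 innerL2 innerL2_vec wgrad is_weak_grad H1 H1_norm
  test_function smooth.

Section sobolev.
Context {R : realType} {m : nat}.
Local Notation E := 'rV[R]_m.+1.
Local Notation mu := (@leb R m).
Context (Omega : set E) (dO : bounded_open Omega).
Implicit Types (u v phi : E -> R) (g h : E -> E).
Local Notation sq := (sqint mu Omega : set (E -> R)).
Local Notation ip := (ip mu Omega).
Local Notation sqv := (sqv Omega).
Local Notation dirichlet := (dirichlet Omega).
Local Notation sobolev_ip := (sobolev_ip Omega).
Let mO := domain_measurable dO.
Let fO := domain_finite dO.
Let sF := ip_form dO.
Let ss : subspace sq := si_sub sF.

Lemma weak_grad_sqv u g : is_weak_grad Omega u g -> sqv g.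
Proof. by move=> /(is_weak_gradP dO) ug i; exact: (ug i).1. Qed.

Definition grad phi : E -> E := fun x => \row_i partial i phi x.

Lemma cmp_grad i phi : cmp i (grad phi) = partial i phi.
Proof. by apply/funext => x; rewrite /cmp /grad mxE. Qed.

Lemma test_weak_grad phi : test_function Omega phi -> is_weak_grad Omega phi (grad phi).
Proof.
move=> tp; apply/(is_weak_gradP dO) => i; rewrite cmp_grad; split.
  by apply: test_sq => //; exact: test_partial.
by move=> psi tq; exact: test_ip_partial.
Qed.

Lemma weak_grad_unique u g h : is_weak_grad Omega u g -> is_weak_grad Omega u h ->
  ae_in Omega (fun x => g x = h x).
Proof.
move=> ug uh.
have sg := weak_grad_sqv ug; have sh := weak_grad_sqv uh.
move: ug uh => /(is_weak_gradP dO) ug /(is_weak_gradP dO) uh.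
have H i : ae_in Omega (fun x => (cmp i g - cmp i h) x = 0).
  apply: (zero_of_tests dO.1 fO).
    apply: (sq_integrable dO); exact: (subB ss (sg i) (sh i)).
  move=> phi tp; have sp := test_sq dO tp.
  rewrite -ip_def (linB ss (linear_forml sF sp) (sg i) (sh i)).
  have := (ug i).2 phi tp; rewrite ((uh i).2 phi tp) => /oppr_inj E1.
  by apply/eqP; rewrite subr_eq0; apply/eqP; symmetry.
have : \forall x \ae mu, forall i : 'I_m.+1, Omega x -> (cmp i g - cmp i h) x = 0.
  exact: filter_forall.
apply: filterS => x hx Ox; apply/rowP => i; apply/eqP; rewrite -subr_eq0; apply/eqP.
exact: hx.
Qed.

Lemma H1_sq u : H1 Omega u -> sq u.
Proof. by case/(H1P dO). Qed.

Lemma wgradP u : H1 Omega u -> is_weak_grad Omega u (wgrad Omega u).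
Proof. by case/(H1P dO) => _ [g ug]; exact: wgrad_xget ug. Qed.

Lemma wgrad_sqv u : H1 Omega u -> sqv (wgrad Omega u).
Proof. by move=> /wgradP/weak_grad_sqv. Qed.

Lemma wgradE u g : is_weak_grad Omega u g -> ae_in Omega (fun x => wgrad Omega u x = g x).
Proof.
by move=> ug; exact: weak_grad_unique (wgrad_xget ug) ug.
Qed.

Lemma weak_gradZD (c : R) u v g h : sq u -> sq v ->
  is_weak_grad Omega u g -> is_weak_grad Omega v h ->
  is_weak_grad Omega (c *: u + v) (fun x => c *: g x + h x).
Proof.
move=> su sv ug vh; apply/(is_weak_gradP dO) => i.
have E1 : cmp i (fun x => c *: g x + h x) = c *: cmp i g + cmp i h.
  by apply/funext => x; rewrite /cmp !mxE.
have sg := weak_grad_sqv ug i; have sh := weak_grad_sqv vh i.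
move: ug vh => /(is_weak_gradP dO)/(_ i)[_ ug] /(is_weak_gradP dO)/(_ i)[_ vh].
rewrite E1; split; first exact: ss.2.
move=> phi tp; have sp := test_sq dO tp; have sdp := test_sq dO (test_partial i tp).
by rewrite (si_lin sF c su sv sdp) (si_lin sF c sg sh sp) ug// vh// mulrN -opprD.
Qed.

Lemma H1ZD (c : R) u v : H1 Omega u -> H1 Omega v -> H1 Omega (c *: u + v).
Proof.
case/(H1P dO) => su [g ug] /(H1P dO)[sv [h vh]]; apply/(H1P dO); split; first exact: ss.2.
by exists (fun x => c *: g x + h x); exact: weak_gradZD.
Qed.

Lemma test_H1 phi : test_function Omega phi -> H1 Omega phi.
Proof.
move=> tp; apply/(H1P dO); split; first exact: test_sq.
by exists (grad phi); exact: test_weak_grad.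
Qed.

Lemma H1_subspace : subspace (H1 Omega).
Proof.
by split; [exact: test_H1 (test0 _)|move=> c u v; exact: H1ZD].
Qed.

Lemma ip_cmp_ae g g' h h' : sqv g -> sqv g' -> sqv h -> sqv h' ->
  ae_in Omega (fun x => g x = g' x) -> ae_in Omega (fun x => h x = h' x) ->
  \sum_i ip (cmp i g) (cmp i h) = \sum_i ip (cmp i g') (cmp i h').
Proof.
move=> sg sg' sh sh' gg hh; apply: eq_bigr => i _.
apply: ae_eq_ip => //; try exact: (sg i).1; try exact: (sg' i).1; try exact: (sh i).1; try exact: (sh' i).1.
- by apply: ae_in1 gg => x _ e; rewrite /cmp e.
- by apply: ae_in1 hh => x _ e; rewrite /cmp e.
Qed.

Lemma dirichletE u v g h : is_weak_grad Omega u g -> is_weak_grad Omega v h ->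
  dirichlet u v = \sum_i ip (cmp i g) (cmp i h).
Proof.
move=> ug vh; have gE := wgradE ug; have hE := wgradE vh.
have sg := weak_grad_sqv ug; have sh := weak_grad_sqv vh.
have su := weak_grad_sqv (wgrad_xget ug); have sv := weak_grad_sqv (wgrad_xget vh).
by rewrite (dirichlet_wgrad dO su sv); exact: ip_cmp_ae.
Qed.

Lemma dirichlet_form : semi_inner (H1 Omega) dirichlet.
Proof.
split; first exact: H1_subspace.
- move=> u v hu hv; rewrite !(dirichletE (wgradP hu) (wgradP hv)) (dirichletE (wgradP hv) (wgradP hu)).
  apply: eq_bigr => i _; apply: (si_sym sF); exact: wgrad_sqv.
- move=> c u v w hu hv hw.
  rewrite (dirichletE (weak_gradZD c (H1_sq hu) (H1_sq hv) (wgradP hu) (wgradP hv)) (wgradP hw)).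
  rewrite (dirichletE (wgradP hu) (wgradP hw)) (dirichletE (wgradP hv) (wgradP hw)).
  rewrite mulr_sumr -big_split /=; apply: eq_bigr => i _.
  rewrite -(si_lin sF); [|exact: wgrad_sqv..].
  by congr ip; apply/funext => x; rewrite /cmp !mxE.
- move=> u hu; rewrite (dirichletE (wgradP hu) (wgradP hu)).
  apply: sumr_ge0 => i _; apply: (si_pos sF); exact: wgrad_sqv.
Qed.

Lemma sobolev_form : semi_inner (H1 Omega) sobolev_ip.
Proof.
have dF := dirichlet_form; split; first exact: H1_subspace.
- by move=> u v hu hv; rewrite !sobolev_ipE (si_sym sF (H1_sq hu) (H1_sq hv)) (si_sym dF hu hv).
- move=> c u v w hu hv hw; rewrite !sobolev_ipE (si_lin dF c hu hv hw).
  by rewrite (si_lin sF c (H1_sq hu) (H1_sq hv) (H1_sq hw)) addrACA -mulrDr.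
- move=> u hu; rewrite sobolev_ipE addr_ge0//; first exact: (si_pos sF (H1_sq hu)).
  exact: (si_pos dF).
Qed.

(** The gradients are parameters because [wgrad] is only some representative, whereas concrete
    gradients come from the chain rule or from test functions. *)
Lemma sobolev_cvgP (v : nat -> E -> R) u (gv : nat -> E -> E) g : (forall n, H1 Omega (v n)) -> H1 Omega u ->
  (forall n, is_weak_grad Omega (v n) (gv n)) -> is_weak_grad Omega u g ->
  form_cvg sobolev_ip v u <->
  form_cvg ip v u /\ forall i, form_cvg ip (fun n => cmp i (gv n)) (cmp i g).
Proof.
move=> hv hu vg ug.
have sg := weak_grad_sqv ug; have sgv n := weak_grad_sqv (vg n).
have E1 n : dirichlet (v n - u) (v n - u) =
    \sum_i ip (cmp i (gv n) - cmp i g) (cmp i (gv n) - cmp i g).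
  have W := weak_gradZD (-1) (H1_sq hu) (H1_sq (hv n)) ug (vg n).
  have -> : v n - u = -1 *: u + v n by rewrite scaleN1r addrC.
  rewrite (dirichletE W W); apply: eq_bigr => i _.
  have -> : cmp i (fun x => -1 *: g x + gv n x) = cmp i (gv n) - cmp i g.
    by apply/funext => x; rewrite /cmp !mxE mulN1r addrC.
  by [].
have P n i : 0 <= ip (cmp i (gv n) - cmp i g) (cmp i (gv n) - cmp i g).
  by apply: (si_pos sF); apply: (subB ss); [exact: sgv|exact: sg].
have Pv n : 0 <= ip (v n - u) (v n - u).
  by apply: (si_pos sF); apply: (subB ss); exact: H1_sq.
have Ps n : 0 <= \sum_i ip (cmp i (gv n) - cmp i g) (cmp i (gv n) - cmp i g).
  by apply: sumr_ge0 => i _; exact: P.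
split => [H|[H1 H2]].
  split => [|i] e e0; have [N HN] := H e e0; exists N => n /HN; rewrite sobolev_ipE E1.
    by apply: le_lt_trans; rewrite lerDl.
  apply: le_lt_trans; rewrite (bigD1 i)//= addrCA lerDl addr_ge0//.
  by apply: sumr_ge0 => j _; exact: P.
move=> e e0.
have e1 : 0 < e / 2 / m.+1%:R by rewrite !divr_gt0.
have [N HN] := H1 _ (divr_gt0 e0 (ltr0Sn R 1)).
have /choice[K HK] := fun i => H2 i _ e1.
exists (maxn N (\max_i K i)) => n; rewrite geq_max => /andP[/HN h1 h2].
rewrite sobolev_ipE E1.
have : \sum_i ip (cmp i (gv n) - cmp i g) (cmp i (gv n) - cmp i g) <= \sum_(i < m.+1) (e / 2 / m.+1%:R).
  apply: ler_sum => i _; apply/ltW/HK; apply: leq_trans h2; exact: leq_bigmax.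
rewrite sumr_const card_ord -[_ *+ _]mulr_natr divfK//; lra.
Qed.

Lemma weak_grad_limit (v : nat -> E -> R) (gv : nat -> E -> E) u g :
  (forall n, sq (v n)) -> sq u -> sqv g ->
  (forall n, is_weak_grad Omega (v n) (gv n)) -> form_cvg ip v u ->
  (forall i, form_cvg ip (fun n => cmp i (gv n)) (cmp i g)) ->
  is_weak_grad Omega u g.
Proof.
move=> sv su sg vg vu gvg; apply/(is_weak_gradP dO) => i; split; first exact: sg.
move=> phi tp; have sp := test_sq dO tp; have sdp := test_sq dO (test_partial i tp).
have c1 := form_cvgr sF sv su sdp vu.
have c2 := form_cvgr sF (fun n => weak_grad_sqv (vg n) i) (sg i) sp (gvg i).
have c3 : - ip phi (cmp i (gv n)) @[n --> \oo] --> - ip phi (cmp i g) by exact: cvgN.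
have : (fun n => ip (partial i phi) (v n)) = (fun n => - ip phi (cmp i (gv n))).
  apply/funext => n; rewrite (si_sym sF sdp (sv n)) (si_sym sF sp (weak_grad_sqv (vg n) i)).
  by have /(is_weak_gradP dO)/(_ i)[_] := vg n; apply.
move=> E1; rewrite E1 in c1; have := cvg_unique _ c1 c3.
rewrite (si_sym sF sdp su) (si_sym sF sp (sg i)); exact.
Qed.

Lemma sobolev_complete : form_complete (H1 Omega) sobolev_ip.
Proof.
move=> v hv cv.
have dF := dirichlet_form; have sS := H1_subspace.
have cu : form_cauchy ip v.
  move=> e e0; have [N HN] := cv e e0; exists N => n k Nn Nk; apply: le_lt_trans (HN n k Nn Nk).
  by rewrite sobolev_ipE lerDl; apply: (si_pos dF); apply: (subB sS).
have cg i : form_cauchy ip (fun n => cmp i (wgrad Omega (v n))).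
  move=> e e0; have [N HN] := cv e e0; exists N => n k Nn Nk; apply: le_lt_trans (HN n k Nn Nk).
  have W := weak_gradZD (-1) (H1_sq (hv k)) (H1_sq (hv n)) (wgradP (hv k)) (wgradP (hv n)).
  have -> : v n - v k = -1 *: v k + v n by rewrite scaleN1r addrC.
  rewrite sobolev_ipE (dirichletE W W) (bigD1 i)//= addrCA.
  rewrite (_ : cmp i (wgrad Omega (v n)) - _ = cmp i (fun x => -1 *: wgrad Omega (v k) x + wgrad Omega (v n) x)); last first.
    by apply/funext => x; rewrite /cmp !mxE mulN1r addrC.
  rewrite lerDl addr_ge0//; first by apply: (si_pos sF); apply: ss.2; exact: H1_sq.
  by apply: sumr_ge0 => j _; apply: (si_pos sF); exact: (weak_grad_sqv W).
have [u su vu] := ip_complete mO (fun n => H1_sq (hv n)) cu.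
have hg (i : 'I_m.+1) : exists g : E -> R, sq g /\ form_cvg ip (fun n => cmp i (wgrad Omega (v n))) g.
  have [g sg H] := ip_complete mO (fun n => wgrad_sqv (hv n) i) (cg i).
  by exists g.
have /choice[gg Hg] := hg.
pose g : E -> E := fun x => \row_i gg i x.
have gE i : cmp i g = gg i by apply/funext => x; rewrite /cmp mxE.
have sg : sqv g by move=> i; rewrite gE; exact: (Hg i).1.
have hcv i : form_cvg ip (fun n => cmp i (wgrad Omega (v n))) (cmp i g).
  by rewrite gE; exact: (Hg i).2.
have ug := weak_grad_limit (fun n => H1_sq (hv n)) su sg (fun n => wgradP (hv n)) vu hcv.
have hu : H1 Omega u by apply/(H1P dO); split => //; exists g.
by exists u => //; apply/(sobolev_cvgP hv hu (fun n => wgradP (hv n)) ug).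
Qed.

Lemma H10_H1 u : H10 Omega u -> H1 Omega u. Proof. by case. Qed.

Lemma H10P u : H10 Omega u <-> H1 Omega u /\
  exists2 phi : nat -> E -> R, (forall n, test_function Omega (phi n)) & form_cvg sobolev_ip phi u.
Proof.
have cF := sobolev_form; have sS := H1_subspace.
split => -[hu H]; split => //.
  have /choice[phi Hphi] : forall n : nat, exists phi, test_function Omega phi /\ H1_norm Omega (u - phi) < n.+1%:R^-1.
    by move=> n; apply: H; rewrite invr_gt0.
  exists phi => [n|e e0]; first exact: (Hphi n).1.
  have se0 : 0 < Num.sqrt e by rewrite sqrtr_gt0.
  have [N _ HN] := (cvgrPdist_lt _ _).1 (@cvg_harmonic R) _ se0.
  exists N => n /HN; rewrite /= sub0r normrN ger0_norm ?invr_ge0// => h.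
  have := lt_trans (Hphi n).2 h; rewrite H1_normE.
  rewrite ltr_sqrt// (formB_sym cF)//; exact: test_H1 (Hphi n).1.
move=> e e0; have [phi tphi cphi] := H.
have [N HN] := cphi _ (exprn_gt0 2 e0).
exists (phi N); split => //; rewrite H1_normE (formB_sym cF)//; last exact: test_H1.
have := HN N (leqnn N); set x := sobolev_ip _ _ => hx.
have x0 : 0 <= x by apply: (si_pos cF); apply: (subB sS) => //; exact: test_H1.
rewrite -(@ltr_pXn2r _ 2) ?nnegrE ?sqrtr_ge0 ?(ltW e0)// sqr_sqrtr//.
Qed.

Lemma test_H10 phi : test_function Omega phi -> H10 Omega phi.
Proof.
move=> tp; apply/H10P; split; first exact: test_H1.
exists (fun=> phi) => //; apply: (form_cvg_cst sobolev_form); exact: test_H1.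
Qed.

Lemma H10_subspace : subspace (H10 Omega).
Proof.
split; first exact: test_H10 (test0 _).
move=> c u v /H10P[hu [phi tphi cphi]] /H10P[hv [psi tpsi cpsi]].
apply/H10P; split; first exact: H1ZD.
exists (fun n => c *: phi n + psi n); first by move=> n; exact: testZD.
exact: (form_cvgZD sobolev_form c (fun n => test_H1 (tphi n)) hu (fun n => test_H1 (tpsi n)) hv cphi cpsi).
Qed.

Lemma H10_closed (v : nat -> E -> R) u : (forall n, H10 Omega (v n)) -> H1 Omega u ->
  form_cvg sobolev_ip v u -> H10 Omega u.
Proof.
have cF := sobolev_form; have sS := H1_subspace.
move=> hv hu vu; split => // e e0.
have e2 : 0 < e / 2 by rewrite divr_gt0.
have [N HN] := vu _ (exprn_gt0 2 e2).
have [phi [tphi hphi]] := (hv N).2 _ e2.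
exists phi; split => //.
have h1 := H10_H1 (hv N); have h2 := test_H1 tphi.
have V1 := subB sS hu h1; have V2 := subB sS h1 h2.
rewrite H1_normE -(subrKA (v N)); apply: le_lt_trans (form_norm_triangle cF V1 V2) _.
have : Num.sqrt (sobolev_ip (u - v N) (u - v N)) < e / 2.
  rewrite -(@ltr_pXn2r _ 2) ?nnegrE ?sqrtr_ge0 ?(ltW e2)// sqr_sqrtr ?(si_pos cF)//.
  by rewrite (formB_sym cF)//; exact: HN.
by rewrite H1_normE in hphi; lra.
Qed.

Lemma H10_limit (v : nat -> E -> R) (gv : nat -> E -> E) u g :
  (forall n, H10 Omega (v n)) -> sq u -> sqv g ->
  (forall n, is_weak_grad Omega (v n) (gv n)) -> form_cvg ip v u ->
  (forall i, form_cvg ip (fun n => cmp i (gv n)) (cmp i g)) ->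
  H10 Omega u /\ is_weak_grad Omega u g.
Proof.
move=> hv su sg vg vu gvg.
have ug := weak_grad_limit (fun n => H1_sq (H10_H1 (hv n))) su sg vg vu gvg.
have hu : H1 Omega u by apply/(H1P dO); split => //; exists g.
split => //; apply: (H10_closed hv hu).
by apply/(sobolev_cvgP (fun n => H10_H1 (hv n)) hu vg ug).
Qed.

Lemma H10_complete : form_complete (H10 Omega) sobolev_ip.
Proof.
move=> v hv cv; have [u hu vu] := sobolev_complete (fun n => H10_H1 (hv n)) cv.
by exists u => //; exact: H10_closed vu.
Qed.

End sobolev.

Section l2_comparison.
Context d (T : measurableType d) (R : realType).
Context (mu : {measure set T -> \bar R}) (D : set T) (mD : measurable D).
Implicit Types u v : T -> R.

Lemma ip_sq_le u v (M : R) : sqint mu D u -> sqint mu D v -> 0 <= M ->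
  (\forall x \ae mu, D x -> `|u x| <= M * `|v x|) -> ip mu D u u <= M ^+ 2 * ip mu D v v.
Proof.
move=> su sv M0 uv.
rewrite -lee_fin EFinM (ipE mD su su) (ipE mD sv sv) -ge0_integralZl_EFin//; last 3 first.
- by move=> x _; rewrite lee_fin -expr2 sqr_ge0.
- by apply/measurable_EFinP; apply: measurable_funM; exact: sv.1.
- by rewrite sqr_ge0.
apply: ae_ge0_le_integral => //.
- by move=> x _; rewrite lee_fin -expr2 sqr_ge0.
- by apply/measurable_EFinP; apply: measurable_funM; exact: su.1.
- by move=> x _; rewrite -EFinM lee_fin -expr2 mulr_ge0 ?sqr_ge0.
- apply: measurable_funeM; apply/measurable_EFinP; apply: measurable_funM; exact: sv.1.
- apply: filterS uv => x h /h {}h; rewrite -EFinM lee_fin -!expr2.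
  rewrite -(real_normK (num_real (u x))) -(real_normK (num_real (v x))) -exprMn.
  by rewrite lerXn2r ?nnegrE// mulr_ge0.
Qed.

Lemma ip_cvg_le (w : nat -> T -> R) u (v : nat -> T -> R) v' (M : R) :
  (forall n, sqint mu D (w n)) -> sqint mu D u -> (forall n, sqint mu D (v n)) -> sqint mu D v' ->
  0 <= M ->
  (forall n, \forall x \ae mu, D x -> `|w n x - u x| <= M * `|v n x - v' x|) ->
  form_cvg (ip mu D) v v' -> form_cvg (ip mu D) w u.
Proof.
move=> sw su sv sv' M0 H vv e e0.
have ss := sqint_subspace mu mD.
have p0 : 0 < M ^+ 2 + 1 by have := sqr_ge0 M; lra.
have [N HN] := vv _ (divr_gt0 e0 p0); exists N => n /HN.
rewrite ltr_pdivlMr//; apply: le_lt_trans.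
have s1 := subB ss (sw n) su; have s2 := subB ss (sv n) sv'.
apply: le_trans (ip_sq_le s1 s2 M0 (H n)) _.
by rewrite mulrC ler_wpM2l ?(si_pos (ip_semi_inner mu mD))// lerDl.
Qed.

End l2_comparison.

(** * The Poincare inequality and the Dirichlet form on H^1_0 *)

Section poincare.
Context {R : realType} {m : nat}.
Local Notation E := 'rV[R]_m.+1.
Local Notation mu := (@leb R m).
Context (Omega : set E) (dO : bounded_open Omega).
Implicit Types (u v phi : E -> R) (g h : E -> E).
Local Notation sq := (sqint mu Omega : set (E -> R)).
Local Notation ip := (ip mu Omega).
Local Notation dirichlet := (dirichlet Omega).
Local Notation sobolev_ip := (sobolev_ip Omega).
Let mO := domain_measurable dO.
Let sF := ip_form dO.
Let ss : subspace sq := si_sub sF.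

Lemma partial_coord i j : partial i (fun x : E => x 0 j) = cst (i == j)%:R.
Proof. by apply/funext => x; exact: (@derive_val _ _ _ _ _ _ _ (is_derive_coord i j x)). Qed.

Lemma smooth_coord j : smooth (fun x : E => x 0 j).
Proof.
apply: (@smooth_coind _ _ [set f | f = (fun x : E => x 0 j) \/ exists c, f = cst c]); last by left.
- move=> _ [->|[c ->]].
  + split; first exact: coord_continuous.
    by move=> i x; exact: (@ex_derive _ _ _ _ _ _ _ (is_derive_coord i j x)).
  + by split => [x|i x]; [exact: cst_continuous|exact: derivable_cst].
- move=> _ i [->|[c ->]]; right.
  + by rewrite partial_coord; eexists.
  + by rewrite partial_cst; eexists.
Qed.

Lemma partialM i (f g : E -> R) x : smooth f -> smooth g ->
  partial i (f * g) x = f x * partial i g x + partial i f x * g x.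
Proof.
move=> sf sg; rewrite /partial deriveM; [|exact: smooth_derivable sf|exact: smooth_derivable sg].
by rewrite -![_ *: _]/(_ * _) [X in _ + X]mulrC.
Qed.

Lemma ip_mul3 (a b c : E -> R) : ip (a * b) c = ip a (b * c).
Proof.
rewrite !ip_def; apply: eq_Rintegral => x _.
by rewrite -[(a * b) x]/(a x * b x) -[(b * c) x]/(b x * c x) mulrA.
Qed.

Lemma integral_test_partial phi i : test_function Omega phi ->
  ip (cst 1) (partial i phi) = 0.
Proof.
move=> tp; rewrite ip_def; under eq_Rintegral => x _ do rewrite mul1r.
rewrite -[RHS](integral_partial0 i tp) Rintegral_mkcond; apply: eq_Rintegral => x _.
rewrite patchE; case: ifPn => //; rewrite notin_setE => Ox.
by rewrite (test_out (test_partial i tp) Ox).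
Qed.

(* Integrate [d_0 (x_0 phi^2)] over the bounded domain. *)
Lemma poincare_test : exists2 C : R, 0 < C &
  forall phi, test_function Omega phi -> ip phi phi <= C * dirichlet phi phi.
Proof.
have [M [Mr HM]] := dO.2.
have HB : forall x, Omega x -> `|x 0 0| <= `|M| + 1.
  move=> x Ox; have h : M < `|M| + 1 by have := ler_norm M; lra.
  have := HM _ h x Ox => /=; apply: le_trans.
  by rewrite [leRHS]/Num.norm /= mx_normrE (le_trans _ (le_bigmax _ _ (0, 0))).
set B := `|M| + 1 in HB; have B0 : 0 < B by rewrite /B; have := normr_ge0 M; lra.
(* Integration gives [|phi|^2 = - 2 (phi, x_0 d_0 phi)], at most [|phi|^2 / 2 + 2 B^2 |d_0 phi|^2]
   by Young's inequality; the first term is absorbed. *)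
exists (4 * B ^+ 2); first by rewrite mulr_gt0// exprn_gt0.
move=> phi tp; pose X : E -> R := fun x => x 0 0.
have sX : smooth X by exact: smooth_coord.
have sphi := test_smooth tp.
have t1 : test_function Omega (phi * phi) by exact: testM sphi tp.
have t2 := testM sX t1.
have td := test_partial 0 tp.
have tw := testM sX td.
have sp := test_sq dO tp; have sd := test_sq dO td; have sw := test_sq dO tw.
have E1 : partial 0 (X * (phi * phi)) = phi * phi + 2 *: (phi * (X * partial 0 phi)).
  apply/funext => x; rewrite (partialM _ _ sX (test_smooth t1)) (partialM _ _ sphi sphi).
  have -> : partial 0 X x = 1 by rewrite /X partial_coord /cst eqxx.
  rewrite -[RHS]/(phi x * phi x + 2 * (phi x * (X x * partial 0 phi x))).
  rewrite -[(phi * phi) x]/(phi x * phi x).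
  by move: (X x) (phi x) (partial 0 phi x) => a b c; ring.
have := integral_test_partial 0 t2; rewrite E1.
have s1 := sq_cst dO 1; have spp := test_sq dO t1.
have tpw : test_function Omega (phi * (X * partial 0 phi)) by exact: testM sphi tw.
have spw := test_sq dO tpw.
rewrite (linD (linear_formr sF s1) spp (subZ ss 2 spw)).
rewrite (linZ ss (linear_formr sF s1) 2 spw).
have c1 f : cst 1 * f = f by apply/funext => x; rewrite -[LHS]/(1 * f x) mul1r.
rewrite -(ip_mul3 (cst 1)) c1 -(ip_mul3 (cst 1) phi) c1 => H.
have h2 : 0 < 2^-1 :> R by rewrite invr_gt0.
have hm := form_le_mean sF sp sw h2; rewrite invrK in hm.
have hw : ip (X * partial 0 phi) (X * partial 0 phi) <= B ^+ 2 * ip (partial 0 phi) (partial 0 phi).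
  apply: (ip_sq_le mO sw sd (ltW B0)); apply: aeW => x Ox.
  by rewrite -[(X * _) x]/(X x * partial 0 phi x) normrM ler_wpM2r//; exact: HB.
have hd : ip (partial 0 phi) (partial 0 phi) <= dirichlet phi phi.
  have W := test_weak_grad dO tp.
  rewrite (dirichletE dO W W) (bigD1 0)//= !cmp_grad lerDl sumr_ge0// => i _.
  by apply: (si_pos sF); exact: weak_grad_sqv W i.
have B2 : 0 < B ^+ 2 by exact: exprn_gt0.
have := ler_wpM2l (ltW B2) hd; have := ler_norm (- ip phi (X * partial 0 phi)); rewrite normrN.
move: H hm hw.
move: (ip phi phi) (ip phi (X * _)) (ip (X * _) _) (ip (partial 0 phi) _) (dirichlet phi phi) (B ^+ 2).
by clear => *; lra.
Qed.

Lemma form_cvg_dominated (V : set (E -> R)) (a b : (E -> R) -> (E -> R) -> R) (C : R)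
    (v : nat -> E -> R) u :
  subspace V -> 0 < C -> (forall w, V w -> a w w <= C * b w w) -> (forall n, V (v n)) -> V u ->
  form_cvg b v u -> form_cvg a v u.
Proof.
move=> sV C0 H Vv Vu vu e e0.
have [N HN] := vu _ (divr_gt0 e0 C0); exists N => n /HN h.
by apply: le_lt_trans (H _ (subB sV (Vv n) Vu)) _; rewrite mulrC -ltr_pdivlMr.
Qed.

Lemma dirichlet_le_sobolev u : H1 Omega u -> dirichlet u u <= 1 * sobolev_ip u u.
Proof. by move=> hu; rewrite sobolev_ipE mul1r lerDr (si_pos sF (H1_sq dO hu)). Qed.

Lemma ip_le_sobolev u : H1 Omega u -> ip u u <= 1 * sobolev_ip u u.
Proof. by move=> hu; rewrite sobolev_ipE mul1r lerDl (si_pos (dirichlet_form dO) hu). Qed.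

Lemma sobolev_cvg_ip (v : nat -> E -> R) u : (forall n, H1 Omega (v n)) -> H1 Omega u ->
  form_cvg sobolev_ip v u -> form_cvg ip v u.
Proof. exact: (form_cvg_dominated (H1_subspace dO) ltr01 ip_le_sobolev). Qed.

Lemma sobolev_cvg_dirichlet (v : nat -> E -> R) u : (forall n, H1 Omega (v n)) -> H1 Omega u ->
  form_cvg sobolev_ip v u -> form_cvg dirichlet v u.
Proof. exact: (form_cvg_dominated (H1_subspace dO) ltr01 dirichlet_le_sobolev). Qed.

Lemma poincare : exists2 C : R, 0 < C &
  forall u, H10 Omega u -> ip u u <= C * dirichlet u u.
Proof.
have [C C0 HC] := poincare_test; exists C => // u /(H10P dO)[hu [phi tphi cphi]].
have h1 n := test_H1 dO (tphi n).
have c1 := form_cvg_sq sF (fun n => test_sq dO (tphi n)) (H1_sq dO hu) (sobolev_cvg_ip h1 hu cphi).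
have c2 := form_cvg_sq (dirichlet_form dO) h1 hu (sobolev_cvg_dirichlet h1 hu cphi).
have c3 : C * dirichlet (phi n) (phi n) @[n --> \oo] --> C * dirichlet u u.
  by apply: cvgM => //; exact: cvg_cst.
by apply: (ler_cvg_to c1 c3); apply: nearW => n; exact: HC.
Qed.

Lemma H10_form : semi_inner (H10 Omega) dirichlet.
Proof.
have dF := dirichlet_form dO; split; first exact: H10_subspace.
- by move=> u v /H10_H1 hu /H10_H1 hv; exact: (si_sym dF).
- by move=> c u v w /H10_H1 hu /H10_H1 hv /H10_H1 hw; exact: (si_lin dF).
- by move=> u /H10_H1 hu; exact: (si_pos dF).
Qed.

Lemma sobolev_le_dirichlet : exists2 C : R, 0 < C &
  forall u, H10 Omega u -> sobolev_ip u u <= C * dirichlet u u.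
Proof.
have [C C0 HC] := poincare; exists (C + 1); first lra.
by move=> u hu; rewrite sobolev_ipE mulrDl mul1r lerD2r; exact: HC.
Qed.

Lemma dirichlet_cvg_sobolev (v : nat -> E -> R) u : (forall n, H10 Omega (v n)) -> H10 Omega u ->
  form_cvg dirichlet v u -> form_cvg sobolev_ip v u.
Proof.
have [C C0 HC] := sobolev_le_dirichlet.
exact: (form_cvg_dominated (H10_subspace dO) C0 HC).
Qed.

Lemma H10_dirichlet_complete : form_complete (H10 Omega) dirichlet.
Proof.
have [C C0 HC] := sobolev_le_dirichlet.
move=> v hv cv; have [|u hu vu] := H10_complete dO hv.
  move=> e e0; have [N HN] := cv _ (divr_gt0 e0 C0); exists N => n k Nn Nk.
  apply: le_lt_trans (HC _ (subB (H10_subspace dO) (hv n) (hv k))) _.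
  by rewrite mulrC -ltr_pdivlMr//; exact: HN.
exists u; [exact: hu|].
by apply: (sobolev_cvg_dirichlet (fun n => H10_H1 (hv n)) (H10_H1 hu)); exact: vu.
Qed.

Lemma H10_ae_unique u v : H10 Omega u -> H10 Omega v -> dirichlet (u - v) (u - v) <= 0 ->
  ae_in Omega (fun x => u x = v x).
Proof.
move=> hu hv h; have [C C0 HC] := poincare.
have hd := subB (H10_subspace dO) hu hv.
have : ip (u - v) (u - v) <= 0.
  by apply: le_trans (HC _ hd) _; rewrite pmulr_rle0.
move=> /(ip_eq0 mO (H1_sq dO (H10_H1 hd))); apply: ae_in1 => x _ /eqP.
by rewrite subr_eq0 => /eqP.
Qed.

End poincare.

(** * Chain rule and truncation *)

Section chain_rule.
Context {R : realType} {m : nat}.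
Local Notation E := 'rV[R]_m.+1.
Local Notation mu := (@leb R m).
Context (Omega : set E) (dO : bounded_open Omega).
Implicit Types (u v phi : E -> R) (g h : E -> E) (T S : R -> R).
Local Notation sq := (sqint mu Omega : set (E -> R)).
Local Notation ip := (ip mu Omega).
Local Notation dirichlet := (dirichlet Omega).
Local Notation sobolev_ip := (sobolev_ip Omega).
Let mO := domain_measurable dO.
Let sF := ip_form dO.
Let ss : subspace sq := si_sub sF.

(** [S] is a derivative of [T] with a free choice of values at kinks. Two different choices for the
    same [T] yield information on the gradient, as in [grad_level_set]. *)
Definition chain T S := forall u g, H10 Omega u -> is_weak_grad Omega u g ->
  H10 Omega (T \o u) /\ is_weak_grad Omega (T \o u) (fun x => S (u x) *: g x).

Lemma cmp_scale (a : E -> R) g i : cmp i (fun x => a x *: g x) = a * cmp i g.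
Proof. by apply/funext => x; rewrite /cmp mxE. Qed.

Lemma sq_mul_bounded (a w : E -> R) (M : R) : measurable_fun Omega a -> 0 <= M ->
  (forall x, `|a x| <= M) -> sq w -> sq (a * w).
Proof.
move=> ma M0 aM sw; apply: (sqint_ae_le mO _ (subZ ss M sw)).
  by apply: measurable_funM => //; exact: sw.1.
apply: ae_inW => x _; rewrite -[(a * w) x]/(a x * w x) -[(M *: w) x]/(M * w x) !normrM.
by rewrite ler_wpM2r// (ger0_norm M0).
Qed.

Lemma chain_limit (T_ S_ : nat -> R -> R) T S (M : R) :
  (forall n, chain (T_ n) (S_ n)) -> 0 <= M ->
  (forall n, measurable_fun setT (T_ n)) -> (forall n, measurable_fun setT (S_ n)) ->
  (forall n t, `|T_ n t| <= M * `|t|) -> (forall n t, `|S_ n t| <= M) ->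
  (forall t, T_ n t @[n --> \oo] --> T t) -> (forall t, S_ n t @[n --> \oo] --> S t) ->
  chain T S.
Proof.
move=> cT M0 mT_ mS_ TM SM Tc Sc u g hu ug.
have mT : measurable_fun setT T by apply: (measurable_fun_cvg mT_) => t _; exact: Tc.
have mS : measurable_fun setT S by apply: (measurable_fun_cvg mS_) => t _; exact: Sc.
have su := H1_sq dO (H10_H1 hu); have gq := weak_grad_sqv dO ug.
have hn n : H10 Omega (T_ n \o u) by exact: (cT n u g hu ug).1.
have gn n : is_weak_grad Omega (T_ n \o u) (fun x => S_ n (u x) *: g x) by exact: (cT n u g hu ug).2.
have sM := subZ ss M su.
have [_ sT c1] := @sqint_dominated _ _ _ mu _ mO (fun n => T_ n \o u) (T \o u) _
  (fun n => (H1_sq dO (H10_H1 (hn n))).1) (measurableT_comp mT su.1) sM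
  (fun n => ae_inW (fun x _ => le_trans (TM n (u x)) (eq_ind_r (fun y => _ <= y) (ler_wpM2r (normr_ge0 _) (ler_norm M)) (normrM M (u x)))))
  (ae_inW (fun x _ => Tc (u x))).
have gM i := subZ ss M (gq i).
have Z i : sq (cmp i (fun x => S (u x) *: g x)) /\
    form_cvg ip (fun n => cmp i (fun x => S_ n (u x) *: g x)) (cmp i (fun x => S (u x) *: g x)).
  have E1 n : cmp i (fun x => S_ n (u x) *: g x) = (S_ n \o u) * cmp i g by exact: cmp_scale.
  have E2 : cmp i (fun x => S (u x) *: g x) = (S \o u) * cmp i g by exact: cmp_scale.
  have -> : (fun n => cmp i (fun x => S_ n (u x) *: g x)) = (fun n => (S_ n \o u) * cmp i g).
    by apply/funext.
  rewrite E2; have [_ h1 h2] := @sqint_dominated _ _ _ mu _ mO (fun n => (S_ n \o u) * cmp i g)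
    ((S \o u) * cmp i g) _ (fun n => measurable_funM (measurableT_comp (mS_ n) su.1) (gq i).1)
    (measurable_funM (measurableT_comp mS su.1) (gq i).1) (gM i)
    (fun n => ae_inW (fun x _ => eq_ind_r (fun y => y <= _) (eq_ind_r (fun y => _ <= y)
       (ler_wpM2r (normr_ge0 _) (le_trans (SM n (u x)) (ler_norm M))) (normrM M (cmp i g x))) (normrM (S_ n (u x)) (cmp i g x))))
    (ae_inW (fun x _ => cvgM (Sc (u x)) (cvg_cst _))).
  by split.
by have [] := H10_limit dO hn sT (fun i => (Z i).1) gn c1 (fun i => (Z i).2).
Qed.

Lemma is_derive_lipschitz T S (M : R) : (forall t, is_derive t (1 : R) T (S t)) ->
  (forall t, `|S t| <= M) -> forall s t, `|T s - T t| <= M * `|s - t|.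
Proof.
move=> dT SM.
suff H s t : s < t -> `|T t - T s| <= M * `|t - s|.
  move=> s t; have [st|st|->] := ltgtP s t; last by rewrite !subrr normr0 mulr0.
  - by rewrite distrC [X in _ * X]distrC; exact: H.
  - exact: H.
move=> st; have [|c _ ->] := MVT st (fun x _ => dT x).
  apply: continuous_subspaceT => x; apply: differentiable_continuous; apply/derivable1_diffP.
  exact: (@ex_derive _ _ _ _ _ _ _ (dT x)).
by rewrite normrM ler_wpM2r.
Qed.

Lemma chain_smooth T S (M : R) : T 0 = 0 -> (forall phi, smooth phi -> smooth (T \o phi)) ->
  (forall t, is_derive t (1 : R) T (S t)) -> continuous S -> (forall t, `|S t| <= M) ->
  chain T S.
Proof.
move=> T0 smT dT cS SM u g hu ug; have hu1 := H10_H1 hu.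
have M0 : 0 <= M by apply: le_trans (SM 0).
have su := H1_sq dO hu1; have gq := weak_grad_sqv dO ug.
have lipT := is_derive_lipschitz dT SM.
have cT : continuous T.
  move=> t; apply: differentiable_continuous; apply/derivable1_diffP.
  exact: (@ex_derive _ _ _ _ _ _ _ (dT t)).
have mT := continuous_measurable_fun cT; have mS := continuous_measurable_fun cS.
have [_ [phi0 tp0 cv0]] := iffLR (H10P dO u) hu.
have [ci0 cg0] := iffLR (sobolev_cvgP dO (fun n => test_H1 dO (tp0 n)) hu1
  (fun n => test_weak_grad dO (tp0 n)) ug) cv0.
have [s sn aes] := form_cvg_ae_subseq mO (fun n => test_sq dO (tp0 n)) su ci0.
pose phi n := phi0 (s n); have tp n : test_function Omega (phi n) by exact: tp0.
have sub (v : nat -> E -> R) w : form_cvg ip v w -> form_cvg ip (fun n => v (s n)) w.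
  move=> h e e0; have [N HN] := h e e0; exists N => n Nn; apply: HN.
  exact: leq_trans Nn (sn n).
have cphi := sub _ _ ci0; have cgrad i := sub _ _ (cg0 i).
have tT n : test_function Omega (T \o phi n).
  exact: test_comp T0 (smT _ (test_smooth (tp n))) (tp n).
have pT n i : partial i (T \o phi n) = (S \o phi n) * partial i (phi n).
  apply/funext => x; have h : is_derive x (basis_vec i) (phi n) (partial i (phi n) x).
    by apply: derivableP; exact: smooth_derivable (test_smooth (tp n)).
  exact: (@derive_val _ _ _ _ _ _ _ (is_derive_comp (dT (phi n x)) h)).
have gT n : is_weak_grad Omega (T \o phi n) (grad (T \o phi n)) by exact: test_weak_grad (tT n).
have sT : sq (T \o u).
  apply: (sqint_ae_le mO (measurableT_comp mT su.1) (subZ ss M su)).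
  apply: ae_inW => x _; have := lipT (u x) 0; rewrite T0 !subr0 => /le_trans; apply.
  by rewrite -[(M *: u) x]/(M * u x) normrM ler_wpM2r// ler_norm.
have sSg i : sq (cmp i (fun x => S (u x) *: g x)).
  rewrite cmp_scale; apply: sq_mul_bounded M0 _ (gq i); last by move=> x; exact: SM.
  exact: measurableT_comp mS su.1.
have c1 : form_cvg ip (fun n => T \o phi n) (T \o u).
  apply: (ip_cvg_le mO (fun n => test_sq dO (tT n)) sT (fun n => test_sq dO (tp n)) su M0 _ cphi).
  by move=> n; apply: ae_inW => x _; exact: lipT.
have c2 i : form_cvg ip (fun n => cmp i (grad (T \o phi n))) (cmp i (fun x => S (u x) *: g x)).
  (* The derivative of [T \o phi n] is [w n + w' n]. The first part tends to zero because [S] is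
     bounded, the second converges by domination, using a.e. convergence of [phi n]. *)
  pose w n := (S \o phi n) * (partial i (phi n) - cmp i g).
  pose w' n := (S \o phi n) * cmp i g.
  have mSp n : measurable_fun Omega (S \o phi n).
    by apply: measurableT_comp mS _; exact: (test_sq dO (tp n)).1.
  have sp n : sq (partial i (phi n)) by apply: (test_sq dO); exact: test_partial (tp n).
  have sw n : sq (w n).
    by apply: sq_mul_bounded (mSp n) M0 _ (subB ss (sp n) (gq i)) => x; exact: SM.
  have sw' n : sq (w' n) by apply: sq_mul_bounded (mSp n) M0 _ (gq i) => x; exact: SM.
  have cw : form_cvg ip w 0.
    have cg : form_cvg ip (fun n => partial i (phi n)) (cmp i g).
      by move=> e e0; have [N HN] := cgrad i e e0; exists N => n /HN; rewrite cmp_grad.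
    apply: (ip_cvg_le mO sw (sub0 ss) sp (gq i) M0 _ cg) => n; apply: ae_inW => x _.
    rewrite -[0 x]/(0 : R) subr0.
    rewrite -[w n x]/(S (phi n x) * (partial i (phi n) x - cmp i g x)) normrM.
    by rewrite ler_wpM2r.
  have d1 n : ae_in Omega (fun x => `|w' n x| <= `|(M *: cmp i g) x|).
    apply: ae_inW => x _; rewrite -[w' n x]/(S (phi n x) * cmp i g x).
    rewrite -[(M *: _) x]/(M * cmp i g x) !normrM ler_wpM2r//.
    by rewrite (le_trans (SM _)) ?ler_norm.
  have d2 : ae_in Omega (fun x => w' n x @[n --> \oo] --> ((S \o u) * cmp i g) x).
    apply: ae_in1 aes => x _ h; apply: cvgM; last exact: cvg_cst.
    by apply: continuous_cvg h; exact: cS.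
  have [_ _ cw'] := sqint_dominated mO (fun n => (sw' n).1)
    (measurable_funM (measurableT_comp mS su.1) (gq i).1) (subZ ss M (gq i)) d1 d2.
  have := form_cvgZD sF 1 sw (sub0 ss) sw' _ cw cw'.
  rewrite scaler0 add0r cmp_scale => /(_ _) H.
  have -> : (fun n => cmp i (grad (T \o phi n))) = (fun n => 1 *: w n + w' n).
    apply/funext => n; rewrite cmp_grad pT; apply/funext => x.
    rewrite -[RHS]/(1 * (S (phi n x) * (partial i (phi n) x - cmp i g x)) + S (phi n x) * cmp i g x).
    by rewrite -[LHS]/(S (phi n x) * partial i (phi n) x) mul1r -mulrDr subrK.
  by apply: H; have := sSg i; rewrite cmp_scale.
by have [] := H10_limit dO (fun n => test_H10 dO (tT n)) sT sSg gT c1 c2.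
Qed.

(** The positive part [(|s| + s) / 2] at [s = t - a], with [|s|] smoothed to the square root of
    [s^2 + e^2] and a constant added so that the value at [t = 0] is zero. For [a >= 0] the limit as
    [e] tends to zero is [max (t - a) 0]. *)
Definition sqrt_pos (a e t : R) : R :=
  (Num.sqrt ((t - a) ^+ 2 + e ^+ 2) - Num.sqrt (a ^+ 2 + e ^+ 2) + t) / 2.
Definition sqrt_pos_deriv (a e t : R) : R :=
  ((t - a) / Num.sqrt ((t - a) ^+ 2 + e ^+ 2) + 1) / 2.

Lemma normr_div_sqrt (x e : R) : `|x / Num.sqrt (x ^+ 2 + e ^+ 2)| <= 1.
Proof.
have [->|e0] := eqVneq (x ^+ 2 + e ^+ 2) 0; first by rewrite sqrtr0 invr0 mulr0 normr0.
have p : 0 < x ^+ 2 + e ^+ 2 by rewrite lt_def e0 addr_ge0 ?sqr_ge0.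
rewrite normrM normfV (ger0_norm (sqrtr_ge0 _)) ler_pdivrMr ?sqrtr_gt0// mul1r.
by rewrite -(sqrtr_sqr x) ler_sqrt ?lerDl ?sqr_ge0// ltW.
Qed.

Lemma sqrt_pos_deriv_le a e t : `|sqrt_pos_deriv a e t| <= 1.
Proof.
have := normr_div_sqrt (t - a) e; rewrite /sqrt_pos_deriv; move: (_ / Num.sqrt _) => y.
by rewrite !ler_norml => /andP[? ?]; apply/andP; split; lra.
Qed.

Lemma is_derive_sqrt_pos a e t : 0 < e ->
  is_derive t (1 : R) (sqrt_pos a e) (sqrt_pos_deriv a e t).
Proof.
move=> e0; have p y : 0 < (y - a) ^+ 2 + e ^+ 2 by rewrite ltr_wpDl ?sqr_ge0// exprn_gt0.
have h1 : is_derive t (1 : R) (fun y => (y - a) ^+ 2 + e ^+ 2) (2 * (t - a)).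
  have -> : (fun y : R => (y - a) ^+ 2 + e ^+ 2) = (id - cst a) * (id - cst a) + cst (e ^+ 2).
    by apply/funext => y; rewrite expr2.
  apply: is_derive_eq; rewrite -![_ *: _]/(_ * _) -[(id - cst a) t]/(t - a).
  by move: (t - a) => y; rewrite subr0 addr0 mulr1 mulr_natl mulr2n.
have h2 := @is_derive_comp _ _ Num.sqrt (fun y => (y - a) ^+ 2 + e ^+ 2) _ _ _ _
  (is_derive1_sqrt (p t)) h1.
have -> : sqrt_pos a e = 2^-1 *: (Num.sqrt \o (fun y => (y - a) ^+ 2 + e ^+ 2)
    - cst (Num.sqrt (a ^+ 2 + e ^+ 2)) + id).
  by apply/funext => y; rewrite /sqrt_pos mulrC.
apply: is_derive_eq; rewrite /sqrt_pos_deriv -![_ *: _]/(_ * _).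
by field; rewrite gt_eqF// sqrtr_gt0.
Qed.

Lemma continuous_sqrt_pos_deriv a e : 0 < e -> continuous (sqrt_pos_deriv a e).
Proof.
move=> e0 t; have p y : 0 < (y - a) ^+ 2 + e ^+ 2 by rewrite ltr_wpDl ?sqr_ge0// exprn_gt0.
have c1 : (fun y : R => y - a) y @[y --> t] --> t - a by apply: cvgB; [exact: cvg_id|exact: cvg_cst].
apply: cvgM; last exact: cvg_cst.
apply: cvgD; last exact: cvg_cst.
apply: cvgM => //; apply: cvgV; first by rewrite gt_eqF// sqrtr_gt0.
apply: continuous_cvg; first exact: sqrt_continuous.
by apply: cvgD; [apply: cvgM|exact: cvg_cst].
Qed.

Lemma sqrt_pos0 a e : sqrt_pos a e 0 = 0.
Proof. by rewrite /sqrt_pos sub0r sqrrN subrr addr0 mul0r. Qed.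

Lemma chain_sqrt_pos a e : 0 < e -> chain (sqrt_pos a e) (sqrt_pos_deriv a e).
Proof.
move=> e0; apply: (@chain_smooth _ _ 1).
- exact: sqrt_pos0.
- move=> phi sphi.
  have s1 := smooth_sqrt (smoothB sphi (smooth_cst a)) e0.
  have s2 := smoothZ 2^-1 (smoothD (smoothB s1 (smooth_cst (Num.sqrt (a ^+ 2 + e ^+ 2)))) sphi).
  have -> // : sqrt_pos a e \o phi = 2^-1 *: ((fun x => Num.sqrt ((phi - cst a) x ^+ 2 + e ^+ 2)) -
    cst (Num.sqrt (a ^+ 2 + e ^+ 2)) + phi).
  by apply/funext => y; rewrite /sqrt_pos /= mulrC.
- by move=> t; exact: is_derive_sqrt_pos.
- exact: continuous_sqrt_pos_deriv.
- exact: sqrt_pos_deriv_le.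
Qed.

(** Shifts and widths are arbitrary sequences because two regularizations of the same function, with
    different limit slopes at [c], are used below. *)
Lemma chain_sqrt_limit (a e : nat -> R) (c : R) S : 0 <= c -> (forall n, 0 < e n) ->
  a n @[n --> \oo] --> c -> e n @[n --> \oo] --> (0 : R) ->
  (forall t, sqrt_pos_deriv (a n) (e n) t @[n --> \oo] --> S t) ->
  chain (fun t => Num.max (t - c) 0) S.
Proof.
move=> c0 e0 ac ec Sc.
have ct n : continuous (sqrt_pos (a n) (e n)).
  move=> t; apply: differentiable_continuous; apply/derivable1_diffP.
  exact: (@ex_derive _ _ _ _ _ _ _ (is_derive_sqrt_pos (a n) t (e0 n))).
apply: (@chain_limit (fun n => sqrt_pos (a n) (e n)) (fun n => sqrt_pos_deriv (a n) (e n)) _ _ 1).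
- by move=> n; exact: chain_sqrt_pos.
- exact: ler01.
- by move=> n; exact: continuous_measurable_fun (ct n).
- by move=> n; apply: continuous_measurable_fun; exact: continuous_sqrt_pos_deriv.
- move=> n t; have := is_derive_lipschitz (fun t => is_derive_sqrt_pos (a n) t (e0 n))
    (sqrt_pos_deriv_le (a n) (e n)) t 0.
  by rewrite sqrt_pos0 !subr0.
- by move=> n t; exact: sqrt_pos_deriv_le.
- move=> t; have -> : Num.max (t - c) 0 =
      (Num.sqrt ((t - c) ^+ 2 + 0 ^+ 2) - Num.sqrt (c ^+ 2 + 0 ^+ 2) + t) / 2.
    rewrite expr0n addr0 addr0 !sqrtr_sqr (ger0_norm c0).
    have [h|h] := leP (t - c) 0; [rewrite ler0_norm//|rewrite gtr0_norm//]; lra.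
  have sq2 (x_ y_ : nat -> R) (x y : R) : x_ n @[n --> \oo] --> x -> y_ n @[n --> \oo] --> y ->
      Num.sqrt (x_ n ^+ 2 + y_ n ^+ 2) @[n --> \oo] --> Num.sqrt (x ^+ 2 + y ^+ 2).
    move=> hx hy; apply: continuous_cvg; first exact: sqrt_continuous.
    by apply: cvgD; apply: cvgM.
  apply: cvgM; last exact: cvg_cst.
  apply: cvgD; last exact: cvg_cst.
  apply: cvgB; apply: sq2 => //.
  by apply: cvgB => //; exact: cvg_cst.
- exact: Sc.
Qed.

Lemma sqrt_pos_deriv_cvg (a e : nat -> R) (c t : R) : t != c -> (forall n, 0 < e n) ->
  a n @[n --> \oo] --> c -> e n @[n --> \oo] --> (0 : R) ->
  sqrt_pos_deriv (a n) (e n) t @[n --> \oo] --> ((c < t)%R%:R : R).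
Proof.
move=> tc e0 ac ec; have tc0 : t - c != 0 by rewrite subr_eq0.
have -> : (c < t)%R%:R = ((t - c) / Num.sqrt ((t - c) ^+ 2 + 0 ^+ 2) + 1) / 2 :> R.
  rewrite expr0n addr0 sqrtr_sqr; have [h|h] := ltP c t.
    by rewrite gtr0_norm ?subr_gt0// divff// /=; lra.
  by rewrite ltr0_norm ?subr_lt0 ?lt_neqAle ?tc ?h// invrN mulrN divff// /=; lra.
have c1 : t - a n @[n --> \oo] --> t - c by apply: cvgB => //; exact: cvg_cst.
apply: cvgM; last exact: cvg_cst.
apply: cvgD; last exact: cvg_cst.
apply: cvgM => //; apply: cvgV.
  by rewrite gt_eqF// sqrtr_gt0 expr0n addr0 exprn_even_gt0.
apply: continuous_cvg; first exact: sqrt_continuous.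
by apply: cvgD; apply: cvgM.
Qed.

(** The regularization is centred at [c + h] with the much smaller width [h ^+ 2], where
    [h = harmonic n]. Its slope at [c] therefore tends to zero, and the strict indicator arises. *)
Lemma chain_posB (c : R) : 0 <= c -> chain (fun t => Num.max (t - c) 0) (fun t => (c < t)%R%:R).
Proof.
move=> c0; have hc : harmonic @ \oo --> (0 : R) := @cvg_harmonic R.
pose e n : R := harmonic n ^+ 2.
have e0 n : 0 < e n by rewrite exprn_gt0// invr_gt0.
have ac : c + harmonic n @[n --> \oo] --> c.
  by rewrite -[X in _ --> X]addr0; apply: cvgD => //; exact: cvg_cst.
have ec : e n @[n --> \oo] --> (0 : R) by rewrite -[X in _ --> X](mulr0 0); apply: cvgM.
apply: (chain_sqrt_limit c0 e0 ac ec) => t.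
have [->|tc] := eqVneq t c; last exact: sqrt_pos_deriv_cvg tc e0 ac ec.
rewrite ltxx.
have E n : sqrt_pos_deriv (c + harmonic n) (e n) c = (1 - (Num.sqrt (1 + harmonic n ^+ 2))^-1) / 2.
  have h0 : 0 < harmonic n :> R by rewrite invr_gt0.
  have p : 0 < 1 + harmonic n ^+ 2 :> R by rewrite ltr_wpDr ?sqr_ge0.
  rewrite /sqrt_pos_deriv /e opprD addrA subrr sub0r sqrrN.
  have -> : harmonic n ^+ 2 + (harmonic n ^+ 2) ^+ 2 = harmonic n ^+ 2 * (1 + harmonic n ^+ 2) :> R.
    by move: (harmonic n) => h; ring.
  rewrite sqrtrM ?sqr_ge0// sqrtr_sqr gtr0_norm//.
  have s0 : Num.sqrt (1 + harmonic n ^+ 2) != 0 :> R by rewrite gt_eqF// sqrtr_gt0.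
  by field; rewrite s0 gt_eqF.
under eq_fun do rewrite E.
have -> : (false%:R : R) = (1 - (Num.sqrt (1 + 0 ^+ 2))^-1) / 2.
  by rewrite expr0n addr0 sqrtr1 invr1 subrr mul0r.
apply: cvgM; last exact: cvg_cst.
apply: cvgB; first exact: cvg_cst.
apply: cvgV; first by rewrite expr0n addr0 sqrtr1 oner_neq0.
apply: continuous_cvg; first exact: sqrt_continuous.
by apply: cvgD; [exact: cvg_cst|apply: cvgM].
Qed.

(* The unshifted regularization has slope [2^-1] instead of [0] at [c]; both
   limits are the gradient of the same function. *)
Lemma grad_level_set (c : R) u g : 0 <= c -> H10 Omega u -> is_weak_grad Omega u g ->
  ae_in Omega (fun x => u x = c -> g x = 0).
Proof.
move=> c0 hu ug; have h1 := (chain_posB c0 hu ug).2.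
have hc : harmonic @ \oo --> (0 : R) := @cvg_harmonic R.
have e0 n : 0 < harmonic n :> R by rewrite invr_gt0.
have cc : (fun=> c) n @[n --> \oo] --> c by exact: cvg_cst.
have ch : chain (fun t => Num.max (t - c) 0) (fun t => if t == c then 2^-1 else (c < t)%R%:R).
  apply: (chain_sqrt_limit c0 e0 cc hc) => t.
  case: eqVneq => [->|tc]; last exact: sqrt_pos_deriv_cvg tc e0 cc hc.
  rewrite (_ : (fun n => _) = fun=> 2^-1); first exact: cvg_cst.
  by apply/funext => n; rewrite /sqrt_pos_deriv subrr mul0r add0r mul1r.
have h2 := (ch u g hu ug).2.
apply: ae_in1 (weak_grad_unique dO h1 h2) => x _ h uc; move: h.
rewrite uc eqxx ltxx scale0r => /esym/eqP.
by rewrite scaler_eq0 invr_eq0 pnatr_eq0 /= => /eqP.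
Qed.

End chain_rule.

(** * Positive parts and their continuity in H^1_0 *)

Section truncation.
Context {R : realType} {m : nat}.
Local Notation E := 'rV[R]_m.+1.
Local Notation mu := (@leb R m).
Context (Omega : set E) (dO : bounded_open Omega).
Implicit Types (u v phi : E -> R) (g h : E -> E) (T S : R -> R).
Local Notation sq := (sqint mu Omega : set (E -> R)).
Local Notation ip := (ip mu Omega).
Local Notation dirichlet := (dirichlet Omega).
Local Notation sobolev_ip := (sobolev_ip Omega).
Let mO := domain_measurable dO.
Let sF := ip_form dO.
Let ss : subspace sq := si_sub sF.

Definition posB (c : R) u : E -> R := fun x => Num.max (u x - c) 0.

Lemma posB_ge0 c u x : 0 <= posB c u x.
Proof. by rewrite /posB le_max lexx orbT. Qed.

Lemma posB_decomposition v : v = posB 0 v - posB 0 (- v).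
Proof.
apply/funext => x; rewrite -[RHS]/(Num.max (v x - 0) 0 - Num.max (- v x - 0) 0) !subr0.
case: (leP (v x) 0) => h; first by rewrite (max_idPl _) ?oppr_ge0// sub0r opprK.
by rewrite (max_idPr _) ?oppr_le0 ?(ltW h)// subr0.
Qed.

Lemma posB_lip c (a b : R) : `|Num.max (a - c) 0 - Num.max (b - c) 0| <= `|a - b|.
Proof.
have h1 := ler_norm (a - b); have h2 := ler_norm (b - a); rewrite distrC in h2.
by have [h|h] := leP (a - c) 0; have [k|k] := leP (b - c) 0; rewrite ler_norml; apply/andP; split; lra.
Qed.

Lemma posB_le_norm c (a : R) : 0 <= c -> `|Num.max (a - c) 0| <= `|a|.
Proof.
move=> c0; have := posB_lip c a 0; rewrite sub0r subr0.
by rewrite [Num.max (- c) 0]max_r ?oppr_le0// subr0.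
Qed.

Lemma H10_posB c u : 0 <= c -> H10 Omega u -> H10 Omega (posB c u).
Proof. by move=> c0 hu; exact: (chain_posB dO c0 hu (wgradP dO (H10_H1 hu))).1. Qed.

Lemma weak_grad_posB c u g : 0 <= c -> H10 Omega u -> is_weak_grad Omega u g ->
  is_weak_grad Omega (posB c u) (fun x => (c < u x)%R%:R *: g x).
Proof. by move=> c0 hu ug; exact: (chain_posB dO c0 hu ug).2. Qed.

Lemma measurable_gt_ind u v : measurable_fun Omega u -> measurable_fun Omega v ->
  measurable_fun Omega (fun x => (u x < v x)%R%:R : R).
Proof.
move=> mu_ mv; have mb : measurable_fun [set: bool] (fun b : bool => b%:R : R) by [].
exact: measurableT_comp mb (measurable_fun_ltr mu_ mv).
Qed.

(** Along an a.e. convergent subsequence the indicators of [d n < g n] converge where [v] is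
    nonzero. On the zero set of [v] they may oscillate, but there the gradient of [v] vanishes by
    [grad_level_set]. *)
Lemma posB_cvg (g : nat -> E -> R) v (d : nat -> R) :
  (forall n, H10 Omega (g n)) -> H10 Omega v -> form_cvg dirichlet g v ->
  (forall n, 0 <= d n) -> d n @[n --> \oo] --> (0 : R) ->
  exists2 s : nat -> nat, (forall n, (n <= s n)%N) &
    form_cvg dirichlet (fun n => posB (d (s n)) (g (s n))) (posB 0 v).
Proof.
move=> hg hv gv d0 dc; have gv' := dirichlet_cvg_sobolev dO hg hv gv.
have hg1 n := H10_H1 (hg n); have hv1 := H10_H1 hv.
have G n := wgradP dO (hg1 n); have Gv := wgradP dO hv1.
have sg n := H1_sq dO (hg1 n); have sv := H1_sq dO hv1.
have [ci ce] := iffLR (sobolev_cvgP dO hg1 hv1 G Gv) gv'.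
have [s sn aes] := form_cvg_ae_subseq mO sg sv ci; exists s => //.
have dsc : d (s n) @[n --> \oo] --> (0 : R).
  apply: (cvg_comp _ _ _ dc); move=> A [N _ HN]; exists N => // n Nn; apply: HN => /=.
  exact: leq_trans Nn (sn n).
have sub (a : nat -> E -> R) (w : E -> R) : form_cvg ip a w -> form_cvg ip (fun n => a (s n)) w.
  move=> h e e0; have [N HN] := h e e0; exists N => n Nn; apply: HN.
  exact: leq_trans Nn (sn n).
have cis := sub _ _ ci; have ces i := sub _ _ (ce i).
have hp n : H10 Omega (posB (d (s n)) (g (s n))) := H10_posB (d0 (s n)) (hg (s n)).
have hp0 : H10 Omega (posB 0 v) := H10_posB (lexx 0) hv.
have hq n : H10 Omega (posB (d (s n)) v) := H10_posB (d0 (s n)) hv.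
have wp n := weak_grad_posB (d0 (s n)) (hg (s n)) (G (s n)).
have wp0 := weak_grad_posB (lexx 0) hv Gv.
apply: (sobolev_cvg_dirichlet dO (fun n => H10_H1 (hp n)) (H10_H1 hp0)).
apply/(sobolev_cvgP dO (fun n => H10_H1 (hp n)) (H10_H1 hp0) wp wp0); split.
- have sp n := H1_sq dO (H10_H1 (hp n)); have sq0 n := H1_sq dO (H10_H1 (hq n)).
  have c1 : form_cvg ip (fun n => posB (d (s n)) (g (s n)) - posB (d (s n)) v) 0.
    apply: (ip_cvg_le mO (fun n => subB ss (sp n) (sq0 n)) (sub0 ss) (fun n => sg (s n)) sv ler01 _ cis).
    by move=> n; apply: ae_inW => x _; rewrite mul1r -[0 x]/(0 : R) subr0; exact: posB_lip.
  have d1 n : ae_in Omega (fun x => `|posB (d (s n)) v x| <= `|v x|).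
    by apply: ae_inW => x _; exact: posB_le_norm.
  have d2 : ae_in Omega (fun x => posB (d (s n)) v x @[n --> \oo] --> posB 0 v x).
    apply: ae_inW => x _; rewrite /posB.
    apply/cvgrPdist_le => e e0; near=> n.
    have := posB_lip 0 (v x) (v x - d (s n)); rewrite subKr !subr0 => /le_trans; apply.
    rewrite ger0_norm//; near: n; exact: (cvgr_le _ dsc).
  have [_ s0 c2] := sqint_dominated mO (fun n => (sq0 n).1) (H1_sq dO (H10_H1 hp0)).1 sv d1 d2.
  have := form_cvgZD sF 1 (fun n => subB ss (sp n) (sq0 n)) (sub0 ss) sq0 s0 c1 c2.
  rewrite scaler0 add0r; have -> // : (fun n => posB (d (s n)) (g (s n))) =
    (fun n => 1 *: (posB (d (s n)) (g (s n)) - posB (d (s n)) v) + posB (d (s n)) v).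
  by apply/funext => n; rewrite scale1r subrK.
- move=> i; pose a n (x : E) : R := (d (s n) < g (s n) x)%R%:R.
  pose a0 (x : E) : R := (0 < v x)%R%:R.
  have ma n : measurable_fun Omega (a n).
    exact: measurable_gt_ind (measurable_cst _) (sg (s n)).1.
  have ma0 : measurable_fun Omega a0 by exact: measurable_gt_ind (measurable_cst _) sv.1.
  have a1 n x : `|a n x| <= 1 by rewrite /a; case: ltP => _; rewrite ?normr1 ?normr0.
  have a01 x : `|a0 x| <= 1 by rewrite /a0; case: ltP => _; rewrite ?normr1 ?normr0.
  have gs n := weak_grad_sqv dO (G (s n)) i; have gs0 := weak_grad_sqv dO Gv i.
  have sd n := subB ss (gs n) gs0.
  have s1 n := sq_mul_bounded dO (ma n) ler01 (a1 n) (sd n).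
  have s2 n := sq_mul_bounded dO (ma n) ler01 (a1 n) gs0.
  have s3 := sq_mul_bounded dO ma0 ler01 a01 gs0.
  have c1 : form_cvg ip (fun n => a n * (cmp i (wgrad Omega (g (s n))) - cmp i (wgrad Omega v))) 0.
    apply: (ip_cvg_le mO s1 (sub0 ss) gs gs0 ler01 _ (ces i)).
    move=> n; apply: ae_inW => x _; rewrite -[0 x]/(0 : R) subr0.
    rewrite -[(a n * _) x]/(a n x * (cmp i (wgrad Omega (g (s n))) x - cmp i (wgrad Omega v) x)).
    by rewrite normrM ler_wpM2r.
  have d1 n : ae_in Omega (fun x => `|(a n * cmp i (wgrad Omega v)) x| <= `|cmp i (wgrad Omega v) x|).
    apply: ae_inW => x _; rewrite -[(a n * _) x]/(a n x * cmp i (wgrad Omega v) x).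
    by rewrite normrM ler_piMl.
  have d2 : ae_in Omega (fun x => (a n * cmp i (wgrad Omega v)) x @[n --> \oo] -->
      (a0 * cmp i (wgrad Omega v)) x).
    have lv := grad_level_set dO (lexx 0) hv Gv.
    apply: ae_in2 lv aes => x _ lv aes.
    have [v0|v0|v0] := ltgtP (v x) 0.
    - apply: cvgM; last exact: cvg_cst.
      apply: cvg_near_cst.
      near=> n; have h : g (s n) x <= d (s n).
        by apply: le_trans (d0 (s n)); near: n; exact: (cvgr_le _ aes).
      by rewrite /a0 /a (lt_gtF v0) (le_gtF h).
    - apply: cvgM; last exact: cvg_cst.
      have h : g (s n) x - d (s n) @[n --> \oo] --> v x.
        by rewrite -[X in _ --> X]subr0; apply: cvgB.
      apply: cvg_near_cst; near=> n; rewrite /a0 /a v0 -subr_gt0.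
      suff -> : 0 < g (s n) x - d (s n) by [].
      by near: n; apply: (cvgr_gt _ h).
    - have z : cmp i (wgrad Omega v) x = 0 by rewrite /cmp lv// mxE.
      rewrite (_ : (fun n => _) = fun=> 0); last first.
        by apply/funext => n; rewrite -[LHS]/(a n x * cmp i (wgrad Omega v) x) z mulr0.
      rewrite -[(a0 * _) x]/(a0 x * cmp i (wgrad Omega v) x) z mulr0.
      exact: cvg_cst.
  have [_ _ c2] := sqint_dominated mO (fun n => (s2 n).1) s3.1 gs0 d1 d2.
  have H := form_cvgZD sF 1 s1 (sub0 ss) s2 s3 c1 c2.
  rewrite scaler0 add0r in H; rewrite (cmp_scale a0).
  have -> // : (fun n => cmp i (fun x => a n x *: wgrad Omega (g (s n)) x)) =
    (fun n => 1 *: (a n * (cmp i (wgrad Omega (g (s n))) - cmp i (wgrad Omega v)))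
      + a n * cmp i (wgrad Omega v)).
  by apply/funext => n; rewrite cmp_scale scale1r mulrBr subrK.
Unshelve. all: by end_near. Qed.

End truncation.

(** * Bounded coefficients *)

HB.lock Definition energy {R : realType} {m : nat} (Omega : set 'rV[R]_m.+1)
  (q : 'rV[R]_m.+1 -> 'M[R]_m.+1) (u v : 'rV[R]_m.+1 -> R) : R := diffusion_form Omega q u v.

Section psd.
Context {R : realType} {n : nat}.
Implicit Types M N : 'M[R]_n.+1.

Lemma quad_delta M i j : ((delta_mx 0 i : 'rV[R]_n.+1) *m M *m (delta_mx 0 j : 'rV_n.+1)^T) 0 0 = M i j.
Proof. by rewrite trmx_delta -rowE -colE !mxE. Qed.

Lemma psd_diag M i : psd M -> 0 <= M i i.
Proof. by move=> /(_ (delta_mx 0 i)); rewrite quad_delta. Qed.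

Lemma quadD M (a b : 'rV[R]_n.+1) (s : R) :
  ((a + s *: b) *m M *m (a + s *: b)^T) 0 0 = (a *m M *m a^T) 0 0 +
    s * ((a *m M *m b^T) 0 0 + (b *m M *m a^T) 0 0) + s ^+ 2 * (b *m M *m b^T) 0 0.
Proof.
have -> : (a + s *: b)^T = a^T + s *: b^T by rewrite linearD linearZ.
rewrite !mulmxDl !mulmxDr -!scalemxAl -!scalemxAr !mxE; ring.
Qed.

(** Positivity is tested on the sum and on the difference of two unit vectors. *)
Lemma psd_offdiag M i j : psd M -> M^T = M -> 2 * `|M i j| <= M i i + M j j.
Proof.
move=> pM sM; have sij : M j i = M i j by rewrite -[in LHS]sM mxE.
have h s : 0 <= M i i + s * (M i j + M i j) + s ^+ 2 * M j j.
  by have := pM (delta_mx 0 i + s *: delta_mx 0 j); rewrite quadD !quad_delta sij.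
have := h 1; have := h (-1); rewrite sqrrN expr1n.
by case: (ger0P (M i j)) => _; lra.
Qed.

End psd.

Section energy.
Context {R : realType} {m : nat}.
Local Notation E := 'rV[R]_m.+1.
Local Notation Mat := 'M[R]_m.+1.
Local Notation mu := (@leb R m).
Context (Omega : set E) (dO : bounded_open Omega).
Implicit Types (u v phi : E -> R) (g h : E -> E) (q d : E -> Mat).
Local Notation sq := (sqint mu Omega : set (E -> R)).
Local Notation ip := (ip mu Omega).
Local Notation dirichlet := (dirichlet Omega).
Local Notation energy := (energy Omega).
Let mO := domain_measurable dO.
Let sF := ip_form dO.
Let ss : subspace sq := si_sub sF.

Definition entry q i j : E -> R := fun x => q x i j.

(** Neither symmetry nor positivity is included, so that the directions [d] qualify as well as the
    admissible [q]. *)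
Definition bounded_coef q := (forall i j, measurable_fun Omega (entry q i j)) /\
  exists M : R, 0 <= M /\ forall i j, ae_in Omega (fun x => `|entry q i j x| <= M).

Lemma sq_sum (I : Type) (r : seq I) (F : I -> E -> R) : (forall i, sq (F i)) ->
  sq (\sum_(i <- r) F i).
Proof.
move=> sFi; elim: r => [|i r IH]; first by rewrite big_nil; exact: (sub0 ss).
by rewrite big_cons; exact: (subD ss (sFi i) IH).
Qed.

Lemma ip_suml (I : Type) (r : seq I) (F : I -> E -> R) w : (forall i, sq (F i)) -> sq w ->
  ip (\sum_(i <- r) F i) w = \sum_(i <- r) ip (F i) w.
Proof.
move=> sFi sw; have L := linear_forml sF sw.
elim: r => [|i r IH]; first by rewrite !big_nil; exact: (lin0 ss L).
by rewrite !big_cons (linD L (sFi i) (sq_sum r sFi)) IH.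
Qed.

Lemma coef_sq q i j w : bounded_coef q -> sq w -> sq (entry q i j * w).
Proof.
move=> [mq [M [M0 HM]]] sw; apply: (sqint_ae_le mO _ (subZ ss M sw)).
  by apply: measurable_funM; [exact: mq|exact: sw.1].
apply: ae_in1 (HM i j) => x _ h.
rewrite -[(_ * w) x]/(entry q i j x * w x) -[(M *: w) x]/(M * w x) !normrM.
by rewrite ler_wpM2r// (ger0_norm M0).
Qed.

Lemma energyE q u v g h : bounded_coef q -> is_weak_grad Omega u g -> is_weak_grad Omega v h ->
  energy q u v = \sum_i \sum_j ip (entry q i j * cmp j g) (cmp i h).
Proof.
move=> bq ug vh; have gE := wgradE dO ug; have hE := wgradE dO vh.
have sg := weak_grad_sqv dO ug; have sh := weak_grad_sqv dO vh.
have wu := weak_grad_sqv dO (wgrad_xget ug); have wv := weak_grad_sqv dO (wgrad_xget vh).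
have F k : sqv Omega k -> forall i, cmp i (fun x => k x *m (q x)^T) = \sum_j entry q i j * cmp j k.
  move=> sk i; apply/funext => x; rewrite /cmp mxE fct_sumE; apply: eq_bigr => j _.
  by rewrite mxE mulrC.
have FS k : sqv Omega k -> sqv Omega (fun x => k x *m (q x)^T).
  by move=> sk i; rewrite F//; apply: sq_sum => j; exact: coef_sq.
rewrite energy.unlock /diffusion_form (innerL2_vecE dO (FS _ wu) wv).
have -> : \sum_i ip (cmp i (fun x => wgrad Omega u x *m (q x)^T)) (cmp i (wgrad Omega v)) =
    \sum_i ip (cmp i (fun x => g x *m (q x)^T)) (cmp i h).
  apply: (ip_cmp_ae dO (FS _ wu) (FS _ sg) wv sh) => //.
  by apply: ae_in1 gE => x _ ->.
apply: eq_bigr => i _; rewrite (F _ sg) ip_suml// => j; exact: coef_sq.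
Qed.

Lemma energy_linr q u : bounded_coef q -> H1 Omega u -> linear_on (H1 Omega) (energy q u).
Proof.
move=> bq hu c v w hv hw; have U := wgradP dO hu; have V := wgradP dO hv; have W := wgradP dO hw.
rewrite (energyE bq U (weak_gradZD dO c (H1_sq dO hv) (H1_sq dO hw) V W)).
rewrite (energyE bq U V) (energyE bq U W) mulr_sumr -big_split /=; apply: eq_bigr => i _.
rewrite mulr_sumr -big_split /=; apply: eq_bigr => j _.
have -> : cmp i (fun x => c *: wgrad Omega v x + wgrad Omega w x) =
    c *: cmp i (wgrad Omega v) + cmp i (wgrad Omega w).
  by apply/funext => x; rewrite /cmp !mxE.
have sx := coef_sq i j bq (wgrad_sqv dO hu j).
exact: (linear_formr sF sx c (wgrad_sqv dO hv i) (wgrad_sqv dO hw i)).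
Qed.

Lemma energy_linl q v : bounded_coef q -> H1 Omega v -> linear_on (H1 Omega) ((energy q)^~ v).
Proof.
move=> bq hv c u w hu hw; have U := wgradP dO hu; have V := wgradP dO hv; have W := wgradP dO hw.
rewrite (energyE bq (weak_gradZD dO c (H1_sq dO hu) (H1_sq dO hw) U W) V).
rewrite (energyE bq U V) (energyE bq W V) mulr_sumr -big_split /=; apply: eq_bigr => i _.
rewrite mulr_sumr -big_split /=; apply: eq_bigr => j _.
have -> : entry q i j * cmp j (fun x => c *: wgrad Omega u x + wgrad Omega w x) =
    c *: (entry q i j * cmp j (wgrad Omega u)) + entry q i j * cmp j (wgrad Omega w).
  apply/funext => x.
  rewrite -[RHS]/(c * (entry q i j x * cmp j (wgrad Omega u) x) + entry q i j x * cmp j (wgrad Omega w) x).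
  rewrite -[LHS]/(entry q i j x * cmp j (fun x => c *: wgrad Omega u x + wgrad Omega w x) x).
  by rewrite /cmp !mxE mulrDr mulrCA.
have s1 := coef_sq i j bq (wgrad_sqv dO hu j); have s2 := coef_sq i j bq (wgrad_sqv dO hw j).
exact: (linear_forml sF (wgrad_sqv dO hv i) c s1 s2).
Qed.

Lemma bounded_coefZD c q d : bounded_coef q -> bounded_coef d -> bounded_coef (c *: q + d).
Proof.
move=> [mq [M [M0 HM]]] [md [N [N0 HN]]].
have EE i j : entry (c *: q + d) i j = (fun x => c * entry q i j x + entry d i j x).
  by apply/funext => x; rewrite /entry -[(_ + d) x]/(c *: q x + d x) !mxE.
split=> [i j|].
  rewrite EE; apply: measurable_funD; last exact: md.
  by apply: measurable_funM; [exact: measurable_cst|exact: mq].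
exists (`|c| * M + N); split; first by rewrite addr_ge0// mulr_ge0.
move=> i j; apply: ae_in2 (HM i j) (HN i j) => x _ h1 h2; rewrite EE.
by rewrite (le_trans (ler_normD _ _))// lerD// normrM ler_wpM2l.
Qed.

Lemma energy_coefZD c q d u v : bounded_coef q -> bounded_coef d -> H1 Omega u -> H1 Omega v ->
  energy (c *: q + d) u v = c * energy q u v + energy d u v.
Proof.
move=> bq bd hu hv; have U := wgradP dO hu; have V := wgradP dO hv.
rewrite (energyE (bounded_coefZD c bq bd) U V) (energyE bq U V) (energyE bd U V).
rewrite mulr_sumr -big_split /=; apply: eq_bigr => i _.
rewrite mulr_sumr -big_split /=; apply: eq_bigr => j _.
have -> : entry (c *: q + d) i j * cmp j (wgrad Omega u) =
    c *: (entry q i j * cmp j (wgrad Omega u)) + entry d i j * cmp j (wgrad Omega u).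
  apply/funext => x.
  rewrite -[RHS]/(c * (entry q i j x * cmp j (wgrad Omega u) x) + entry d i j x * cmp j (wgrad Omega u) x).
  rewrite -[LHS]/(entry (c *: q + d) i j x * cmp j (wgrad Omega u) x).
  by rewrite mulrA -mulrDl /entry -[(_ + d) x]/(c *: q x + d x) !mxE.
have s1 := coef_sq i j bq (wgrad_sqv dO hu j); have s2 := coef_sq i j bd (wgrad_sqv dO hu j).
exact: (linear_forml sF (wgrad_sqv dO hv i) c s1 s2).
Qed.

Lemma energy_sym q u v : bounded_coef q -> ae_in Omega (fun x => (q x)^T = q x) ->
  H1 Omega u -> H1 Omega v -> energy q u v = energy q v u.
Proof.
move=> bq sq_ hu hv; have U := wgradP dO hu; have V := wgradP dO hv.
rewrite (energyE bq U V) (energyE bq V U) exchange_big /=; apply: eq_bigr => i _.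
apply: eq_bigr => j _.
have su := wgrad_sqv dO hu i; have sv := wgrad_sqv dO hv j.
have s1 := coef_sq j i bq su; have s2 := coef_sq i j bq sv.
have -> : ip (entry q j i * cmp i (wgrad Omega u)) (cmp j (wgrad Omega v)) =
    ip (entry q j i * cmp j (wgrad Omega v)) (cmp i (wgrad Omega u)).
  by rewrite !ip_def; apply: eq_Rintegral => x _; rewrite -![(_ * _) x]/(_ x * _ x) mulrAC.
apply: (ae_eq_ip mO (coef_sq j i bq sv).1 s2.1 su.1 su.1); last by apply: ae_inW.
apply: ae_in1 sq_ => x _ h; rewrite -[LHS]/(entry q j i x * _) -[RHS]/(entry q i j x * _).
by rewrite /entry -[in LHS]h mxE.
Qed.

Lemma bounded_coef_cst (A : Mat) : bounded_coef (cst A).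
Proof.
split=> [i j|]; first exact: measurable_cst.
exists (\sum_i \sum_j `|A i j|); split; first by apply: sumr_ge0 => i _; apply: sumr_ge0.
move=> i j; apply: ae_inW => x _; rewrite /entry (bigD1 i)//= (bigD1 j)//= -addrA lerDl.
by rewrite addr_ge0//; apply: sumr_ge0 => // k _; apply: sumr_ge0.
Qed.

Lemma energy1 u v : H1 Omega u -> H1 Omega v -> energy (cst 1%:M) u v = dirichlet u v.
Proof.
move=> hu hv; have U := wgradP dO hu; have V := wgradP dO hv.
rewrite (energyE (bounded_coef_cst _) U V) (dirichletE dO U V); apply: eq_bigr => i _.
have L := linear_forml sF (wgrad_sqv dO hv i).
rewrite (bigD1 i)//= big1 ?addr0.
  congr ip; apply/funext => x; rewrite -[LHS]/(entry (cst 1%:M) i i x * _).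
  by rewrite /entry mxE eqxx mul1r.
move=> j ji; rewrite -[RHS](lin0 ss L); congr ip; apply/funext => x.
rewrite -[LHS]/(entry (cst 1%:M) i j x * _).
by rewrite /entry mxE eq_sym (negbTE ji) mul0r.
Qed.

Lemma energy_bound q : bounded_coef q -> exists2 C : R, 0 < C &
  forall u v, H1 Omega u -> H1 Omega v -> energy q u v ^+ 2 <= C * (dirichlet u u * dirichlet v v).
Proof.
move=> bq; have [mq [M [M0 HM]]] := bq.
(* There are [n * n] entries, each bounded by [M]; the [+ 1] makes the constant positive. The square
   is due to the squared form of the estimate. *)
pose n : R := m.+1%:R; exists ((n * n * (M + 1)) ^+ 2).
  by rewrite exprn_gt0// !mulr_gt0 ?ltr0n// ltr_wpDl.
move=> u v hu hv; have U := wgradP dO hu; have V := wgradP dO hv.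
have dF := dirichlet_form dO; have du := si_pos dF hu; have dv := si_pos dF hv.
have comp_le w i : H1 Omega w -> ip (cmp i (wgrad Omega w)) (cmp i (wgrad Omega w)) <= dirichlet w w.
  move=> hw; rewrite (dirichletE dO (wgradP dO hw) (wgradP dO hw)) (bigD1 i)//= lerDl.
  by apply: sumr_ge0 => j _; apply: (si_pos sF); exact: wgrad_sqv.
set P := dirichlet u u * dirichlet v v; have P0 : 0 <= P by exact: mulr_ge0.
have T i j : `|ip (entry q i j * cmp j (wgrad Omega u)) (cmp i (wgrad Omega v))| <= (M + 1) * Num.sqrt P.
  have su := wgrad_sqv dO hu j; have sv := wgrad_sqv dO hv i; have sx := coef_sq i j bq su.
  have h1 := form_CS sF sx sv.
  have h2 : ip (entry q i j * cmp j (wgrad Omega u)) (entry q i j * cmp j (wgrad Omega u)) <=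
      M ^+ 2 * dirichlet u u.
    apply: le_trans (ler_wpM2l (sqr_ge0 M) (comp_le u j hu)).
    apply: (ip_sq_le mO sx su M0); apply: ae_in1 (HM i j) => x _ h.
    by rewrite -[(entry q i j * _) x]/(entry q i j x * _) normrM ler_wpM2r.
  have h3 := ler_pM (si_pos sF sx) (si_pos sF sv) h2 (comp_le v i hv).
  rewrite -mulrA -/P in h3; have := le_trans h1 h3.
  rewrite -(sqr_sqrtr P0) -exprMn -ler_sqrt ?sqr_ge0// !sqrtr_sqr => h4.
  rewrite normrM (ger0_norm M0) (ger0_norm (sqrtr_ge0 P)) in h4 *.
  by apply: le_trans h4 _; rewrite ler_wpM2r ?sqrtr_ge0// lerDl.
have S : `|energy q u v| <= n * n * (M + 1) * Num.sqrt P.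
  rewrite (energyE bq U V); apply: le_trans (ler_norm_sum _ _ _) _.
  apply: (@le_trans _ _ (\sum_(i < m.+1) n * ((M + 1) * Num.sqrt P))).
    apply: ler_sum => i _; apply: le_trans (ler_norm_sum _ _ _) _.
    apply: (@le_trans _ _ (\sum_(j < m.+1) (M + 1) * Num.sqrt P)); first exact: ler_sum.
    by rewrite sumr_const card_ord mulr_natl.
  by rewrite sumr_const card_ord -mulr_natl !mulrA.
rewrite -(sqr_sqrtr P0) -exprMn -(real_normK (num_real (energy q u v))).
by rewrite lerXn2r ?nnegrE// (le_trans _ S).
Qed.

(** The gradient of [posB c u] is that of [u] times an indicator, and an indicator equals its
    square. *)
Lemma energy_posB q c u : bounded_coef q -> 0 <= c -> H10 Omega u ->
  energy q u (posB c u) = energy q (posB c u) (posB c u).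
Proof.
move=> bq c0 hu; have U := wgradP dO (H10_H1 hu); have P := weak_grad_posB dO c0 hu U.
rewrite (energyE bq U P) (energyE bq P P); apply: eq_bigr => i _; apply: eq_bigr => j _.
rewrite !ip_def; apply: eq_Rintegral => x _; rewrite !cmp_scale.
rewrite -![(_ * _) x]/(_ x * _ x).
by rewrite /=; case: (c < u x); rewrite !(mul1r, mul0r, mulr0).
Qed.

Lemma energy_psd q u : bounded_coef q -> ae_in Omega (fun x => psd (q x)) -> H1 Omega u ->
  0 <= energy q u u.
Proof.
move=> bq pq hu; have U := wgradP dO hu; have sU := wgrad_sqv dO hu.
have sF' : sqv Omega (fun x => wgrad Omega u x *m (q x)^T).
  move=> i; have -> : cmp i (fun x => wgrad Omega u x *m (q x)^T) =
      \sum_j entry q i j * cmp j (wgrad Omega u).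
    apply/funext => x; rewrite /cmp mxE fct_sumE; apply: eq_bigr => j _.
    by rewrite mxE mulrC.
  by apply: sq_sum => j; exact: coef_sq.
rewrite energy.unlock; apply: (innerL2_vec_ge0 dO sF' sU).
apply: ae_in1 pq => x _ /(_ (wgrad Omega u x)); set a := wgrad Omega u x.
suff -> : (a *m q x *m a^T) 0 0 = dot (a *m (q x)^T) a by [].
rewrite /dot -[RHS]/(\sum_i _); have -> : (a *m q x *m a^T) 0 0 = ((a *m q x *m a^T)^T) 0 0 by rewrite [RHS]mxE.
rewrite trmx_mul trmxK trmx_mul mulmxA mxE; apply: eq_bigr => k _.
by rewrite [a^T k 0]mxE.
Qed.

(** * Boundedness, coercivity and convexity of the admissible coefficients *)

Section admissible_coefficients.
Context (qmin qmax : R) (qmin0 : 0 < qmin).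
Local Notation Qad := (Qad Omega qmin qmax).

Lemma Qad_sym q : Qad q -> ae_in Omega (fun x => (q x)^T = q x).
Proof. by move=> [[]]. Qed.

Lemma psd_scalar (c : R) : 0 <= c -> psd (c%:M : Mat).
Proof.
move=> c0 a; rewrite mul_mx_scalar -scalemxAl mxE mulr_ge0// mxE.
by apply: sumr_ge0 => i _; rewrite [a^T i 0]mxE -expr2 sqr_ge0.
Qed.

Lemma psdD (A B : Mat) : psd A -> psd B -> psd (A + B).
Proof. by move=> pA pB a; rewrite mulmxDr mulmxDl mxE addr_ge0. Qed.

Lemma Qad_bounded q : Qad q -> bounded_coef q.
Proof.
move=> [[Lq sq_] lq]; split=> [i j|]; first exact: (iffLR (L2P dO _) (Lq i j)).1.
exists `|qmax|; split=> // i j; apply: ae_in2 sq_ lq => x _ sx [l1 l2].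
have p : psd (q x).
  by rewrite -[q x](subrK qmin%:M); apply: psdD l1 (psd_scalar (ltW qmin0)).
have h k : q x k k <= qmax.
  by have := psd_diag k l2; rewrite !mxE eqxx mulr1n subr_ge0.
have := psd_offdiag i j p sx; have := h i; have := h j; have := ler_norm qmax.
by rewrite /entry; move=> *; lra.
Qed.

Lemma energy_Qad_form q : Qad q -> semi_inner (H10 Omega) (energy q).
Proof.
move=> Qq; have bq := Qad_bounded Qq; split; first exact: H10_subspace.
- by move=> u v /H10_H1 hu /H10_H1 hv; exact: energy_sym (Qad_sym Qq) hu hv.
- by move=> c u v w /H10_H1 hu /H10_H1 hv /H10_H1 hw; exact: (energy_linl bq hw).
- move=> u /H10_H1 hu; apply: energy_psd => //.
  apply: ae_in1 Qq.2 => x _ [l1 _].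
  by rewrite -[q x](subrK qmin%:M); apply: psdD l1 (psd_scalar (ltW qmin0)).
Qed.

Lemma energy_coercive q u : Qad q -> H1 Omega u -> qmin * dirichlet u u <= energy q u u.
Proof.
move=> Qq hu; have bq := Qad_bounded Qq; have b1 := bounded_coef_cst (1%:M : Mat).
have bb := bounded_coefZD (- qmin) b1 bq.
have : 0 <= energy (- qmin *: cst 1%:M + q) u u.
  apply: energy_psd => //; apply: ae_in1 Qq.2 => x _ [l1 _].
  rewrite -[(_ + _) x]/(- qmin *: 1%:M + q x) scalemx1 addrC.
  by have -> : (- qmin)%:M = - (qmin%:M : Mat) by rewrite raddfN.
rewrite energy_coefZD// energy1// mulNr addrC subr_ge0//.
Qed.

Lemma Qad_direction_bounded q d : Qad q -> Qad (q + d) -> bounded_coef d.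
Proof.
move=> Qq Qqd; have := bounded_coefZD (-1) (Qad_bounded Qq) (Qad_bounded Qqd).
by have -> : -1 *: q + (q + d) = d by rewrite scaleN1r addKr.
Qed.

Lemma Qad_segment q d t : Qad q -> Qad (q + d) -> 0 <= t -> t <= 1 -> Qad (q + t *: d).
Proof.
move=> Qq Qqd t0 t1; have EE : q + t *: d = (1 - t) *: q + t *: (q + d).
  by rewrite scalerDr addrA -scalerDl subrK scale1r.
have [[Lq sq_] lq] := Qq; have [[Lqd sqd] lqd] := Qqd.
have ex x : (q + t *: d) x = (1 - t) *: q x + t *: (q + d) x by rewrite EE.
split; first split.
- move=> i j; apply/(L2P dO).
  have -> : (fun x => (q + t *: d) x i j) = (1 - t) *: (fun x => q x i j) + t *: (fun x => (q + d) x i j).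
    by apply/funext => x; rewrite ex -[RHS]/((1 - t) * q x i j + t * (q + d) x i j) mxE [in LHS]mxE [X in _ + X]mxE.
  by apply: (subD ss); apply: (subZ ss); apply/(L2P dO); [exact: Lq|exact: Lqd].
- apply: ae_in2 sq_ sqd => x _ h1 h2; rewrite ex.
  by rewrite [LHS]linearD [X in X + _]linearZ [X in _ + X]linearZ /= h1 h2.
- apply: ae_in2 lq lqd => x _ [l1 l2] [k1 k2].
  have cvx (A B : Mat) : psd A -> psd B -> psd ((1 - t) *: A + t *: B).
    move=> pA pB a; rewrite mulmxDr mulmxDl -!scalemxAr -!scalemxAl !mxE.
    by rewrite addr_ge0// mulr_ge0// ?subr_ge0//; [have := pA a|have := pB a]; rewrite mxE.
  rewrite ex; split; rewrite /loewner_le.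
    have -> : (1 - t) *: q x + t *: (q + d) x - qmin%:M =
        (1 - t) *: (q x - qmin%:M) + t *: ((q + d) x - qmin%:M).
      rewrite !scalerBr addrACA -opprD -scalerDl subrK scale1r//.
    exact: cvx.
  have -> : qmax%:M - ((1 - t) *: q x + t *: (q + d) x) =
      (1 - t) *: (qmax%:M - q x) + t *: (qmax%:M - (q + d) x).
    by rewrite !scalerBr addrACA -opprD -scalerDl subrK scale1r.
  exact: cvx.
Qed.

End admissible_coefficients.

End energy.

(** * Capacity *)

Global Opaque H10.

Section form_series.
Context {R : realType} {X : lmodType R} {V : set X} {a : X -> X -> R}.
Context (sa : semi_inner V a) (cV : form_complete V a).
Let sV := si_sub sa.

(** The seminorm of [v k] is at most [2^-1 ^+ k] times the square root of [c]. These bounds add up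
    to twice that root, whose square is [4 * c]. *)
Lemma form_series (v : nat -> X) (c : R) : 0 <= c -> (forall k, V (v k)) ->
  (forall k, a (v k) (v k) <= c * 4^-1 ^+ k) ->
  exists2 u, V u & form_cvg a (fun n => \sum_(k < n) v k) u /\ a u u <= 4 * c.
Proof.
move=> c0 Vv av; pose S n := \sum_(k < n) v k; pose N x := Num.sqrt (a x x).
have VS n : V (S n).
  elim: n => [|n IH]; first by rewrite /S big_ord0; exact: (sub0 sV).
  by rewrite /S big_ord_recr /=; exact: (subD sV IH (Vv n)).
have h k j : N (S (k + j)%N - S k) <= Num.sqrt c * (2 * 2^-1 ^+ k * (1 - 2^-1 ^+ j)).
  elim: j => [|j IH].
    rewrite addn0 subrr expr0 subrr !mulr0 /N.
    by rewrite (lin0 sV (linear_formr sa (sub0 sV))) sqrtr0.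
  have -> : S (k + j.+1)%N - S k = (S (k + j)%N - S k) + v (k + j)%N.
    by rewrite addnS /S big_ord_recr /= addrAC.
  apply: le_trans (form_norm_triangle sa (subB sV (VS _) (VS _)) (Vv _)) _.
  have h2 : Num.sqrt (a (v (k + j)%N) (v (k + j)%N)) <= Num.sqrt c * 2^-1 ^+ (k + j).
    have p : 0 <= 2^-1 ^+ (k + j) :> R by rewrite exprn_ge0// invr_ge0.
    rewrite -[X in _ * X](ger0_norm p) -sqrtr_sqr -sqrtrM// ler_sqrt ?mulr_ge0 ?sqr_ge0//.
    apply: le_trans (av _) _; rewrite ler_wpM2l// -exprM mulnC exprM.
    by rewrite expr2 -invfM -natrM.
  apply: le_trans (lerD IH h2) _; rewrite -mulrDr ler_wpM2l ?sqrtr_ge0//.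
  rewrite exprD exprS; move: (2^-1 ^+ k) (2^-1 ^+ j) => x y.
  by rewrite le_eqVlt; apply/orP; left; apply/eqP; field.
have hS k n : (k <= n)%N -> a (S n - S k) (S n - S k) <= 4 * c * 4^-1 ^+ k.
  move=> kn; have VB := subB sV (VS n) (VS k).
  have p : 0 <= 2^-1 ^+ k :> R by rewrite exprn_ge0// invr_ge0.
  have pn : 0 <= 2^-1 ^+ (n - k) :> R by rewrite exprn_ge0// invr_ge0.
  have := h k (n - k)%N; rewrite subnKC// /N => hk.
  have hk2 : Num.sqrt (a (S n - S k) (S n - S k)) <= Num.sqrt c * (2 * 2^-1 ^+ k).
    apply: le_trans hk _; rewrite ler_wpM2l ?sqrtr_ge0//.
    by apply: ler_piMr; [exact: mulr_ge0|rewrite gerBl].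
  rewrite -(sqr_sqrtr (si_pos sa VB)).
  have -> : 4 * c * 4^-1 ^+ k = (Num.sqrt c * (2 * 2^-1 ^+ k)) ^+ 2.
    rewrite !exprMn (sqr_sqrtr c0) -(exprM _ k 2) mulnC exprM.
    have -> : (2^-1 ^+ 2 : R) = 4^-1 by rewrite expr2 -invfM -natrM.
    by rewrite (_ : 2 ^+ 2 = 4 :> R); [rewrite mulrCA mulrA|rewrite expr2 -natrM].
  by rewrite lerXn2r ?nnegrE ?mulr_ge0 ?sqrtr_ge0.
have [|u Vu Su] := cV VS.
  move=> e e0; have c4 : `|4^-1 : R| < 1 by rewrite ger0_norm ?invr_ge0// invf_lt1// ltr1n.
  have cv : 4 * c * 4^-1 ^+ n @[n --> \oo] --> (0 : R).
    rewrite -[X in _ --> X](mulr0 (4 * c)); apply: cvgM; [exact: cvg_cst|exact: cvg_expr].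
  have [M _ HM] := (cvgr_lt _ cv) e e0; exists M => n k Mn Mk.
  have [kn|nk] := leqP k n.
    by apply: le_lt_trans (hS _ _ kn) _; exact: HM.
  rewrite (formB_sym sa (VS n) (VS k)).
  by apply: le_lt_trans (hS _ _ (ltnW nk)) _; exact: HM.
exists u => //; split=> //.
have c1 := form_cvg_sq sa VS Vu Su.
apply: (ler_cvg_to c1 (cvg_cst (4 * c))); apply: nearW => n.
have S0 : S 0%N = 0 by rewrite /S big_ord0.
by have := hS 0%N n isT; rewrite S0 subr0 expr0 mulr1.
Qed.

End form_series.

Section capacity.
Context {R : realType} {m : nat}.
Local Notation E := 'rV[R]_m.+1.
Local Notation mu := (@leb R m).
Context (Omega : set E) (dO : bounded_open Omega).
Implicit Types (u v phi : E -> R) (A B O G : set E).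
Local Notation sq := (sqint mu Omega : set (E -> R)).
Local Notation ip := (ip mu Omega).
Local Notation dirichlet := (dirichlet Omega).
Let mO := domain_measurable dO.
Let sF := ip_form dO.
Let ss : subspace sq := si_sub sF.
Let dF := H10_form dO.
Let sV := H10_subspace dO.

(** A witness for [capacity Omega A < e]. Working with witnesses avoids the infimum, and potentials
    of different sets can be added. *)
Definition small (e : R) A := exists v O,
  [/\ H10 Omega v, open O, A `<=` O /\ O `<=` Omega, ae_in O (fun x => 1 <= v x) &
      dirichlet v v < e].

Definition null A := forall e : R, 0 < e -> small e A.

Definition qe (P : E -> Prop) := null [set x | Omega x /\ ~ P x].

Lemma capacity_small A (e : R) : (capacity Omega A < e%:E)%E <-> small e A.
Proof.
split.
- move=> /ereal_inf_lt[_ [v [hv [ O [oO AO OO vO]]] <-]]; rewrite lte_fin => h.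
  by exists v, O; split=> //; rewrite dirichlet.unlock.
- move=> [v [ O [hv oO [AO OO] vO dv]]].
  apply: le_lt_trans (_ : ((dirichlet v v)%:E < _)%E); last by rewrite lte_fin.
  apply: ereal_inf_lbound; exists v; last by rewrite dirichlet.unlock.
  by split=> //; exists O.
Qed.

Lemma capacity_ge0 A : (0 <= capacity Omega A)%E.
Proof.
apply: le_ereal_inf_tmp => _ [v [hv _] <-]; rewrite lee_fin.
by have := si_pos dF hv; rewrite dirichlet.unlock.
Qed.

Lemma capacity_null A : capacity Omega A = 0%E <-> null A.
Proof.
split=> [A0 e e0|nA]; first by apply/capacity_small; rewrite A0 lte_fin.
apply/eqP; rewrite eq_le capacity_ge0 andbT; apply/lee_addgt0Pr => e e0.
by rewrite add0e ltW//; apply/capacity_small; exact: nA.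
Qed.

Lemma qe_onP A (P : E -> Prop) : qe_on Omega A P <-> qe (fun x => A x -> P x).
Proof.
rewrite /qe_on capacity_null /qe.
have -> // : [set x | [/\ Omega x, A x & ~ P x]] = [set x | Omega x /\ ~ (A x -> P x)].
apply/seteqP; split => x /= => [[Ox Ax nP]|[Ox nAP]]; first by split=> // /(_ Ax).
by have [Ax nPx] := (not_implyP _ _).1 nAP.
Qed.

(** [posB c u] and [u - posB c u] are orthogonal by [energy_posB] with the identity as
    coefficient. *)
Lemma dirichlet_posB c u : 0 <= c -> H10 Omega u -> dirichlet (posB c u) (posB c u) <= dirichlet u u.
Proof.
move=> c0 hu; have hp := H10_posB dO c0 hu.
have h1 := H10_H1 hu; have h2 := H10_H1 hp.
have := energy_posB dO (bounded_coef_cst Omega 1%:M) c0 hu; rewrite !energy1// => h.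
have := si_pos dF (subB sV hu hp); rewrite (formB2 dF hu hp) h => *; lra.
Qed.

Definition absf u : E -> R := fun x => `|u x|.

Lemma absfE u : absf u = posB 0 u + posB 0 (- u).
Proof.
apply/funext => x; rewrite -[RHS]/(Num.max (u x - 0) 0 + Num.max (- u x - 0) 0) !subr0 /absf.
case: (ger0P (u x)) => h.
  by rewrite (max_idPr _) ?oppr_le0// addr0.
by rewrite (max_idPl _) ?oppr_ge0 ?(ltW h)// add0r.
Qed.

Lemma H10_absf u : H10 Omega u -> H10 Omega (absf u).
Proof.
move=> hu; rewrite absfE.
exact: (subD sV (H10_posB dO (lexx 0) hu) (H10_posB dO (lexx 0) (subN sV hu))).
Qed.

Lemma dirichlet_absf u : H10 Omega u -> dirichlet (absf u) (absf u) <= 4 * dirichlet u u.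
Proof.
move=> hu; rewrite absfE; have hN := subN sV hu.
have := formD2_le dF (H10_posB dO (lexx 0) hu) (H10_posB dO (lexx 0) hN).
have := dirichlet_posB (lexx 0) hu; have := dirichlet_posB (lexx 0) hN.
rewrite (formN2 dF hu) => *; lra.
Qed.

Lemma smallS A B e : A `<=` B -> small e B -> small e A.
Proof.
by move=> AB [v [ O [hv oO [BO OO] vO dv]]]; exists v, O; split=> //; split=> //; exact: subset_trans BO.
Qed.

Lemma nullS A B : A `<=` B -> null B -> null A.
Proof. by move=> AB nB e e0; exact: smallS AB (nB e e0). Qed.

Lemma small_pos A e : small e A -> exists v O,
  [/\ H10 Omega v, open O, A `<=` O /\ O `<=` Omega, ae_in O (fun x => 1 <= v x) &
      dirichlet v v < e /\ forall x, 0 <= v x].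
Proof.
move=> [v [ O [hv oO AO vO dv]]]; exists (posB 0 v), O; split.
- exact: (H10_posB dO (lexx 0) hv).
- exact: oO.
- exact: AO.
- by apply: ae_in1 vO => x _ h; rewrite /posB subr0 le_max h.
- split; last exact: posB_ge0.
  exact: le_lt_trans (dirichlet_posB (lexx 0) hv) dv.
Qed.

Lemma ae_in_bigcup (O : nat -> set E) (P : E -> Prop) : (forall k, ae_in (O k) P) ->
  ae_in (\bigcup_k O k) P.
Proof.
move=> h; have : ae_in setT (fun x => forall k, O k x -> P x).
  apply: ae_in_forall => k; have := h k; rewrite /ae_in; apply: filterS => x hx _; exact: hx.
by rewrite /ae_in; apply: filterS => x /(_ I) hx [k _ Ok]; exact: hx Ok.
Qed.

(** The sum of nonnegative potentials dominates each of them, hence is at least [1] a.e. on the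
    union. By [form_series] its energy is at most [4 * (e / 16)], which is below [e]. *)
Lemma small_bigcup (A : nat -> set E) (e : R) : 0 < e ->
  (forall k, small (e / 16 * 4^-1 ^+ k) (A k)) -> small e (\bigcup_k A k).
Proof.
move=> e0 sA.
have /choice[vO HvO] k : exists vO : (E -> R) * set E,
    [/\ H10 Omega vO.1, open vO.2, A k `<=` vO.2 /\ vO.2 `<=` Omega, ae_in vO.2 (fun x => 1 <= vO.1 x) &
      dirichlet vO.1 vO.1 < e / 16 * 4^-1 ^+ k /\ forall x, 0 <= vO.1 x].
  by have [v [ O H]] := small_pos (sA k); exists (v, O).
pose v k := (vO k).1; pose O k := (vO k).2.
have hv k : H10 Omega (v k) by case: (HvO k).
have v0 k x : 0 <= v k x by case: (HvO k) => _ _ _ _ [_]; exact.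
have e16 : 0 <= e / 16 by rewrite divr_ge0// ltW.
have [|u hu [cu du]] := form_series dF (H10_dirichlet_complete dO) e16 hv.
  by move=> k; case: (HvO k) => _ _ _ _ [/ltW].
have hS n : H10 Omega (\sum_(k < n) v k).
  elim: n => [|n IH]; first by rewrite big_ord0; exact: (sub0 sV).
  by rewrite big_ord_recr /=; exact: (subD sV IH (hv n)).
have ci := sobolev_cvg_ip dO (fun n => H10_H1 (hS n)) (H10_H1 hu) (dirichlet_cvg_sobolev dO hS hu cu).
have [s sn aes] := form_cvg_ae_subseq mO (fun n => H1_sq dO (H10_H1 (hS n))) (H1_sq dO (H10_H1 hu)) ci.
have vu : ae_in Omega (fun x => forall k, v k x <= u x).
  apply: ae_in_forall => k; apply: ae_in1 aes => x _ cx.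
  apply: (ler_cvg_to (cvg_cst (v k x)) cx); near=> n.
  have kn : (k < s n)%N by apply: leq_trans (sn n); near: n; exact: nbhs_infty_gt.
  rewrite fct_sumE (bigD1 (Ordinal kn))//= lerDl; apply: sumr_ge0 => i _; exact: v0.
exists u, (\bigcup_k O k); split=> //.
- by apply: bigcup_open => k _; case: (HvO k).
- split; first by move=> x [k _ Ax]; exists k => //; case: (HvO k) => _ _ [h _] _ _; exact: h.
  by move=> x [k _ Ox]; case: (HvO k) => _ _ [_ h] _ _; exact: h.
- apply: ae_in_bigcup => k; case: (HvO k) => _ _ [_ OO] h _.
  have : ae_in (O k) (fun x => v k x <= u x).
    by move: vu; rewrite /ae_in; apply: filterS => x hx Ox; exact: hx (OO x Ox) k.
  by apply: ae_in2 h => x _; exact: le_trans.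
- apply: le_lt_trans du _; rewrite mulrCA; lra.
Unshelve. all: by end_near. Qed.

Lemma null_bigcup (A : nat -> set E) : (forall k, null (A k)) -> null (\bigcup_k A k).
Proof.
move=> nA e e0; apply: small_bigcup => // k; apply: nA.
by rewrite mulr_gt0 ?divr_gt0// exprn_gt0// invr_gt0.
Qed.

Lemma nullU A B : null A -> null B -> null (A `|` B).
Proof.
move=> nA nB; apply: nullS (@null_bigcup (fun k => if k is 0%N then A else B) _).
  by move=> x [Ax|Bx]; [exists 0%N|exists 1%N].
by case.
Qed.

Lemma small0 e : 0 < e -> small e set0.
Proof.
move=> e0; exists 0, set0; split; [exact: (sub0 sV)|exact: open0|by split=> x|exact: ae_inW|].
by rewrite (lin0 sV (linear_formr dF (sub0 sV))).
Qed.

Lemma smallU A B e : small (e / 4) A -> small (e / 4) B -> small e (A `|` B).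
Proof.
move=> /small_pos[v [ O [hv oO [AO OO] vO [dv v0]]]] /small_pos[w [U [hw oU [BU UO] wU [dw w0]]]].
exists (v + w), (O `|` U); split.
- exact: (subD sV).
- exact: openU.
- by split=> x []; [left; exact: AO|right; exact: BU|exact: OO|exact: UO].
- move: vO wU; rewrite /ae_in; apply: filterS2 => x hO hU [/hO h|/hU h]; rewrite -[(v + w) x]/(v x + w x).
    by rewrite (le_trans h)// lerDl.
  by rewrite (le_trans h)// lerDr.
- apply: le_lt_trans (formD2_le dF hv hw) _; lra.
Qed.

Lemma qe1 (P Q : E -> Prop) : (forall x, Omega x -> P x -> Q x) -> qe P -> qe Q.
Proof. by move=> PQ; apply: nullS => x [Ox nQ]; split=> // Px; apply: nQ; exact: PQ. Qed.

Lemma qe2 (P Q S : E -> Prop) : (forall x, Omega x -> P x -> Q x -> S x) -> qe P -> qe Q -> qe S.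
Proof.
move=> PQS nP nQ; apply: nullS (nullU nP nQ) => x [Ox nS].
have [Px|nPx] := pselect (P x); last by left.
by right; split=> // Qx; apply: nS; exact: PQS.
Qed.

Lemma qe_forall (P : nat -> E -> Prop) : (forall k, qe (P k)) -> qe (fun x => forall k, P k x).
Proof.
move=> h; apply: nullS (null_bigcup h) => x [Ox /existsNP[k nP]].
by exists k.
Qed.

(* Chebyshev's inequality and Poincare's inequality. *)
Lemma null_negligible A : null A -> mu.-negligible A.
Proof.
move=> nA; have [C C0 HC] := poincare dO.
have /choice[vO HvO] k : exists vO : (E -> R) * set E,
    [/\ H10 Omega vO.1, open vO.2, A `<=` vO.2 /\ vO.2 `<=` Omega, ae_in vO.2 (fun x => 1 <= vO.1 x) &
      dirichlet vO.1 vO.1 < k.+1%:R^-1].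
  have k0 : 0 < k.+1%:R^-1 :> R by rewrite invr_gt0.
  by have [v [ O H]] := nA _ k0; exists (v, O).
pose O k := (vO k).2.
have mk k : measurable (O k) by apply: open_measurable_rV; case: (HvO k).
have muO k : (mu (O k) <= (C * k.+1%:R^-1)%:E)%E.
  case: (HvO k) => hv oO [_ OO] vO1 dv; have sv := H1_sq dO (H10_H1 hv).
  apply: (@le_trans _ _ (ip (vO k).1 (vO k).1)%:E); last first.
    by rewrite lee_fin (le_trans (HC _ hv))// ler_wpM2l// ltW.
  rewrite (ipE mO sv sv).
  have mv : measurable_fun (O k) (fun x => ((vO k).1 x * (vO k).1 x)%:E).
    by apply/measurable_EFinP; apply: measurable_funM; apply: measurable_funS sv.1.
  apply: (@le_trans _ _ (\int[mu]_(x in O k) ((vO k).1 x * (vO k).1 x)%:E)%E).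
    rewrite -[leLHS]mul1e -(integral_cst mu (mk k) 1%E).
    apply: ae_ge0_le_integral => //.
    - by move=> x _; rewrite lee_fin -expr2 sqr_ge0.
    - move: vO1; rewrite /ae_in; apply: filterS => x h /h {}h; by rewrite lee_fin -expr2 exprn_ege1.
  apply: ge0_subset_integral => //.
  - by apply/measurable_EFinP; apply: measurable_funM; exact: sv.1.
  - by move=> x _; rewrite lee_fin -expr2 sqr_ge0.
exists (\bigcap_k O k); split.
- exact: bigcapT_measurable.
- apply/eqP; rewrite eq_le measure_ge0 andbT; apply/lee_addgt0Pr => e e0; rewrite add0e.
  have hc : C * harmonic n @[n --> \oo] --> C * 0.
    by apply: cvgM; [exact: cvg_cst|exact: cvg_harmonic].
  rewrite mulr0 in hc; have [N _ HN] := (cvgr_le _ hc) e e0.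
  apply: (le_trans _ (le_trans (muO N) _)); last by rewrite lee_fin; apply: HN => /=.
  by apply: le_measure; rewrite ?inE//; [exact: bigcapT_measurable|exact: bigcap_inf].
- by move=> x Ax k _; case: (HvO k) => _ _ [h _] _ _; exact: h.
Qed.

Lemma qe_ae (P : E -> Prop) : qe P -> ae_in Omega P.
Proof.
move=> /null_negligible h; rewrite /ae_in; apply: negligibleS h => x /= nP.
by split; [apply: contrapT => nO; apply: nP|move=> Px; apply: nP].
Qed.

End capacity.

(** * Quasi-continuous functions and representatives *)

Section quasi_continuity.
Context {R : realType} {m : nat}.
Local Notation E := 'rV[R]_m.+1.
Local Notation mu := (@leb R m).
Context (Omega : set E) (dO : bounded_open Omega).
Implicit Types (u v w phi : E -> R) (A B O G : set E).
Local Notation sq := (sqint mu Omega : set (E -> R)).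
Local Notation ip := (ip mu Omega).
Local Notation dirichlet := (dirichlet Omega).
Local Notation qcont := (quasi_continuous Omega).
Local Notation qe := (qe Omega).
Local Notation small := (small Omega).
Local Notation null := (null Omega).
Let mO := domain_measurable dO.
Let sF := ip_form dO.
Let dF := H10_form dO.
Let sV := H10_subspace dO.

Lemma qcontP w : qcont w <-> forall e, 0 < e -> exists G,
  [/\ open G, G `<=` Omega, small e G & {within Omega `\` G, continuous w}].
Proof.
by split=> h e e0; have [G [oG GO sG cG]] := h e e0; exists G; split=> //; apply/capacity_small.
Qed.

Lemma qcont_comp2 (F : R -> R -> R) w1 w2 :
  (forall a b, F z.1 z.2 @[z --> (a, b)] --> F a b) -> qcont w1 -> qcont w2 ->
  qcont (fun x => F (w1 x) (w2 x)).
Proof.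
move=> cF /qcontP q1 /qcontP q2; apply/qcontP => e e0.
have e4 : 0 < e / 4 by rewrite divr_gt0.
have [G1 [ o1 G1O s1 c1]] := q1 _ e4; have [G2 [ o2 G2O s2 c2]] := q2 _ e4.
exists (G1 `|` G2); split.
- exact: openU.
- by move=> x []; [exact: G1O|exact: G2O].
- exact: smallU.
- have d1 : {within Omega `\` (G1 `|` G2), continuous w1}.
    by apply: continuous_subspaceW c1 => x [Ox nG]; split=> // G1x; apply: nG; left.
  have d2 : {within Omega `\` (G1 `|` G2), continuous w2}.
    by apply: continuous_subspaceW c2 => x [Ox nG]; split=> // G2x; apply: nG; right.
  apply/subspace_continuousP => x Ax; apply: continuous2_cvg; first exact: cF.
  - by move/subspace_continuousP: d1; exact.
  - by move/subspace_continuousP: d2; exact.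
Qed.

Lemma qcont_comp (F : R -> R) w : continuous F -> qcont w -> qcont (fun x => F (w x)).
Proof.
move=> cF qw; apply: (@qcont_comp2 (fun a _ => F a) w w) => // a b.
by apply: (continuous_cvg _ (cF a)); exact: cvg_fst.
Qed.

Lemma qcont_continuous w : continuous w -> qcont w.
Proof.
move=> cw; apply/qcontP => e e0; exists set0; split; [exact: open0|by move=> x []|exact: small0|].
exact: continuous_subspaceT.
Qed.

Lemma qcontZD c w1 w2 : qcont w1 -> qcont w2 -> qcont (c *: w1 + w2).
Proof.
apply: (@qcont_comp2 (fun a b => c * a + b)) => a b.
apply: cvgD; last exact: cvg_snd.
by apply: cvgM; [exact: cvg_cst|exact: cvg_fst].
Qed.

Lemma qcont_posB c w : qcont w -> qcont (posB c w).
Proof.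
move=> qw; apply: (@qcont_comp (fun a => Num.max (a - c) 0)) => // a.
apply/cvgrPdist_lt => e e0; near=> y.
apply: le_lt_trans (posB_lip c a y) _; near: y; exact: cvgr_dist_lt.
Unshelve. all: by end_near. Qed.

(** Preimages under [w] are open only relative to the complement of [G]; joining [G] makes them
    open. This supplies the open neighbourhoods in the definition of capacity. *)
Lemma open_level w G (U : set R) : open G -> open U ->
  {within Omega `\` G, continuous w} -> open (G `|` [set x | Omega x /\ U (w x)]).
Proof.
move=> oG oU /subspace_continuousP cw; rewrite openE => x [Gx|[Ox Ux]].
  by apply: filterS (_ : nbhs x G); [move=> y; left|exact: open_nbhs_nbhs].
have [Gx|nGx] := pselect (G x).
  by apply: filterS (_ : nbhs x G); [move=> y; left|exact: open_nbhs_nbhs].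
have : \forall y \near within (Omega `\` G) (nbhs x), U (w y).
  by apply: (cw x (conj Ox nGx)); exact: open_nbhs_nbhs.
rewrite near_withinE => h; have hO : nbhs x Omega by apply: open_nbhs_nbhs; split=> //; exact: dO.1.
rewrite /interior; near=> y.
have Oy : Omega y by near: y.
have [Gy|nGy] := pselect (G y); [by left|right; split=> //].
have : (Omega `\` G) y by split.
by near: y.
Unshelve. all: by end_near. Qed.

(** The set where [w < 0] is negligible, so a potential of [G] is still at least [1] a.e. on the
    open set obtained by joining it to [G]. It thus has capacity below every [e], like [G]
    itself. *)
Lemma qc_nonneg w : qcont w -> ae_in Omega (fun x => 0 <= w x) -> qe (fun x => 0 <= w x).
Proof.
move=> /qcontP qw w0 e e0; have [G [oG GO [v [ O [hv oO [GsO OO] vO dv]]] cw]] := qw e e0.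
exists v, (G `|` [set x | Omega x /\ (w x < 0)]); split.
- exact: hv.
- exact: (@open_level w G [set t | t < 0] oG (@open_lt _ 0) cw).
- by split=> x [] //; [move=> Ox h; right; split=> //; rewrite ltNge; apply/negP|exact: GO|case].
- move: vO w0; rewrite /ae_in; apply: filterS2 => x hv1 hw [Gx|[Ox]]; first exact/hv1/GsO.
  by rewrite ltNge hw.
- exact: dv.
Qed.

Lemma qc_le w1 w2 : qcont w1 -> qcont w2 -> ae_in Omega (fun x => w1 x <= w2 x) ->
  qe (fun x => w1 x <= w2 x).
Proof.
move=> q1 q2 h; have := qc_nonneg (qcontZD (-1) q1 q2).
have EE x : (-1 *: w1 + w2) x = w2 x - w1 x.
  by rewrite -[LHS]/(-1 * w1 x + w2 x) mulN1r addrC.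
move=> /(_ _) H; apply: (qe1 _ (H _)) => [x _|]; first by rewrite EE subr_ge0.
by apply: ae_in1 h => x _; rewrite EE subr_ge0.
Qed.

Lemma qc_eq w1 w2 : qcont w1 -> qcont w2 -> ae_in Omega (fun x => w1 x = w2 x) ->
  qe (fun x => w1 x = w2 x).
Proof.
move=> q1 q2 h; apply: (qe2 dO _ (qc_le q1 q2 _) (qc_le q2 q1 _)).
- by move=> x _ h1 h2; apply/eqP; rewrite eq_le h1.
- by apply: ae_in1 h => x _ ->.
- by apply: ae_in1 h => x _ ->.
Qed.

(** Chebyshev's inequality for the capacity: [|v| / r] is a potential of the level set, and [p] pays
    for the open set off which [w] is continuous. The constant is [8 = 2 * 4], from [formD2_le] and
    [dirichlet_absf]; half of the remaining slack is left to [p]. *)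
Lemma level_small w v (e r : R) : H10 Omega v -> qcont w -> ae_in Omega (fun x => w x = v x) ->
  0 < r -> 8 * dirichlet v v < e * r ^+ 2 -> small e [set x | Omega x /\ r < `|w x|].
Proof.
move=> hv /qcontP qw wv r0 hr; have r20 : 0 < r ^+ 2 by exact: exprn_gt0.
pose s := (e - 8 * dirichlet v v / r ^+ 2) / 2.
have s0 : 0 < s by rewrite divr_gt0// subr_gt0 ltr_pdivrMr.
have [G [oG GO /small_pos-/(_ dO)[p [ O [hp oO [GsO OO] pO [dp p0]]]] cw]] := qw s s0.
have hz : H10 Omega (r^-1 *: absf v) by apply: (subZ sV); exact: H10_absf.
exists (r^-1 *: absf v + p), (G `|` [set x | Omega x /\ [set t | r < `|t|] (w x)]); split.
- exact: (subD sV hz hp).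
- apply: open_level oG _ cw; apply: (@open_comp _ _ (fun t : R => `|t|) [set t | r < t]); last exact: open_gt.
  by move=> x _; exact: norm_continuous.
- by split=> x; [by right|case; [exact: GO|case]].
- move: pO wv; rewrite /ae_in; apply: filterS2 => x hp1 hw; rewrite -[(_ + p) x]/(r^-1 * `|v x| + p x).
  move=> [Gx|[Ox /= rw]].
    by rewrite (le_trans (hp1 (GsO _ Gx)))// lerDr mulr_ge0 ?invr_ge0 ?(ltW r0).
  by rewrite (le_trans _ (_ : r^-1 * `|v x| <= _)) ?lerDl// mulrC ler_pdivlMr// mul1r -hw// ltW.
- apply: le_lt_trans (formD2_le dF hz hp) _; rewrite (formZ2 dF _ (H10_absf dO hv)).
  have h1 := dirichlet_absf dO hv.
  have h2 : r^-1 ^+ 2 * dirichlet (absf v) (absf v) <= 4 * dirichlet v v / r ^+ 2.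
    by rewrite exprVn mulrC ler_wpM2r// invr_ge0 ltW.
  have h3 : 4 * dirichlet v v / r ^+ 2 *+ 2 = 8 * dirichlet v v / r ^+ 2.
    by rewrite mulr2n; field; rewrite gt_eqF.
  move: h2 h3 dp; rewrite /s; move: (r^-1 ^+ 2 * _) (4 * _ / _) (8 * _ / _) (dirichlet p p).
  by clear => a b c d *; lra.
Qed.

Lemma geometric_lim (a : nat -> R) N : (forall n, (N <= n)%N -> `|a n.+1 - a n| <= 2^-1 ^+ n) ->
  cvgn a /\ forall n, (N <= n)%N -> `|limn a - a n| <= 2 * 2^-1 ^+ n.
Proof.
move=> h.
have p n : 0 < 2^-1 ^+ n :> R by rewrite exprn_gt0// invr_gt0.
have H n j : (N <= n)%N -> `|a (n + j)%N - a n| <= 2 * 2^-1 ^+ n * (1 - 2^-1 ^+ j).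
  move=> Nn; elim: j => [|j IH]; first by rewrite addn0 subrr normr0 expr0 subrr mulr0.
  have -> : a (n + j.+1)%N - a n = (a (n + j.+1)%N - a (n + j)%N) + (a (n + j)%N - a n).
    by rewrite addrA subrK.
  apply: le_trans (ler_normD _ _) _; rewrite addnS.
  apply: le_trans (lerD (h _ (leq_trans Nn (leq_addr _ _))) IH) _.
  rewrite exprD exprS; move: (2^-1 ^+ n) (2^-1 ^+ j) => x y.
  by rewrite le_eqVlt; apply/orP; left; apply/eqP; field.
have H2 n k : (N <= n)%N -> (n <= k)%N -> `|a k - a n| <= 2 * 2^-1 ^+ n.
  move=> Nn nk; have := H n (k - n)%N Nn; rewrite subnKC// => /le_trans; apply.
  by apply: ler_piMr; [rewrite mulr_ge0 ?(ltW (p _))|rewrite gerBl ltW].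
have z : 2 * 2^-1 ^+ n @[n --> \oo] --> (0 : R).
  rewrite -[X in _ --> X](mulr0 2); apply: cvgM; first exact: cvg_cst.
  by apply: cvg_expr; rewrite ger0_norm ?invr_ge0// invf_lt1// ltr1n.
have ca : cvgn a.
  apply: cauchy_cvg; apply: cauchy_exP => e e0.
  have [M _ HM] := (cvgr_lt _ z) e e0; exists (a (maxn M N)).
  exists (maxn M N) => // k /= hk; rewrite -ball_normE /= distrC.
  apply: le_lt_trans (H2 _ _ (leq_maxr _ _) hk) _.
  by apply: HM => /=; exact: leq_maxl.
split=> // n Nn.
have c1 : `|a k - a n| @[k --> \oo] --> `|limn a - a n|.
  by apply: cvg_norm; apply: cvgB; [exact: ca|exact: cvg_cst].
have c2 : (fun=> 2 * 2^-1 ^+ n) k @[k --> \oo] --> (2 * 2^-1 ^+ n : R) by exact: cvg_cst.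
apply: (ler_cvg_to c1 c2).
by exists n => // k /= nk; exact: H2.
Qed.

Lemma uniform_limit_continuous (A : set E) (phi : nat -> E -> R) w :
  (forall n, continuous (phi n)) ->
  (forall e, 0 < e -> exists n, forall x, A x -> `|w x - phi n x| < e) ->
  {within A, continuous w}.
Proof.
move=> cphi unif; apply/subspace_continuousP => x Ax; apply/cvgrPdist_lt => e e0.
have e3 : 0 < e / 3 by rewrite divr_gt0.
have [n Hn] := unif _ e3; rewrite near_withinE.
have h : \forall t \near x, `|phi n x - phi n t| < e / 3 by exact: (cvgrPdist_lt _ _).1 (cphi n x) _ e3.
near=> y => Ay.
have hy : `|phi n x - phi n y| < e / 3 by near: y.
have h1 := Hn x Ax; have h2 := Hn y Ay; rewrite distrC in h2.
have -> : w x - w y = (w x - phi n x) + (phi n x - phi n y) + (phi n y - w y).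
  by rewrite !subrKA.
apply: le_lt_trans (ler_normD _ _) _; apply: le_lt_trans (lerD (ler_normD _ _) (lexx _)) _.
lra.
Unshelve. all: by end_near. Qed.

(** Test functions converge to [v] so fast that the sets [G n], where successive ones differ by more
    than [2^-1 ^+ n], have small unions. Off the union [U N] the convergence is uniform. *)
Lemma qcont_exists v : H10 Omega v -> exists w, qcont w /\ ae_in Omega (fun x => w x = v x).
Proof.
move=> hv; have [hv1 [phi0 tp0 cv0]] := iffLR (H10P dO v) hv.
have cd0 := sobolev_cvg_dirichlet dO (fun n => test_H1 dO (tp0 n)) hv1 cv0.
(* Of the three factors [4^-1 ^+ n], one is lost to the squared level in [level_small], one serves
   as weight in [small_bigcup], and the last makes [U N] small. The constant [512] below is
   [8 * 4 * 16]. *)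
have c0 n : 0 < 4^-1 ^+ (3 * n) :> R by rewrite exprn_gt0// invr_gt0.
have /choice[s Hs] n : exists k, (n <= k)%N /\ dirichlet (phi0 k - v) (phi0 k - v) < 4^-1 ^+ (3 * n).
  by have [N HN] := cd0 _ (c0 n); exists (maxn n N); split; [exact: leq_maxl|apply: HN; exact: leq_maxr].
pose phi n := phi0 (s n); have tp n : test_function Omega (phi n) := tp0 (s n).
have hp n : H10 Omega (phi n) := test_H10 dO (tp n).
have cphi n : continuous (phi n) := smooth_continuous (test_smooth (tp n)).
have dphi n : dirichlet (phi n.+1 - phi n) (phi n.+1 - phi n) <= 4 * 4^-1 ^+ (3 * n).
  have -> : phi n.+1 - phi n = (phi n.+1 - v) - (phi n - v) by rewrite opprB addrA subrK.
  have h1 := subB sV (hp n.+1) hv; have h2 := subB sV (hp n) hv.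
  have := formD2_le dF h1 (subN sV h2); rewrite (formN2 dF h2) => /le_trans; apply.
  have h3 := (Hs n.+1).2; have h4 := (Hs n).2.
  have h5 : 4^-1 ^+ (3 * n.+1) <= 4^-1 ^+ (3 * n) :> R.
    by apply: ler_wiXn2l; rewrite ?invr_ge0// ?invf_le1// ?ler1n// leq_mul2l leqnSn orbT.
  rewrite -/(phi n.+1) -/(phi n) in h3 h4; move: h3 h4 h5.
  move: (dirichlet _ _) (dirichlet _ _) (4^-1 ^+ _) (4^-1 ^+ _).
  by clear => a b c d *; lra.
pose G n := [set x | Omega x /\ 2^-1 ^+ n < `|phi n.+1 x - phi n x|].
have oG n : open (G n).
  have cn : continuous (fun x => `|phi n.+1 x - phi n x|).
    have cB : continuous (phi n.+1 - phi n) by move=> x; apply: continuousB; exact: cphi.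
    by move=> x; exact: (cvg_norm (cB x)).
  apply: openI; first exact: dO.1.
  apply: (@open_comp _ _ (fun x => `|phi n.+1 x - phi n x|) [set t | 2^-1 ^+ n < t]); last exact: open_gt.
  by move=> x _; exact: cn.
pose U N := \bigcup_n G (N + n)%N.
have sU e : 0 < e -> exists N, small e (U N).
  move=> e0; have z : 512 * 4^-1 ^+ n @[n --> \oo] --> (0 : R).
    rewrite -[X in _ --> X](mulr0 512); apply: cvgM; first exact: cvg_cst.
    by apply: cvg_expr; rewrite ger0_norm ?invr_ge0// invf_lt1// ltr1n.
  have [N _ HN] := (cvgr_lt _ z) e e0; exists N; apply: (small_bigcup dO e0) => k.
  apply: (@level_small (phi (N + k)%N.+1 - phi (N + k)%N) (phi (N + k)%N.+1 - phi (N + k)%N)).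
  - exact: (subB sV (hp _) (hp _)).
  - by apply: qcont_continuous => x; apply: continuousB; exact: cphi.
  - exact: ae_inW.
  - by rewrite exprn_gt0// invr_gt0.
  - apply: le_lt_trans (_ : 8 * (4 * 4^-1 ^+ (3 * (N + k))) < _).
      by rewrite ler_pM2l.
    have := HN (N + k)%N (leq_addr _ _).
    have hk : 4^-1 ^+ (N + k) <= 4^-1 ^+ k :> R.
      by apply: ler_wiXn2l; rewrite ?invr_ge0// ?invf_le1// ?ler1n// leq_addl.
    move: hk; set n := (N + k)%N => hk hn.
    have p4 : 0 < 4^-1 ^+ n :> R by rewrite exprn_gt0// invr_gt0.
    have -> : (2^-1 ^+ n) ^+ 2 = 4^-1 ^+ n :> R.
      by rewrite -exprM mulnC exprM expr2 -invfM -natrM.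
    have -> : (3 * n = n + n + n)%N by rewrite !mulSn addn0 addnA.
    rewrite (exprD _ (n + n)%N) (exprD _ n); move: hk hn p4; move: (4^-1 ^+ n) (4^-1 ^+ k) => x y xy hx x0.
    have e16 : 0 < e / 16 by rewrite divr_gt0.
    have h1 : 32 * x < e / 16 by lra.
    have -> : 8 * (4 * (x * x * x)) = 32 * x * x * x by ring.
    rewrite ltr_pM2r//; apply: lt_le_trans (_ : e / 16 * x <= _); first by rewrite ltr_pM2r.
    by rewrite ler_pM2l.
pose w x := limn (fun n => phi n x).
have lim x N : Omega x -> ~ U N x -> cvgn (fun n => phi n x) /\
    forall n, (N <= n)%N -> `|w x - phi n x| <= 2 * 2^-1 ^+ n.
  move=> Ox nU; apply: geometric_lim => n Nn; rewrite leNgt; apply/negP => h.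
  by apply: nU; exists (n - N)%N => //; rewrite /G /= subnKC.
exists w; split.
- apply/qcontP => e e0; have [N sN] := sU e e0; exists (U N); split=> //.
  + by apply: bigcup_open => n _.
  + by move=> x [n _ []].
  + apply: (uniform_limit_continuous cphi) => r r0.
    have z : 2 * 2^-1 ^+ n @[n --> \oo] --> (0 : R).
      rewrite -[X in _ --> X](mulr0 2); apply: cvgM; first exact: cvg_cst.
      by apply: cvg_expr; rewrite ger0_norm ?invr_ge0// invf_lt1// ltr1n.
    have [M _ HM] := (cvgr_lt _ z) r r0; exists (maxn M N) => x [Ox nUx].
    apply: le_lt_trans ((lim x N Ox nUx).2 _ (leq_maxr _ _)) _.
    by apply: HM => /=; exact: leq_maxl.
- have q1 : qe (fun x => exists N, ~ U N x).
    move=> e e0; have [N sN] := sU e e0; apply: smallS sN => x [Ox nx].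
    by apply: contrapT => nU; apply: nx; exists N.
  have cphi' : form_cvg ip phi v.
    have c1 := sobolev_cvg_ip dO (fun n => test_H1 dO (tp0 n)) hv1 cv0.
    move=> e e0; have [N HN] := c1 e e0; exists N => n Nn; apply: HN.
    exact: leq_trans Nn (Hs n).1.
  have [s' sn aes] := form_cvg_ae_subseq mO (fun n => H1_sq dO (H10_H1 (hp n))) (H1_sq dO hv1) cphi'.
  apply: ae_in2 (qe_ae dO q1) aes => x Ox [N nU] cs.
  have [cx _] := lim x N Ox nU.
  have cs2 : phi (s' n) x @[n --> \oo] --> w x.
    apply: (cvg_comp s' (fun n => phi n x) _ cx).
    by move=> B [M _ HM]; exists M => // n /= Mn; apply: HM; exact: leq_trans Mn (sn n).
  by apply: (cvg_unique _ cs2 cs).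
Qed.

End quasi_continuity.

(** * Quasi-support *)

Section riesz.
Context {R : realType} {X : lmodType R} {V : set X} {a : X -> X -> R}.
Context (sa : semi_inner V a).
Let sV := si_sub sa.

(** On a subspace the competitors [u + v] and [u - v] turn the variational inequality into an
    equation. With [F = a v] the result is the orthogonal projection of [v] onto [K]. *)
Lemma riesz_subspace (K : set X) (F : X -> R) (M : R) : K `<=` V -> subspace K ->
  form_closed V a K -> linear_on V F -> (forall v, V v -> F v ^+ 2 <= M * a v v) ->
  form_complete V a -> exists2 u, K u & forall v, K v -> a u v = F v.
Proof.
move=> KV sK cK lF FM cV.
have Kcvx : convex_on K by move=> s u v _ _; exact: (sub_conv sK).
have [|u Ku Hu] := variational_inequality sa KV _ Kcvx lF FM cV cK; first by exists 0; exact: (sub0 sK).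
exists u => // v Kv; have Vu := KV _ Ku; have Vv := KV _ Kv.
have h1 := Hu _ (subD sK Ku Kv); have h2 := Hu _ (subB sK Ku Kv).
have e1 : u + v - u = v by rewrite addrAC subrr add0r.
have e2 : u - v - u = - v by rewrite addrAC subrr add0r.
rewrite e1 in h1; rewrite e2 (linN sV lF Vv) (linN sV (linear_formr sa Vu) Vv) lerN2 in h2.
by apply/eqP; rewrite eq_le h1 h2.
Qed.

End riesz.

Section quasi_support.
Context {R : realType} {m : nat}.
Local Notation E := 'rV[R]_m.+1.
Local Notation mu := (@leb R m).
Context (Omega : set E) (dO : bounded_open Omega).
Implicit Types (u v w phi : E -> R) (A B O G : set E).
Local Notation sq := (sqint mu Omega : set (E -> R)).
Local Notation ip := (ip mu Omega).
Local Notation dirichlet := (dirichlet Omega).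
Local Notation qcont := (quasi_continuous Omega).
Local Notation qe := (qe Omega).
Local Notation small := (small Omega).
Local Notation null := (null Omega).
Local Notation rep := (qc_rep Omega).
Let mO := domain_measurable dO.
Let sF := ip_form dO.
Let ss : subspace sq := si_sub sF.
Let dF := H10_form dO.
Let sV := H10_subspace dO.

Lemma qc_repP v : H10 Omega v -> qcont (rep v) /\ ae_in Omega (fun x => rep v x = v x).
Proof.
move=> hv; have [w Hw] := qcont_exists dO hv.
by have := @xgetPex _ v [set w | qcont w /\ ae_in Omega (fun x => w x = v x)] (ex_intro _ w Hw).
Qed.

Lemma qc_repE v w : H10 Omega v -> qcont w -> ae_in Omega (fun x => v x = w x) ->
  qe (fun x => rep v x = w x).
Proof.
move=> hv qw vw; have [qr rv] := qc_repP hv; apply: (qc_eq dO qr qw).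
by apply: ae_in2 rv vw => x _ -> ->.
Qed.

Lemma rep_test phi : test_function Omega phi -> qe (fun x => rep phi x = phi x).
Proof.
move=> tp; apply: (qc_repE (test_H10 dO tp)); last exact: ae_inW.
by apply: (qcont_continuous dO); exact: smooth_continuous (test_smooth tp).
Qed.

Lemma repZD c u v : H10 Omega u -> H10 Omega v ->
  qe (fun x => rep (c *: u + v) x = c * rep u x + rep v x).
Proof.
move=> hu hv; have [qu ru] := qc_repP hu; have [qv rv] := qc_repP hv.
have hh : H10 Omega (c *: u + v) by exact: (subD sV (subZ sV c hu) hv).
apply: (qc_repE (w := c *: rep u + rep v) hh); first exact: (qcontZD dO).
apply: ae_in2 ru rv => x _ h1 h2.
by rewrite -[LHS]/(c * u x + v x) -[RHS]/(c * rep u x + rep v x) h1 h2.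
Qed.

Lemma rep_posB c u : 0 <= c -> H10 Omega u ->
  qe (fun x => rep (posB c u) x = Num.max (rep u x - c) 0).
Proof.
move=> c0 hu; have [qu ru] := qc_repP hu.
apply: (qc_repE (w := posB c (rep u)) (H10_posB dO c0 hu)); first exact: (qcont_posB dO).
by apply: ae_in1 ru => x _ h; rewrite /posB h.
Qed.

Lemma rep_le u v : H10 Omega u -> H10 Omega v -> ae_in Omega (fun x => u x <= v x) ->
  qe (fun x => rep u x <= rep v x).
Proof.
move=> hu hv uv; have [qu ru] := qc_repP hu; have [qv rv] := qc_repP hv.
by apply: (qc_le dO qu qv); apply: ae_in3 ru rv uv => x _ -> ->.
Qed.

Lemma rep_eq u v : H10 Omega u -> H10 Omega v -> ae_in Omega (fun x => u x = v x) ->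
  qe (fun x => rep u x = rep v x).
Proof.
move=> hu hv uv; apply: (qe2 dO _ (rep_le hu hv _) (rep_le hv hu _)).
- by move=> x _ h1 h2; apply/eqP; rewrite eq_le h1.
- by apply: ae_in1 uv => x _ ->.
- by apply: ae_in1 uv => x _ ->.
Qed.

Lemma rep_level v (e r : R) : H10 Omega v -> 0 < r -> 8 * dirichlet v v < e * r ^+ 2 ->
  small e [set x | Omega x /\ r < `|rep v x|].
Proof. by move=> hv; have [qv rv] := qc_repP hv; exact: (level_small dO hv qv rv). Qed.

Lemma exp_half_lt (r : R) : 0 < r -> exists k, 2^-1 ^+ k < r.
Proof.
move=> r0; have z : 2^-1 ^+ n @[n --> \oo] --> (0 : R).
  by apply: cvg_expr; rewrite ger0_norm ?invr_ge0// invf_lt1// ltr1n.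
by have [N _ HN] := (cvgr_lt _ z) r r0; exists N; apply: HN => /=.
Qed.

(** At a point of [P] with [rep v x > 2^-1 ^+ k] and [rep (w (s k)) x <= 0], the two functions
    differ by more than [2^-1 ^+ k]. The exceptional set is covered by such level sets and a null
    set. *)
Lemma qe_le_closed (P : set E) (w : nat -> E -> R) v : (forall n, H10 Omega (w n)) -> H10 Omega v ->
  form_cvg dirichlet w v -> (forall n, qe (fun x => P x -> rep (w n) x <= 0)) ->
  qe (fun x => P x -> rep v x <= 0).
Proof.
move=> hw hv cw Hw e e0.
(* [e / 4 / 16 * 4^-1 ^+ k] is the share of the [k]-th set in [small_bigcup]; the remaining factor
   [4^-1 ^+ k / 8] is required by [rep_level] at the level [2^-1 ^+ k]. *)
have c0 k : 0 < e / 4 / 16 * 4^-1 ^+ k * 4^-1 ^+ k / 8.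
  by rewrite divr_gt0// !mulr_gt0 ?divr_gt0 ?exprn_gt0 ?invr_gt0.
have /choice[s Hs] k : exists n, dirichlet (w n - v) (w n - v) < e / 4 / 16 * 4^-1 ^+ k * 4^-1 ^+ k / 8.
  by have [N HN] := cw _ (c0 k); exists N; exact: HN.
have hd n : H10 Omega (w n - v) by exact: (subB sV (hw n) hv).
have q1 := qe2 dO (S := fun x => forall n, (P x -> rep (w n) x <= 0) /\
   rep (-1 *: v + w n) x = -1 * rep v x + rep (w n) x)
   (fun x _ h1 h2 n => conj (h1 n) (h2 n)) (qe_forall dO Hw) (qe_forall dO (fun n => repZD (-1) hv (hw n))).
apply: (smallS _ (smallU dO (q1 (e / 4) _) (small_bigcup dO (A := fun k =>
  [set x | Omega x /\ 2^-1 ^+ k < `|rep (-1 *: v + w (s k)) x|]) _ _))) => /=.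
- move=> x [Ox nx]; have [nq|] := pselect (~ forall n, (P x -> rep (w n) x <= 0) /\
   rep (-1 *: v + w n) x = -1 * rep v x + rep (w n) x); first by left.
  move=> /contrapT q; right.
  have [Px /negP] := (not_implyP _ _).1 nx; rewrite -ltNge => v0.
  have [k hk] := exp_half_lt v0; exists k => //; split=> //.
  apply: lt_le_trans hk _; rewrite (q _).2 mulN1r addrC.
  have h := (q (s k)).1 Px; rewrite distrC ger0_norm; first by rewrite lerBrDr gerDl.
  by rewrite subr_ge0 (le_trans h)// ltW.
- by rewrite divr_gt0.
- by rewrite divr_gt0.
- move=> k; have -> : -1 *: v + w (s k) = w (s k) - v by rewrite scaleN1r addrC.
  apply: (rep_level (hd _)); first by rewrite exprn_gt0// invr_gt0.
  have := Hs k; rewrite ltr_pdivlMr// mulrC.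
  by rewrite -[(2^-1 ^+ k) ^+ 2]exprM [(k * 2)%N]mulnC exprM expr2 -invfM -natrM.
Qed.

Lemma small_le e e' A : e <= e' -> small e A -> small e' A.
Proof.
move=> ee [v [ O [hv oO AO vO dv]]]; exists v, O; split; [exact: hv|exact: oO|exact: AO|exact: vO|].
exact: lt_le_trans dv ee.
Qed.

Lemma null_seq A : (forall k, small k.+1%:R^-1 A) -> null A.
Proof.
move=> h e e0; have [N _ HN] := (cvgr_lt _ (@cvg_harmonic R)) e e0.
by apply: small_le (h N); apply/ltW; apply: (HN N) => /=.
Qed.

(** A quasi-open set differs from a countable intersection of open sets by a set of capacity zero,
    which is measurable since the Lebesgue measure is complete. *)
Lemma quasi_open_measurable O : quasi_open Omega O -> measurable O.
Proof.
move=> [OO qO].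
have /choice[G HG] k : exists G, [/\ open G, G `<=` Omega, small k.+1%:R^-1 G & open (O `|` G)].
  have k0 : 0 < k.+1%:R^-1 :> R by rewrite invr_gt0.
  by have [G [oG GO sG oOG]] := qO _ k0; exists G; split=> //; apply/(capacity_small Omega).
pose M := \bigcap_k (O `|` G k).
have mM : measurable M.
  by apply: bigcapT_measurable => k; apply: open_measurable_rV; case: (HG k).
have nN : null (M `\` O).
  apply: null_seq => k; case: (HG k) => _ _ sG _; apply: smallS sG => x [Mx nO].
  by case: (Mx k I).
have mN : measurable (M `\` O).
  exact: measure_is_complete_caratheodory (null_negligible dO nN).
have -> : O = M `\` (M `\` O).
  rewrite setDD; apply/seteqP; split=> x; last by case.
  by move=> Ox; split=> // k _; left.
exact: measurableD.
Qed.

Lemma dirichlet_posB_eq c u : 0 <= c -> H10 Omega u ->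
  dirichlet u (posB c u) = dirichlet (posB c u) (posB c u).
Proof.
move=> c0 hu; have hp := H10_posB dO c0 hu.
have := energy_posB dO (bounded_coef_cst Omega 1%:M) c0 hu.
by rewrite (energy1 dO (H10_H1 hu) (H10_H1 hp)) (energy1 dO (H10_H1 hp) (H10_H1 hp)).
Qed.

Lemma ip_ge0 (a b : E -> R) : measurable_fun Omega a -> measurable_fun Omega b ->
  ae_in Omega (fun x => 0 <= a x * b x) -> 0 <= ip a b.
Proof.
move=> ma mb ab; have mab : measurable_fun Omega (fun x => a x * b x) by exact: measurable_funM.
rewrite ip_def (@ae_eq_Rintegral _ _ _ mu _ mO _ (fun x => Num.max (a x * b x) 0)).
- by apply: Rintegral_ge0 => x _; rewrite le_max lexx orbT.
- exact: mab.
- by apply: measurable_maxr; [exact: mab|exact: measurable_cst].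
- by apply: ae_in1 ab => x _ h; rewrite max_l.
Qed.

Lemma ip_bounded f : sq f -> exists M : R, 0 <= M /\
  forall v, H10 Omega v -> ip f v ^+ 2 <= M * dirichlet v v.
Proof.
move=> sf; have [C C0 HC] := poincare dO; exists (ip f f * C).
have f0 := si_pos sF sf; split; first by rewrite mulr_ge0// ltW.
move=> v hv; apply: le_trans (form_CS sF sf (H1_sq dO (H10_H1 hv))) _.
by rewrite -mulrA ler_wpM2l//; exact: HC.
Qed.

Lemma ip_linear f : sq f -> linear_on (H10 Omega) (ip f).
Proof.
move=> sf c u v /H10_H1/(H1_sq dO) su /H10_H1/(H1_sq dO) sv.
exact: (linear_formr sF sf c su sv).
Qed.

Lemma dirichlet_cvg_ae (w : nat -> E -> R) v : (forall n, H10 Omega (w n)) -> H10 Omega v ->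
  form_cvg dirichlet w v -> exists2 s : nat -> nat, (forall n, (n <= s n)%N) &
    ae_in Omega (fun x => w (s n) x @[n --> \oo] --> v x).
Proof.
move=> hw hv cw; apply: (form_cvg_ae_subseq mO (fun n => H1_sq dO (H10_H1 (hw n))) (H1_sq dO (H10_H1 hv))).
exact: (sobolev_cvg_ip dO (fun n => H10_H1 (hw n)) (H10_H1 hv) (dirichlet_cvg_sobolev dO hw hv cw)).
Qed.

Section density.
Context (lam : E -> R) (slam : sq lam) (lam0 : ae_in Omega (fun x => 0 <= lam x)).

Definition orth : set (E -> R) :=
  [set v | H10 Omega v /\ ae_in Omega (fun x => lam x * v x = 0)].

Lemma orth_subspace : subspace orth.
Proof.
split; first by split; [exact: (sub0 sV)|apply: ae_inW => x _; exact: mulr0].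
move=> c u v [hu lu] [hv lv]; split; first exact: (subD sV (subZ sV c hu) hv).
apply: ae_in2 lu lv => x _ h1 h2.
by rewrite -[(_ + v) x]/(c * u x + v x) mulrDr mulrCA h1 h2 mulr0 addr0.
Qed.

Lemma orth_H10 : orth `<=` H10 Omega. Proof. by move=> v []. Qed.

Lemma orth_posB u : orth u -> orth (posB 0 u).
Proof.
move=> [hu lu]; split; first exact: (H10_posB dO (lexx 0) hu).
apply: ae_in1 lu => x _ h; rewrite /posB subr0.
by case: (leP (u x) 0) => _ //; rewrite mulr0.
Qed.

Lemma orth_closed : form_closed (H10 Omega) dirichlet orth.
Proof.
move=> w v ow hv cw; split=> //.
have [s sn cs] := dirichlet_cvg_ae (fun n => (ow n).1) hv cw.
have h : ae_in Omega (fun x => forall n, lam x * w n x = 0).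
  by apply: ae_in_forall => n; exact: (ow n).2.
apply: ae_in2 h cs => x _ hx cx.
have c1 : lam x * w (s n) x @[n --> \oo] --> lam x * v x by apply: cvgM => //; exact: cvg_cst.
have E0 : (fun n => lam x * w (s n) x) = fun=> 0 by apply/funext.
have c2 : (fun _ : nat => 0 : R) n @[n --> \oo] --> (0 : R) by exact: cvg_cst.
by rewrite E0 in c1; apply: (cvg_unique _ c1 c2).
Qed.

Lemma torsion f : sq f -> exists2 w, orth w & forall v, orth v -> dirichlet w v = ip f v.
Proof.
move=> sf; have [M [_ HM]] := ip_bounded sf.
exact: (riesz_subspace dF orth_H10 orth_subspace orth_closed (ip_linear sf) HM
  (H10_dirichlet_complete dO)).
Qed.

(** Comparison principle: [posB 0 (w - w1)] may be used as a test function because [orth] is stable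
    under positive parts. *)
Lemma torsion_le f w w1 : sq f -> ae_in Omega (fun x => f x <= 1) -> orth w -> orth w1 ->
  (forall v, orth v -> dirichlet w v = ip f v) ->
  (forall v, orth v -> dirichlet w1 v = ip (cst 1) v) -> ae_in Omega (fun x => w x <= w1 x).
Proof.
move=> sf f1 ow ow1 Hw Hw1; have od := subB orth_subspace ow ow1; have oy := orth_posB od.
have [hw hw1 hy] := And3 ow.1 ow1.1 oy.1; have sy := H1_sq dO (H10_H1 hy).
have s1 : sq (cst 1) := sq_cst dO 1.
have h0 : dirichlet (posB 0 (w - w1)) (posB 0 (w - w1)) <= 0.
  rewrite -(dirichlet_posB_eq (lexx 0) od.1) (linB sV (linear_forml dF hy) hw hw1).
  rewrite (Hw _ oy) (Hw1 _ oy) -(linB ss (linear_forml sF sy) sf s1) -oppr_ge0.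
  rewrite -(linN ss (linear_forml sF sy) (subB ss sf s1)) opprB.
  apply: ip_ge0 => //; [exact: (subB ss s1 sf).1|exact: sy.1|].
  apply: ae_in1 f1 => x _ h; rewrite -[(_ - f) x]/(1 - f x).
  by rewrite mulr_ge0 ?posB_ge0// subr_ge0.
have := H10_ae_unique dO hy (sub0 sV); rewrite subr0 => /(_ h0).
apply: ae_in1 => x _; rewrite /posB subr0 -[(w - w1) x]/(w x - w1 x) => /eqP.
by rewrite eq_maxr ?eqxx ?orbT// => /idP; case: leP => //; rewrite subr_le0.
Qed.

(* The quasi-support is the zero set of the torsion function [w1] of [orth], the
   solution of [- Delta w1 = 1] in [orth]: the solutions with bounded right-hand
   sides are dense in [orth] and dominated by multiples of [w1].  For minimality,
   a quasi-open set on which [lam] vanishes is exhausted by the sets where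
   [chi - p > 0], [chi] a cut-off of an open superset and [p] the potential of the
   small difference. *)
Lemma q_supp_construction : exists A, is_q_supp Omega lam A /\
  forall v, orth v -> qe (fun x => A x -> rep v x = 0).
Proof.
have s1 : sq (cst 1) := sq_cst dO 1.
have [w1 ow1 Hw1] := torsion s1; have hw1 := ow1.1.
have [qw1 rw1] := qc_repP hw1.
pose A := [set x | Omega x /\ rep w1 x = 0].
have vanish v : orth v -> qe (fun x => A x -> rep v x = 0).
  (* [Z] is a closed subspace of [orth]. It is shown that [v] agrees a.e. with its projection [z]
     onto [Z]. *)
  move=> ov; pose Z := [set z | orth z /\ qe (fun x => A x -> rep z x = 0)].
  have ZV : Z `<=` H10 Omega by move=> z [[]].
  have sZ : subspace Z.
    split.
      split; first exact: (sub0 orth_subspace).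
      apply: qe1 (rep_test (test0 Omega)) => x _ h _; exact: h.
    move=> c z z' [oz qz] [oz' qz']; split; first exact: (subD orth_subspace (subZ orth_subspace c oz) oz').
    apply: (qe2 dO _ (repZD c oz.1 oz'.1) (qe2 dO (fun x _ h1 h2 => conj h1 h2) qz qz')).
    by move=> x _ -> [h1 h2] Ax; rewrite (h1 Ax) (h2 Ax) mulr0 addr0.
  have cZ : form_closed (H10 Omega) dirichlet Z.
    move=> w z Zw hz cw; split; first exact: (orth_closed (fun n => (Zw n).1) hz cw).
    have hw n : H10 Omega (w n) := (Zw n).1.1.
    have n1 : qe (fun x => A x -> rep z x <= 0).
      by apply: (qe_le_closed hw hz cw) => n; apply: qe1 (Zw n).2 => x _ h Ax; rewrite h.
    have hN n : H10 Omega (- w n) := subN sV (hw n).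
    have cN : form_cvg dirichlet (fun n => - w n) (- z).
      move=> e e0; have [N HN] := cw e e0; exists N => n /HN.
      by rewrite -opprD (formN2 dF (subB sV (hw n) hz)).
    have repN y : H10 Omega y -> qe (fun x => rep (- y) x = - rep y x).
      move=> hy; have := qe2 dO (S := fun x => rep (- y) x = - rep y x) _ (repZD (-1) hy (sub0 sV)) (rep_test (test0 Omega)).
      by rewrite scaleN1r addr0; apply => x _ -> h0; rewrite h0 mulN1r addr0.
    have n2 : qe (fun x => A x -> rep (- z) x <= 0).
      apply: (qe_le_closed hN (subN sV hz) cN) => n.
      by apply: (qe2 dO _ (repN _ (hw n)) (Zw n).2) => x _ -> h Ax; rewrite h// oppr0.
    apply: (qe2 dO _ n1 (qe2 dO (fun x _ h1 h2 => conj h1 h2) n2 (repN _ hz))).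
    move=> x _ h1 [h2 h3] Ax; apply/eqP; rewrite eq_le (h1 Ax) /=.
    by have := h2 Ax; rewrite h3 oppr_le0.
  have [z [oz qz] Hz] := riesz_subspace dF ZV sZ cZ (linear_formr dF ov.1)
    (fun y hy => form_CS dF ov.1 hy) (H10_dirichlet_complete dO).
  have or := subB orth_subspace ov oz; have sr := H1_sq dO (H10_H1 or.1).
  (* The sign of [v - z]. Its torsion function [w] lies between [- w1] and [w1], hence in [Z];
     orthogonality of [v - z] to [w] says that the integral of [|v - z|] is zero. *)
  pose f : E -> R := fun x => (0 < (v - z) x)%R%:R - ((v - z) x < 0)%R%:R.
  have mf : measurable_fun Omega f.
    by apply: measurable_funB; apply: measurable_gt_ind => //; exact: sr.1.
  have fb x : `|f x| <= 1.
    by rewrite /f; case: ltgtP => _; rewrite ?subr0 ?sub0r ?normrN ?normr1 ?subrr ?normr0.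
  have sf : sq f by apply: (@sq_bounded _ _ _ dO _ 1) => //; apply: ae_inW => x _; exact: fb.
  have [w ow Hw] := torsion sf.
  have w_le : ae_in Omega (fun x => w x <= w1 x).
    apply: (torsion_le sf _ ow ow1 Hw Hw1); apply: ae_inW => x _.
    by apply: le_trans (fb x); exact: ler_norm.
  have onw := subN orth_subspace ow.
  have w_ge : ae_in Omega (fun x => - w x <= w1 x).
    apply: (torsion_le (subN ss sf) _ onw ow1 _ Hw1).
      apply: ae_inW => x _; apply: le_trans (fb x); rewrite -normrN; exact: ler_norm.
    move=> y oy; have sy := H1_sq dO (H10_H1 oy.1).
    by rewrite (linN sV (linear_forml dF oy.1) ow.1) (linN ss (linear_forml sF sy) sf) (Hw y oy).
  have Zw : Z w.
    split=> //; have q1 := rep_le ow.1 hw1 w_le; have q2 := rep_le onw.1 hw1 w_ge.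
    have q3 := repZD (-1) ow.1 (sub0 sV); rewrite scaleN1r addr0 in q3.
    apply: (qe2 dO _ q1 (qe2 dO (fun x _ h1 h2 => conj h1 h2) q2
      (qe2 dO (fun x _ h1 h2 => conj h1 h2) q3 (rep_test (test0 Omega))))).
    move=> x _ h1 [h2 [h3 h4]] [_ Ax]; rewrite h3 h4 addr0 mulN1r Ax oppr_le0 in h2.
    by apply/eqP; rewrite eq_le h2 andbT -Ax.
  have E0 : ip f (v - z) = 0.
    rewrite -(Hw _ or) (si_sym dF ow.1 or.1) (linB sV (linear_forml dF ow.1) ov.1 oz.1).
    by rewrite (Hz _ Zw) subrr.
  have fr x : f x * (v - z) x = `|(v - z) x|.
    rewrite /f; case: ltgtP => h; rewrite ?subr0 ?sub0r ?mul1r ?mulN1r.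
    - by rewrite gtr0_norm.
    - by rewrite ltr0_norm.
    - by rewrite mul0r -h normr0.
  have vz : ae_in Omega (fun x => v x = z x).
    have := @Rintegral0_ae _ _ _ mu _ mO (fun x => f x * (v - z) x) (sqint_mul mO sf sr).
    rewrite -(ip_def mu Omega f (v - z)) E0 => H.
    have : ae_in Omega (fun x => f x * (v - z) x = 0).
      by apply: H => //; apply: ae_inW => x _; rewrite fr.
    apply: ae_in1 => x _; rewrite fr => /eqP; rewrite normr_eq0 subr_eq0 => /eqP; exact.
  apply: (qe2 dO _ (rep_eq ov.1 oz.1 vz) qz) => x _ -> h; exact: h.
have qA : quasi_closed Omega A.
  split=> [x []//|]; split=> [x []//|] e e0.
  have [G [oG GO sG cG]] := iffLR (qcontP Omega _) qw1 e e0.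
  exists G; split=> //; first exact/(capacity_small Omega).
  rewrite setUC; have -> : Omega `\` A = [set x | Omega x /\ [set t : R | t != 0] (rep w1 x)].
    apply/seteqP; split=> x [Ox].
      by move=> nA; split=> //=; apply/eqP => h; apply: nA.
    by move=> /= /eqP h; split=> // -[_].
  by apply: (@open_level _ _ _ dO _ _ [set t : R | t != 0] oG _ cG); exact: open_neq.
have mA : measurable (Omega `\` A) by exact: quasi_open_measurable qA.2.
exists A; split=> //; split=> //.
- rewrite /density_measure -(integral0 mu (Omega `\` A)); apply: ae_eq_integral => //.
  + by apply/measurable_EFinP; apply: measurable_funS slam.1 => // x [].
  + move: rw1 ow1.2; rewrite /ae_in; apply: filterS2 => x h1 h2 [Ox nA] /=.
    congr EFin; have := h2 Ox; rewrite -(h1 Ox) => /eqP; rewrite mulf_eq0.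
    by case/orP => /eqP // h; exfalso; apply: nA.
- move=> B [BO qB] lB; apply/(capacity_null dO).
  have mB := quasi_open_measurable qB.
  have lamB : ae_in (Omega `\` B) (fun x => lam x = 0).
    have il : mu.-integrable (Omega `\` B) (EFin \o lam).
      apply: integrableS (sq_integrable dO slam) => // x [] //.
    apply: (Rintegral0_ae mB il).
    - by move: lam0; rewrite /ae_in; apply: filterS => x h [Ox _]; exact: h.
    - by rewrite /Rintegral -/(density_measure lam _) lB.
  have /choice[Gp HGp] k : exists Gp : set E * (E -> R), [/\ open (Omega `\` B `|` Gp.1), Gp.1 `<=` Omega,
      H10 Omega Gp.2, (forall x, 0 <= Gp.2 x) /\ ae_in Omega (fun x => Gp.1 x -> 1 <= Gp.2 x) &
      dirichlet Gp.2 Gp.2 < k.+1%:R^-1].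
    have k0 : 0 < k.+1%:R^-1 :> R by rewrite invr_gt0.
    have [G [oG GO /(capacity_small Omega) sG oOG]] := qB.2 _ k0.
    have [p [ O [hp oO [GsO OO] pO [dp p0]]]] := small_pos dO sG.
    exists (G, p); split=> //; split=> //.
    by move: pO; rewrite /ae_in; apply: filterS => x h _ Gx; exact/h/GsO.
  pose G k := (Gp k).1; pose p k := (Gp k).2.
  have /choice[chi Hchi] k : exists chi : nat -> E -> R,
     [/\ forall j, test_function (Omega `\` B `|` G k) (chi j), forall j x, 0 <= chi j x <= 1 &
      forall x, (Omega `\` B `|` G k) x -> chi j x @[j --> \oo] --> (1 : R)].
    by case: (HGp k) => oG _ _ _ _; exact: cutoff_sequence oG.
  have tchi k j : test_function Omega (chi k j).
    case: (Hchi k) => tc _ _; apply: test_sub (tc j) => x [[]//|].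
    by case: (HGp k) => _ h _ _ _; exact: h.
  have hp k : H10 Omega (p k) by case: (HGp k).
  have hd k j : H10 Omega (-1 *: p k + chi k j).
    exact: (subD sV (subZ sV _ (hp k)) (test_H10 dO (tchi k j))).
  (* The function vanishes on [G k], where [p k >= 1 >= chi k j], and elsewhere on [B], where
     [chi k j] is zero. On the rest of [Omega] the density [lam] vanishes. *)
  have ov k j : orth (posB 0 (-1 *: p k + chi k j)).
    split; first exact: (H10_posB dO (lexx 0) (hd k j)).
    case: (HGp k) => _ _ _ [p0 p1] _; case: (Hchi k) => tc c01 _.
    move: p1 lamB; rewrite /ae_in; apply: filterS2 => x h1 h2 Ox.
    rewrite /posB subr0 -[(_ + _) x]/(-1 * p k x + chi k j x) mulN1r addrC.
    have [Gx|nGx] := pselect (G k x).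
      rewrite max_r ?mulr0// subr_le0 (le_trans _ (h1 Ox Gx))//.
      by case/andP: (c01 j x).
    have [Bx|nBx] := pselect (B x); last by rewrite h2 ?mul0r.
    rewrite (test_out (tc j)) ?sub0r; last by case=> [[]|].
    rewrite max_r ?mulr0// oppr_le0; exact: p0.
  have q1 : qe (fun x => forall k j, A x -> chi k j x <= rep (p k) x).
    apply: (qe_forall dO) => k; apply: (qe_forall dO) => j.
    apply: (qe2 dO _ (vanish _ (ov k j)) (qe2 dO (fun x _ h1 h2 => conj h1 h2)
      (rep_posB (lexx 0) (hd k j)) (qe2 dO (fun x _ h1 h2 => conj h1 h2)
      (repZD (-1) (hp k) (test_H10 dO (tchi k j))) (rep_test (tchi k j))))).
    move=> x _ h1 [h2 [h3 h4]] Ax; have := h1 Ax; rewrite h2 h3 h4 subr0 mulN1r addrC.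
    have [|_] := leP (chi k j x - rep (p k) x) 0; first by rewrite subr_le0.
    by move/eqP; rewrite subr_eq0 => /eqP ->.
  move=> e e0; have e40 : 0 < e / 4 by rewrite divr_gt0.
  (* On [A] one has [chi k j <= rep (p k)] q.e., and outside of [B] the cut-offs tend to [1]. So [A]
     minus [B] lies, up to a null set, above the level [1 / 2] of [rep (p k)]. *)
  have [k hk] : exists k, 8 * dirichlet (p k) (p k) < e / 4 * 2^-1 ^+ 2.
    have c : 0 < e / 4 * 2^-1 ^+ 2 / 8 by rewrite divr_gt0// mulr_gt0// exprn_gt0// invr_gt0.
    have [N _ HN] := (cvgr_lt _ (@cvg_harmonic R)) _ c; exists N.
    rewrite mulrC -ltr_pdivlMr//; case: (HGp N) => _ _ _ _ h; apply: lt_trans h _.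
    by apply: (HN N) => /=.
  apply: smallS (smallU dO (q1 _ e40) (rep_level (hp k) _ hk)); last by rewrite invr_gt0.
  move=> x [[Ox Ax] nB].
  have [nq|/contrapT q] := pselect (~ forall k j, A x -> chi k j x <= rep (p k) x); first by left.
  right; split=> //; case: (Hchi k) => _ _ /(_ x (or_introl (conj Ox nB))) c1.
  have h1 : 1 <= rep (p k) x.
    apply: (ler_cvg_to c1 (cvg_cst (rep (p k) x))); apply: nearW => j; exact: q.
  apply: lt_le_trans (ler_norm _); apply: lt_le_trans h1.
  by rewrite invf_lt1// ltr1n.
Qed.

(** [q_supp] is an unspecified choice among quasi-supports. Its minimality against the constructed
    [A0] transfers the vanishing property of [A0]; the converse uses that [lam] vanishes a.e. off
    the quasi-support. *)
Lemma qe_q_supp v : H10 Omega v ->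
  qe_on Omega (q_supp Omega lam) (fun x => rep v x = 0) <-> ae_in Omega (fun x => lam x * v x = 0).
Proof.
move=> hv; have [A0 [sA0 HA0]] := q_supp_construction.
have [qA lA mA] := @xgetPex _ set0 [set A | is_q_supp Omega lam A] (ex_intro _ A0 sA0).
rewrite -/(q_supp Omega lam) in qA lA mA.
rewrite (qe_onP dO); split=> [q0|lv].
- have mO' := quasi_open_measurable qA.2.
  have lamA : ae_in (Omega `\` q_supp Omega lam) (fun x => lam x = 0).
    have il : mu.-integrable (Omega `\` q_supp Omega lam) (EFin \o lam).
      by apply: integrableS (sq_integrable dO slam) => // x [].
    apply: (Rintegral0_ae mO' il).
    - by move: lam0; rewrite /ae_in; apply: filterS => x h [Ox _]; exact: h.
    - by rewrite /Rintegral -/(density_measure lam _) lA.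
  have [_ rv] := qc_repP hv; have q1 := qe_ae dO q0.
  move: lamA rv q1; rewrite /ae_in; apply: filterS3 => x h1 h2 h3 Ox.
  have [Ax|nA] := pselect (q_supp Omega lam x); last by rewrite h1 ?mul0r.
  by rewrite -(h2 Ox) (h3 Ox Ax) mulr0.
- have [qA0 lA0 _] := sA0; have n1 := iffLR (capacity_null dO _) (mA _ qA0 lA0).
  apply: nullS (nullU dO n1 (HA0 v (conj hv lv))) => x [Ox nx].
  have [Ax nr] := (not_implyP _ _).1 nx.
  have [A0x|nA0] := pselect (A0 x); last by left.
  by right; split=> // /(_ A0x).
Qed.

End density.
End quasi_support.

(** * The obstacle problem and its multiplier *)

Lemma semi_innerS {R : realType} {X : lmodType R} (V W : set X) (a : X -> X -> R) :
  semi_inner V a -> W `<=` V -> subspace W -> semi_inner W a.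
Proof.
move=> sa WV sW; split=> //.
- by move=> u v /WV hu /WV hv; exact: (si_sym sa).
- by move=> c u v w /WV hu /WV hv /WV hw; exact: (si_lin sa).
- by move=> u /WV hu; exact: (si_pos sa).
Qed.

Lemma harmonic_lt {R : realType} (e : R) : 0 < e -> exists N : nat, forall n, (N <= n)%N -> n.+1%:R^-1 < e.
Proof.
move=> e0; have [N _ HN] := (cvgr_lt _ (@cvg_harmonic R)) e e0.
by exists N => n Nn; exact: (HN n).
Qed.

Lemma le0_of_harmonic {R : realType} (x c : R) : (forall n : nat, x <= c * n.+1%:R^-1) -> x <= 0.
Proof.
move=> h; have hc : c * n.+1%:R^-1 @[n --> \oo] --> c * 0.
  by apply: cvgM; [exact: cvg_cst|exact: cvg_harmonic].
rewrite mulr0 in hc; have hx : (fun _ : nat => x) n @[n --> \oo] --> x by exact: cvg_cst.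
by apply: (ler_cvg_to hx hc); exact: nearW.
Qed.

Section obstacle.
Context {R : realType} {m : nat}.
Local Notation E := 'rV[R]_m.+1.
Local Notation Mat := 'M[R]_m.+1.
Local Notation mu := (@leb R m).
Context (Omega : set E) (dO : bounded_open Omega).
Implicit Types (u v w z phi : E -> R).
Local Notation sq := (sqint mu Omega : set (E -> R)).
Local Notation ip := (ip mu Omega).
Local Notation dirichlet := (dirichlet Omega).
Local Notation energy := (energy Omega).
Let mO := domain_measurable dO.
Let sF := ip_form dO.
Let ss : subspace sq := si_sub sF.
Let dF := H10_form dO.
Let sV := H10_subspace dO.
Context (f : E -> R) (sf : sq f) (qmin qmax psi : R) (qmin0 : 0 < qmin) (psi0 : 0 < psi).
Local Notation Qad := (Qad Omega qmin qmax).
Local Notation K := (obstacle_set Omega psi).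

Lemma energy_le q : Qad q -> exists2 C : R, 0 < C &
  forall u, H10 Omega u -> energy q u u <= C * dirichlet u u.
Proof.
move=> Qq; have [C C0 HC] := energy_bound dO (Qad_bounded dO qmin0 Qq).
exists (Num.sqrt C); first by rewrite sqrtr_gt0.
move=> u hu; have h := HC u u (H10_H1 hu) (H10_H1 hu).
have d0 := si_pos dF hu; have e0 := si_pos (energy_Qad_form dO qmin0 Qq) hu.
rewrite -(ger0_norm e0) -(ger0_norm (mulr_ge0 (sqrtr_ge0 C) d0)) -!sqrtr_sqr.
rewrite ler_sqrt ?sqr_ge0//; apply: le_trans h _.
by rewrite exprMn (sqr_sqrtr (ltW C0)) expr2.
Qed.

Lemma dirichlet_le_energy q : Qad q -> forall u, H10 Omega u -> dirichlet u u <= qmin^-1 * energy q u u.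
Proof.
move=> Qq u hu; rewrite mulrC ler_pdivlMr// mulrC.
exact: (energy_coercive dO qmin0 Qq (H10_H1 hu)).
Qed.

Lemma energy_complete q : Qad q -> form_complete (H10 Omega) (energy q).
Proof.
move=> Qq v hv cv; have [C C0 HC] := energy_le Qq.
have qi : 0 < qmin^-1 by rewrite invr_gt0.
have [|u hu vu] := H10_dirichlet_complete dO hv.
  move=> e e0; have [N HN] := cv _ (divr_gt0 e0 qi); exists N => n k Nn Nk.
  apply: le_lt_trans (dirichlet_le_energy Qq (subB sV (hv n) (hv k))) _.
  by rewrite mulrC -ltr_pdivlMr//; exact: HN.
exists u; first exact: hu.
exact: (form_cvg_dominated sV C0 HC hv hu vu).
Qed.

Lemma energy_cvg_dirichlet q (v : nat -> E -> R) u : Qad q -> (forall n, H10 Omega (v n)) -> H10 Omega u ->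
  form_cvg (energy q) v u -> form_cvg dirichlet v u.
Proof.
move=> Qq hv hu; have qi : 0 < qmin^-1 by rewrite invr_gt0.
exact: (form_cvg_dominated sV qi (dirichlet_le_energy Qq) hv hu).
Qed.

Lemma ip_energy_bounded q : Qad q -> forall g, sq g -> exists M : R,
  forall v, H10 Omega v -> ip g v ^+ 2 <= M * energy q v v.
Proof.
move=> Qq g sg; have [M [M0 HM]] := ip_bounded dO sg; exists (M * qmin^-1) => v hv.
apply: le_trans (HM v hv) _; rewrite -mulrA ler_wpM2l//; exact: dirichlet_le_energy.
Qed.

Lemma ae_le_closed (w : nat -> E -> R) v (b : E -> R) : (forall n, H10 Omega (w n)) -> H10 Omega v ->
  form_cvg dirichlet w v -> (forall n, ae_in Omega (fun x => w n x <= b x)) ->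
  ae_in Omega (fun x => v x <= b x).
Proof.
move=> hw hv cw /ae_in_forall h; have [s sn cs] := dirichlet_cvg_ae dO hw hv cw.
apply: ae_in2 h cs => x _ hx cx; apply: (ler_cvg_to cx (cvg_cst (b x))).
by apply: nearW => n; exact: hx.
Qed.

Lemma ae_ge_closed (w : nat -> E -> R) v (b : E -> R) : (forall n, H10 Omega (w n)) -> H10 Omega v ->
  form_cvg dirichlet w v -> (forall n, ae_in Omega (fun x => b x <= w n x)) ->
  ae_in Omega (fun x => b x <= v x).
Proof.
move=> hw hv cw /ae_in_forall h; have [s sn cs] := dirichlet_cvg_ae dO hw hv cw.
apply: ae_in2 h cs => x _ hx cx; apply: (ler_cvg_to (cvg_cst (b x)) cx).
by apply: nearW => n; exact: hx.
Qed.

Lemma obstacle_exists q : Qad q -> obstacle_solution Omega f psi q (solution_map Omega f psi q).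
Proof.
move=> Qq; apply: (@xgetPex _ (cst 0) [set u | obstacle_solution Omega f psi q u]).
have [M HM] := ip_energy_bounded Qq sf.
have KV : K `<=` H10 Omega by move=> v [].
have K0 : K !=set0.
  by exists 0; split; [exact: (sub0 sV)|apply: ae_inW => x _; exact: ltW].
have Kc : convex_on K.
  move=> s u v s0 s1 [hu ku] [hv kv]; split; first exact: (sub_conv sV).
  apply: ae_in2 ku kv => x _ h1 h2; rewrite -[(_ + _) x]/(s * u x + (1 - s) * v x).
  have -> : psi = s * psi + (1 - s) * psi by rewrite -mulrDl addrC subrK mul1r.
  by rewrite lerD// ler_wpM2l// subr_ge0.
have cK : form_closed (H10 Omega) (energy q) K.
  move=> w v Kw hv cw; split=> //.
  exact: (ae_le_closed (fun n => (Kw n).1) hv (energy_cvg_dirichlet Qq (fun n => (Kw n).1) hv cw) (fun n => (Kw n).2)).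
have [u Ku Hu] := variational_inequality (energy_Qad_form dO qmin0 Qq) KV K0 Kc (ip_linear dO sf) HM
  (energy_complete Qq) cK.
exists u; split=> // v Kv; have := Hu v Kv.
by rewrite innerL2E energy.unlock.
Qed.

(** * The residual of the obstacle problem as a nonnegative L^2 function *)

Section multiplier.
Context (q : E -> Mat) (Qq : Qad q).
Let u := solution_map Omega f psi q.
Let eF := energy_Qad_form dO qmin0 Qq.
Let Lam v := ip f v - energy q u v.

Lemma solution_in : H10 Omega u. Proof. by case: (obstacle_exists Qq) => [[]]. Qed.
Lemma solution_le : ae_in Omega (fun x => u x <= psi). Proof. by case: (obstacle_exists Qq) => [[]]. Qed.
Let hu := solution_in.

Lemma solution_vi v : K v -> ip f (v - u) <= energy q u (v - u).
Proof.
by move=> Kv; have := (obstacle_exists Qq).2 v Kv; rewrite innerL2E -/u energy.unlock.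
Qed.

Let Lam_lin : linear_on (H10 Omega) Lam.
Proof.
move=> c v w hv hw; rewrite /Lam (ip_linear dO sf c hv hw) (linear_formr eF hu c hv hw).
by rewrite mulrBr opprD addrACA.
Qed.

Lemma residual_ge0 v : H10 Omega v -> ae_in Omega (fun x => 0 <= v x) -> 0 <= Lam v.
Proof.
move=> hv v0; have Kv : K (u - v).
  split; first exact: (subB sV hu hv).
  apply: ae_in2 solution_le v0 => x _ h1 h2; rewrite -[(u - v) x]/(u x - v x).
  by rewrite (le_trans _ h1)// gerBl.
have := solution_vi Kv; have -> : u - v - u = - v by rewrite addrAC subrr add0r.
rewrite (linN sV (ip_linear dO sf) hv) (linN sV (linear_formr eF hu) hv) lerN2 => h.
by rewrite subr_ge0.
Qed.

Let fp : E -> R := fun x => Num.max (f x) 0.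
Let sfp : sq fp.
Proof.
apply: (sqint_ae_le mO _ sf); first by apply: measurable_maxr; [exact: sf.1|exact: measurable_cst].
apply: ae_inW => x _; rewrite /fp; have [h|h] := leP (f x) 0; first by rewrite normr0.
by [].
Qed.

(* Lewy-Stampacchia: the solution [z] of the lower obstacle problem with
   obstacle [u] and right-hand side [f - f^+] satisfies [z <= psi], hence competes
   with [u], and coincides with it. *)
Lemma residual_le v : H10 Omega v -> ae_in Omega (fun x => 0 <= v x) -> Lam v <= ip fp v.
Proof.
have sg := subB ss sf sfp; have [M HM] := ip_energy_bounded Qq sg.
pose L := [set w | H10 Omega w /\ ae_in Omega (fun x => u x <= w x)].
have LV : L `<=` H10 Omega by move=> w [].
have L0 : L !=set0 by exists u; split; [exact: hu|exact: ae_inW].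
have Lc : convex_on L.
  move=> s v1 v2 s0 s1 [h1 k1] [h2 k2]; split; first exact: (sub_conv sV).
  apply: ae_in2 k1 k2 => x _ l1 l2; rewrite -[(_ + _) x]/(s * v1 x + (1 - s) * v2 x).
  have -> : u x = s * u x + (1 - s) * u x by rewrite -mulrDl addrC subrK mul1r.
  by rewrite lerD// ler_wpM2l// subr_ge0.
have cL : form_closed (H10 Omega) (energy q) L.
  move=> w y Kw hy cw; split=> //.
  exact: (ae_ge_closed (fun n => (Kw n).1) hy (energy_cvg_dirichlet Qq (fun n => (Kw n).1) hy cw) (fun n => (Kw n).2)).
have [z [hz uz] Hz] := variational_inequality eF LV L0 Lc (ip_linear dO sg) HM (energy_complete Qq) cL.
have hp := H10_posB dO (ltW psi0) hz; have sp := H1_sq dO (H10_H1 hp).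
have zpsi : ae_in Omega (fun x => z x <= psi).
  (* This competitor is the minimum of [z] and [psi], which still lies above [u]. *)
  have Lw : L (z - posB psi z).
    split; first exact: (subB sV hz hp).
    apply: ae_in2 uz solution_le => x _ h1 h2; rewrite -[(z - _) x]/(z x - Num.max (z x - psi) 0).
    by have [h|h] := leP (z x - psi) 0; [rewrite subr0|rewrite subKr].
  have := Hz _ Lw; have -> : z - posB psi z - z = - posB psi z by rewrite addrAC subrr add0r.
  rewrite (linN sV (ip_linear dO sg) hp) (linN sV (linear_formr eF hz) hp) lerN2.
  rewrite (energy_posB dO (Qad_bounded dO qmin0 Qq) (ltW psi0) hz) => h.
  have h2 : ip (f - fp) (posB psi z) <= 0.
    rewrite -oppr_ge0 -(linN ss (linear_forml sF sp) sg) opprB.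
    apply: (ip_ge0 dO); [exact: (subB ss sfp sf).1|exact: sp.1|].
    apply: ae_inW => x _; rewrite -[(fp - f) x]/(fp x - f x) mulr_ge0 ?posB_ge0// subr_ge0.
    by rewrite /fp le_max lexx.
  have h3 := dirichlet_le_energy Qq hp.
  have h4 : dirichlet (posB psi z) (posB psi z) <= 0.
    apply: le_trans h3 _; rewrite pmulr_rle0 ?invr_gt0//; exact: le_trans h h2.
  have := H10_ae_unique dO hp (sub0 sV); rewrite subr0 => /(_ h4).
  apply: ae_in1 => x _; rewrite /posB -[0 x]/(0 : R) => e0; rewrite -subr_le0.
  by move: e0; case: leP => // h5 h6; rewrite h6 ltxx in h5.
have hd := subB sV hz hu; have sd := H1_sq dO (H10_H1 hd).
have h1 := solution_vi (conj hz zpsi).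
have h2 := Hz u (conj hu (ae_inW (fun x _ => lexx (u x)))).
(* Adding the two variational inequalities bounds the energy of [z - u] by [- ip fp (z - u)], which
   is nonpositive because [u <= z]. *)
have dE : energy q (z - u) (z - u) <= 0.
  have e1 : u - z = - (z - u) by rewrite opprB.
  rewrite e1 (linN sV (ip_linear dO sg) hd) (linN sV (linear_formr eF hz) hd) lerN2 in h2.
  have h3 : 0 <= ip fp (z - u).
    apply: (ip_ge0 dO); [exact: sfp.1|exact: sd.1|].
    apply: ae_in1 uz => x _ h; rewrite mulr_ge0 ?subr_ge0//.
    by rewrite /fp le_max lexx orbT.
  rewrite (linB sV (linear_forml eF hd) hz hu).
  have := linB ss (linear_forml sF sd) sf sfp; move: h1 h2 h3.
  move: (ip f _) (ip fp _) (ip (f - fp) _) (energy q u _) (energy q z _).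
  by move=> *; lra.
have z0 : dirichlet (z - u) (z - u) <= 0.
  by apply: le_trans (dirichlet_le_energy Qq hd) _; rewrite pmulr_rle0 ?invr_gt0.
move=> hv v0; have sv := H1_sq dO (H10_H1 hv).
have Lv : L (z + v).
  split; first exact: (subD sV hz hv).
  apply: ae_in2 uz v0 => x _ l1 l2; rewrite -[(z + v) x]/(z x + v x).
  by rewrite (le_trans l1)// lerDl.
have := Hz _ Lv; have -> : z + v - z = v by rewrite addrAC subrr add0r.
have Ez : energy q z v = energy q u v.
  apply/eqP; rewrite -subr_eq0 -(linB sV (linear_forml eF hv) hz hu) -sqrf_eq0.
  rewrite eq_le sqr_ge0 andbT; apply: le_trans (form_CS eF hd hv) _.
  have -> : energy q (z - u) (z - u) = 0 by apply/eqP; rewrite eq_le dE (si_pos eF hd).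
  by rewrite mul0r.
rewrite Ez (linB ss (linear_forml sF sv) sf sfp) /Lam.
by move: (ip f v) (ip fp v) (energy q u v) => a b c; lra.
Qed.

(** On nonnegative functions [Lam] lies between [0] and [ip fp]. Splitting [v] into positive and
    negative parts gives [|Lam v| <= ip fp (absf v)], hence continuity in the L^2 norm. *)
Let Lam_bound v : H10 Omega v -> Lam v ^+ 2 <= ip fp fp * ip v v.
Proof.
move=> hv; have sv := H1_sq dO (H10_H1 hv).
have hp := H10_posB dO (lexx 0) hv; have hn := H10_posB dO (lexx 0) (subN sV hv).
have sp := H1_sq dO (H10_H1 hp); have sn := H1_sq dO (H10_H1 hn).
have p0 : ae_in Omega (fun x => 0 <= posB 0 v x) by apply: ae_inW => x _; exact: posB_ge0.
have n0 : ae_in Omega (fun x => 0 <= posB 0 (- v) x) by apply: ae_inW => x _; exact: posB_ge0.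
have vE := posB_decomposition v.
have aE : absf v = posB 0 v + posB 0 (- v) := absfE v.
have h1 := residual_ge0 hp p0; have h2 := residual_le hp p0.
have h3 := residual_ge0 hn n0; have h4 := residual_le hn n0.
have ha := H10_absf dO hv; have sa := H1_sq dO (H10_H1 ha).
have B : `|Lam v| <= ip fp (absf v).
  rewrite aE (linD (linear_formr sF sfp) sp sn) [in Lam v]vE (linB sV Lam_lin hp hn).
  by rewrite ler_norml; apply/andP; split; lra.
have av : ip (absf v) (absf v) = ip v v.
  by rewrite !ip_def; apply: eq_Rintegral => x _; rewrite /absf -!expr2 real_normK ?num_real.
rewrite -av -(real_normK (num_real (Lam v))); apply: le_trans (form_CS sF sfp sa).
by rewrite lerXn2r ?nnegrE// (le_trans _ B).
Qed.

(** A Riesz representation for a functional given on H^1_0 only, which is not assumed complete for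
    [ip]. The almost minimizers in H^1_0 are Cauchy in L^2, and their L^2 limit is the density. *)
Lemma multiplier_exists : exists lam, sq lam /\ forall v, H10 Omega v -> ip lam v = Lam v.
Proof.
have WS : (H10 Omega : set (E -> R)) `<=` sq by move=> v /H10_H1; exact: (H1_sq dO).
have iF := semi_innerS sF WS sV.
have V0 : (H10 Omega : set (E -> R)) !=set0 by exists 0; exact: (sub0 sV).
have Vc : convex_on (H10 Omega : set (E -> R)) by move=> s v w _ _; exact: (sub_conv sV).
have [v [hv cv Jv]] := almost_minimizers iF (fun _ h => h) V0 Vc Lam_lin Lam_bound.
have sv n := WS _ (hv n).
have [lam slam cl] := ip_complete mO sv cv.
exists lam; split=> // y hy; have sy := WS _ hy.
have key y' : H10 Omega y' -> Lam y' <= ip lam y'.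
  move=> hy'; have sy' := WS _ hy'.
  (* At fixed [s] the limit in [n] removes the error [n.+1^-1 / s]; afterwards [s] tends to zero
     through the values [n.+1^-1]. *)
  have step (s : R) : 0 < s -> s <= 1 -> - s * ip y' y' <= 2 * (ip lam y' - Lam y').
    move=> s0 s1.
    have c1 := form_cvgr sF sv slam sy' cl.
    have c2 : 2 * (ip y' (v n) - Lam y') @[n --> \oo] --> 2 * (ip y' lam - Lam y').
      by apply: cvgM; [exact: cvg_cst|apply: cvgB; [exact: c1|exact: cvg_cst]].
    have c3 : - (n.+1%:R^-1 / s) - s * ip y' y' @[n --> \oo] --> - (0 / s) - s * ip y' y'.
      apply: cvgB; last exact: cvg_cst.
      by apply: cvgN; apply: cvgM; [exact: cvg_harmonic|exact: cvg_cst].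
    rewrite mul0r oppr0 sub0r -mulNr (si_sym sF sy' slam) in c2 c3.
    apply: (ler_cvg_to c3 c2); apply: nearW => n.
    have hw := subD sV (hv n) hy'.
    have := almost_min_variation iF Lam_lin (hv n) hw s0 s1 (Jv n _ (sub_conv sV s hw (hv n))).
    have -> : v n + y' - v n = y' by rewrite addrAC subrr add0r.
    by rewrite (si_sym sF sy' (sv n)) mulNr.
  have B n : Lam y' - ip lam y' <= (ip y' y' / 2) * n.+1%:R^-1.
    have := step n.+1%:R^-1; rewrite invr_gt0 ltr0n => /(_ isT).
    rewrite invf_le1 ?ltr0n// ler1n => /(_ isT).
    by move: (n.+1%:R^-1) (ip y' y') (ip lam y') (Lam y') => a b c e; lra.
  by rewrite -subr_le0; exact: le0_of_harmonic B.
apply/eqP; rewrite eq_le key// andbT.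
have := key _ (subN sV hy); rewrite (linN sV Lam_lin hy) (linN ss (linear_formr sF slam) sy).
by rewrite lerN2.
Qed.

Let lam := multiplier Omega f q u.

Lemma multiplierP : sq lam /\ forall v, H10 Omega v -> ip lam v = ip f v - energy q u v.
Proof.
have [l [sl Hl]] := multiplier_exists.
have [|L HL] := @xgetPex _ (cst 0) [set l | is_multiplier Omega f q u l].
  exists l; split; first exact/(L2P dO).
  by move=> v hv; rewrite innerL2E (Hl v hv) /Lam /div_pairing innerL2E energy.unlock addrC.
rewrite -/(multiplier Omega f q u) -/lam in L HL; split; first exact/(L2P dO).
by move=> v hv; have := HL v hv; rewrite !innerL2E /div_pairing energy.unlock addrC.
Qed.

Let slam := multiplierP.1.

Lemma multiplier_ge0 : ae_in Omega (fun x => 0 <= lam x).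
Proof.
apply: (nonneg_of_tests dO.1 (domain_finite dO) (sq_integrable dO slam)) => phi tp phi0.
have hphi := test_H10 dO tp; have := multiplierP.2 _ hphi; rewrite ip_def => ->.
by apply: residual_ge0 => //; apply: ae_inW.
Qed.

(** [psi - u] is not in H^1_0, being positive at the boundary. The admissible increments are
    [Y j = min (chi j) (psi - u)], written with [posB] to be in H^1_0, and [chi j] tends to [1]. *)
Lemma complementarity : ae_in Omega (fun x => lam x * (psi - u x) = 0).
Proof.
have [chi [tchi chi01 cchi]] := cutoff_sequence dO.1.
have tO j := tchi j; have hchi j := test_H10 dO (tO j).
pose Y j := chi j - posB psi (u + chi j).
have huc j := subD sV hu (hchi j); have hp j := H10_posB dO (ltW psi0) (huc j).
have hY j : H10 Omega (Y j) := subB sV (hchi j) (hp j).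
have YE j x : Y j x = Num.min (chi j x) (psi - u x).
  rewrite -[LHS]/(chi j x - Num.max (u x + chi j x - psi) 0).
  case: (leP (u x + chi j x - psi) 0) => h.
    by rewrite subr0 (min_idPl _)//; lra.
  by rewrite (min_idPr _); lra.
have Y0 j : ae_in Omega (fun x => 0 <= Y j x).
  apply: ae_in1 solution_le => x _ h; rewrite YE le_min subr_ge0 h andbT.
  by case/andP: (chi01 j x).
have z j : ae_in Omega (fun x => lam x * Y j x = 0).
  have sY := H1_sq dO (H10_H1 (hY j)).
  have Ky : K (u + Y j).
    split; first exact: (subD sV hu (hY j)).
    apply: ae_inW => x _; rewrite -[(u + Y j) x]/(u x + Y j x) YE -lerBrDl.
    by rewrite ge_min lexx orbT.
  have := solution_vi Ky; have -> : u + Y j - u = Y j by rewrite addrAC subrr add0r.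
  rewrite -subr_le0 -(multiplierP.2 _ (hY j)) ip_def => h.
  apply: (Rintegral0_ae mO (sqint_mul mO slam sY) _ h).
  by apply: ae_in2 multiplier_ge0 (Y0 j) => x _ h1 h2; exact: mulr_ge0.
apply: ae_in2 (ae_in_forall z) solution_le => x Ox hz hx.
have [->|l0] := eqVneq (lam x) 0; first by rewrite mul0r.
have [ux|ux] := leP (psi - u x) 0.
  by have -> : psi - u x = 0; [apply/eqP; rewrite eq_le ux subr_ge0|rewrite mulr0].
have E0 : (fun j => chi j x) = fun=> 0.
  apply/funext => j; have /eqP := hz j; rewrite mulf_eq0 (negbTE l0) /= YE.
  by case: leP => _ /eqP // h; rewrite h ltxx in ux.
have c0 : (fun _ : nat => 0 : R) j @[j --> \oo] --> (0 : R) by exact: cvg_cst.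
have c1 := cchi x Ox; rewrite E0 in c1.
have h : (1 : R) = 0 by apply: (cvg_unique _ c1 c0).
by move/eqP: h; rewrite oner_eq0.
Qed.

End multiplier.
End obstacle.

(** * Approximation of the critical cone *)

Lemma compact_positive_lower_bound {R : realType} {T : topologicalType} (A : set T) (h : T -> R) :
  compact A -> {within A, continuous h} -> (forall x, A x -> 0 < h x) ->
  exists2 r : R, 0 < r & forall x, A x -> r <= h x.
Proof.
move=> cA ch h0; have ck := continuous_compact ch cA.
have oC : open (~` (h @` A)) by apply: closed_openC; exact: (compact_closed (@norm_hausdorff _ R) ck).
have n0 : (~` (h @` A)) 0 by move=> [x Ax hx]; have := h0 x Ax; rewrite hx ltxx.
have /nbhs_ballP[r /= r0 Hr] := open_nbhs_nbhs (conj oC n0).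
exists r => // x Ax; rewrite leNgt; apply/negP => hr.
apply: (Hr (h x)); last by exists x.
by rewrite -ball_normE /= sub0r normrN gtr0_norm ?h0.
Qed.

Section cone.
Context {R : realType} {m : nat}.
Local Notation E := 'rV[R]_m.+1.
Local Notation mu := (@leb R m).
Context (Omega : set E) (dO : bounded_open Omega).
Implicit Types (u v w z phi : E -> R).
Local Notation sq := (sqint mu Omega : set (E -> R)).
Local Notation ip := (ip mu Omega).
Local Notation dirichlet := (dirichlet Omega).
Local Notation rep := (qc_rep Omega).
Local Notation qe := (qe Omega).
Local Notation small := (small Omega).
Let mO := domain_measurable dO.
Let dF := H10_form dO.
Let sV := H10_subspace dO.

Lemma regular_set w1 w2 (P : E -> Prop) (e : R) : quasi_continuous Omega w1 ->
  quasi_continuous Omega w2 -> qe P -> 0 < e -> exists G,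
  [/\ open G, G `<=` Omega /\ small e G, {within Omega `\` G, continuous w1},
      {within Omega `\` G, continuous w2} & forall x, Omega x -> ~ G x -> P x].
Proof.
move=> /qcontP q1 /qcontP q2 qP e0.
have e4 : 0 < e / 4 by rewrite divr_gt0.
have e16 : 0 < e / 4 / 4 by rewrite divr_gt0.
have [G1 [ o1 G1O s1 c1]] := q1 _ e16; have [G2 [ o2 G2O s2 c2]] := q2 _ e16.
have [v [ O [hv oO [PO OO] vO dv]]] := qP _ e4.
have sO : small (e / 4) O by exists v, O; split; [exact: hv|exact: oO|by split|exact: vO|exact: dv].
exists ((G1 `|` G2) `|` O); split.
- by apply: openU => //; exact: openU.
- split; first by move=> x [[]|]; [exact: G1O|exact: G2O|exact: OO].
  by apply: (smallU dO) sO; exact: (smallU dO s1 s2).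
- by apply: continuous_subspaceW c1 => x [Ox nG]; split=> // G1x; apply: nG; left; left.
- by apply: continuous_subspaceW c2 => x [Ox nG]; split=> // G2x; apply: nG; left; right.
- by move=> x Ox nG; apply: contrapT => nP; apply: nG; right; exact: PO.
Qed.

Context (u : E -> R) (psi : R) (hu : H10 Omega u) (upsi : ae_in Omega (fun x => u x <= psi)).

(** On the compact set obtained by removing [G] from the support of [phi], the continuous function
    [h] is positive, since [rep v] vanishes where [rep u = psi]. It has a positive lower bound
    there, and where [rep v > r] only the term [psi - rep u] remains. *)
Lemma feasible_bound (G : set E) phi (v : E -> R) (r M : R) : G `<=` Omega ->
  test_function Omega phi -> (forall x, `|phi x| <= M) -> 0 < M -> 0 < r -> open G ->
  {within Omega `\` G, continuous rep u} -> {within Omega `\` G, continuous rep v} ->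
  (forall x, Omega x -> ~ G x -> rep u x <= psi /\ (rep u x = psi -> rep v x = 0)) ->
  exists2 c : R, 0 <= c & forall x, Omega x -> ~ G x -> r < rep v x -> r < phi x ->
    M <= c * (psi - rep u x).
Proof.
move=> GO tp phiM M0 r0 oG cu cv HG; have [S [cS SO S0]] := test_support tp.
pose h x := (psi - rep u x) + Num.max (r - rep v x) 0.
have cA : compact (S `\` G) by rewrite setDE; apply: compact_closedI cS _; exact: open_closedC.
have sub : S `\` G `<=` Omega `\` G by move=> x [/SO].
have ch : {within S `\` G, continuous h}.
  apply: continuous_subspaceW sub _; apply/subspace_continuousP => x Ax.
  apply: cvgD; first by apply: cvgB; [exact: cvg_cst|move/subspace_continuousP: cu; exact].
  have hc : (fun y => r - rep v y) @ within (Omega `\` G) (nbhs x) --> r - rep v x.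
    by apply: cvgB; [exact: cvg_cst|move/subspace_continuousP: cv; exact].
  have cmax : continuous (fun a : R => Num.max a 0).
    move=> a; apply/cvgrPdist_lt => e e0; near=> y.
    have := posB_lip 0 a y; rewrite !subr0 => /le_lt_trans; apply.
    by near: y; exact: cvgr_dist_lt.
  exact: (cvg_comp _ _ hc (cmax _)).
have hp x : (S `\` G) x -> 0 < h x.
  move=> [Sx nG]; have [u1 u2] := HG x (SO x Sx) nG.
  have [e|ne] := eqVneq (rep u x) psi.
    by rewrite /h e subrr add0r (u2 e) subr0 lt_max r0.
  by rewrite /h ltr_pwDl// ?subr_gt0 ?lt_neqAle ?ne// le_max lexx orbT.
have [c c0 Hc] := compact_positive_lower_bound cA ch hp.
exists (M / c); first by rewrite divr_ge0 ?ltW.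
move=> x Ox nG rv rphi.
have Sx : S x by apply: contrapT => nS; rewrite (S0 x nS) in rphi; have := lt_trans r0 rphi; rewrite ltxx.
have := Hc x (conj Sx nG); rewrite /h max_r ?addr0; last by rewrite subr_le0 ltW.
by move=> h1; rewrite mulrAC ler_pdivlMr// ler_wpM2l// ltW.
Unshelve. all: by end_near. Qed.

(* With [phi n] test functions converging to [v] and [p n >= 1] on a small open set
   outside of which [u] and [v] are continuous, take the positive part of
   [min v (phi n) - M n * p n - d n]: where it is positive, [psi - u] is bounded
   below by compactness. *)
Lemma cone_nonneg_approx v : H10 Omega v -> (forall x, 0 <= v x) ->
  qe (fun x => rep u x = psi -> rep v x = 0) ->
  exists w : nat -> E -> R, [/\ forall n, H10 Omega (w n), forall n x, 0 <= w n x, form_cvg dirichlet w v &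
    forall n, exists2 c : R, 0 <= c & ae_in Omega (fun x => w n x <= c * (psi - u x))].
Proof.
move=> hv v0 qv.
have [hv1 [phi tp cv0]] := iffLR (H10P dO v) hv.
have hphi n := test_H10 dO (tp n).
have cphi := sobolev_cvg_dirichlet dO (fun n => test_H1 dO (tp n)) hv1 cv0.
have /choice[M HM] n : exists M : R, 0 < M /\ forall x, `|phi n x| <= M.
  by have [M M0 h] := test_bounded (tp n); exists M.
have [qu ru] := qc_repP dO hu; have [qrv rv] := qc_repP dO hv.
have qu1 : qe (fun x => rep u x <= psi).
  apply: (qc_le dO qu (qcont_continuous dO (@cst_continuous _ _ psi))).
  by apply: ae_in2 ru upsi => x _ ->.
have qP : qe (fun x => rep u x <= psi /\ (rep u x = psi -> rep v x = 0)).
  exact: (qe2 dO (fun x _ h1 h2 => conj h1 h2) qu1 qv).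
pose d n : R := n.+1%:R^-1; have d0 n : 0 < d n by rewrite invr_gt0.
(* With this bound on the energy of [p n], the energy of [M n *: p n] is at most [d n], although
   [M n] is uncontrolled. *)
have ec n : 0 < d n / M n ^+ 2 by rewrite divr_gt0// exprn_gt0//; case: (HM n).
have /choice[Gp HGp] n : exists Gp : set E * (E -> R), [/\ H10 Omega Gp.2, forall x, 0 <= Gp.2 x,
    ae_in Omega (fun x => Gp.1 x -> 1 <= Gp.2 x), dirichlet Gp.2 Gp.2 < d n / M n ^+ 2 &
    exists2 c : R, 0 <= c & forall x, Omega x -> ~ Gp.1 x -> d n < rep v x -> d n < phi n x ->
      M n <= c * (psi - rep u x)].
  have [G [oG [GO sG] cu cv HG]] := regular_set qu qrv qP (ec n).
  have [p [ O [hp oO [GsO OO] pO [dp p0]]]] := small_pos dO sG.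
  exists (G, p); split=> //=.
    by move: pO; rewrite /ae_in; apply: filterS => x h _ Gx; exact/h/GsO.
  by apply: (feasible_bound GO (tp n) (HM n).2 (HM n).1 (d0 n) oG cu cv HG).
pose p n := (Gp n).2; have hp n : H10 Omega (p n) by case: (HGp n).
have hdiff n : H10 Omega (v - phi n) := subB sV hv (hphi n).
have hpos n := H10_posB dO (lexx 0) (hdiff n).
(* The first bracket is the minimum of [v] and [phi n]. *)
pose g n := (v - posB 0 (v - phi n)) - M n *: p n.
have hMp n := subZ sV (M n) (hp n).
have hg n : H10 Omega (g n) := subB sV (subB sV hv (hpos n)) (hMp n).
have cg : form_cvg dirichlet g v.
  move=> e e0; have e4 : 0 < e / 4 by rewrite divr_gt0.
  have [N1 H1] := cphi _ e4; have [N2 H2] := harmonic_lt e4.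
  exists (maxn N1 N2) => n; rewrite geq_max => /andP[n1 n2].
  have -> : g n - v = - (posB 0 (v - phi n) + M n *: p n).
    by rewrite /g opprD addrC !addrA addNr add0r.
  rewrite (formN2 dF (subD sV (hpos n) (hMp n))).
  apply: le_lt_trans (formD2_le dF (hpos n) (hMp n)) _.
  have h1 := dirichlet_posB dO (lexx 0) (hdiff n).
  have h2 := H1 n n1; rewrite (formB_sym dF (hphi n) hv) in h2.
  have h3 : dirichlet (M n *: p n) (M n *: p n) <= d n.
    rewrite (formZ2 dF _ (hp n)); case: (HGp n) => _ _ _ /ltW h _.
    by have M2 : 0 < M n ^+ 2 by [rewrite exprn_gt0//; case: (HM n)]; rewrite mulrC -ler_pdivlMr.
  have h4 := H2 n n2; rewrite -/(d n) in h4; lra.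
have [s sn cw] := posB_cvg dO hg hv cg (fun n => ltW (d0 n)) (@cvg_harmonic R).
have vE : posB 0 v = v by apply/funext => x; rewrite /posB subr0 max_l.
rewrite vE in cw; exists (fun n => posB (d (s n)) (g (s n))); split; [| |exact: cw|].
- by move=> n; exact: (H10_posB dO (ltW (d0 _)) (hg _)).
- by move=> n x; exact: posB_ge0.
move=> n; move: (s n) => k; case: (HGp k) => _ p0 p1 _ [c c0 Hc]; exists c => //.
have := ae_in2 (Q := fun x => rep v x = v x) (S := fun x => rep u x = u x /\ rep v x = v x)
  (fun x _ h1 h2 => conj h1 h2) ru rv.
apply: ae_in3 _ upsi p1 => x Ox ux hp1 [ru_ rv_].
have rhs0 : 0 <= c * (psi - u x) by rewrite mulr_ge0// subr_ge0.
have gE : g k x = v x - Num.max (v x - phi k x) 0 - M k * p k x.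
  by rewrite -[LHS]/(v x - Num.max (v x - phi k x - 0) 0 - M k * p k x) subr0.
have M0 : 0 < M k by case: (HM k).
have phiM : phi k x <= M k by case: (HM k) => _ /(_ x); apply: le_trans; exact: ler_norm.
have Mp0 : 0 <= M k * p k x := mulr_ge0 (ltW M0) (p0 x).
have gv : g k x <= v x.
  by rewrite gE; have [h|h] := leP (v x - phi k x) 0; lra.
have gphi : g k x <= phi k x - M k * p k x.
  by rewrite gE; have [h|h] := leP (v x - phi k x) 0; lra.
have [gd|gd] := leP (g k x - d k) 0; first by rewrite /posB (max_idPr gd).
rewrite /posB (max_idPl (ltW gd)).
have [Gx|nGx] := pselect ((Gp k).1 x).
  (* On the exceptional set [M k * p k x] is at least [M k], hence at least [phi k x], which
     contradicts positivity of [g k x - d k]. *)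
  have p1x : 1 <= p k x := hp1 Gx; have : M k * 1 <= M k * p k x by rewrite ler_pM2l.
  by have := d0 k; move=> *; lra.
have h1 : d k < rep v x by rewrite rv_; lra.
have h2 : d k < phi k x by lra.
have := Hc x Ox nGx h1 h2; rewrite ru_; apply: le_trans.
by have := d0 k; move=> *; lra.
Qed.

End cone.

(** * Directional differentiability *)

Lemma bounded_linear_cvg {R : realType} {X : lmodType R} (V : set X) (a : X -> X -> R) (F : X -> R) (C : R)
    (v : nat -> X) u : semi_inner V a -> linear_on V F -> (forall y, V y -> F y ^+ 2 <= C * a y y) ->
  (forall n, V (v n)) -> V u -> form_cvg a v u -> F (v n) @[n --> \oo] --> F u.
Proof.
move=> sa lF FC Vv Vu cv; apply/cvgrPdist_lt => e e0.
have C1 : 0 < `|C| + 1 by rewrite ltr_wpDl.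
have e2 : 0 < e ^+ 2 by rewrite exprn_gt0.
have [N HN] := cv _ (divr_gt0 e2 C1); exists N => // n /= Nn.
have Vd := subB (si_sub sa) (Vv n) Vu.
rewrite distrC -(linB (si_sub sa) lF (Vv n) Vu) -(@ltr_pXn2r _ 2) ?nnegrE ?(ltW e0)//.
rewrite real_normK ?num_real//; apply: le_lt_trans (FC _ Vd) _.
apply: le_lt_trans (_ : (`|C| + 1) * a (v n - u) (v n - u) < _).
  rewrite ler_wpM2r ?(si_pos sa Vd)// (le_trans (ler_norm C))// lerDl//.
by rewrite mulrC -ltr_pdivlMr//; exact: HN.
Qed.

Lemma sqr_lt_norm {R : realType} (x y : R) : 0 < y -> x ^+ 2 < y ^+ 2 -> `|x| < y.
Proof. by move=> y0; rewrite -(@ltr_pXn2r _ 2 _ `|x|) ?nnegrE ?(ltW y0)// real_normK ?num_real. Qed.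

Lemma scaled_sub_le0 {R : realType} (s p r : R) : 0 < s -> r <= p -> s * r + (- s * p + 0) <= 0.
Proof. by move=> s0 rp; rewrite addr0 mulNr -mulrBr pmulr_rle0// subr_le0. Qed.

Global Opaque solution_map multiplier qc_rep quasi_continuous capacity.

Section derivative.
Context {R : realType} {m : nat}.
Local Notation E := 'rV[R]_m.+1.
Local Notation Mat := 'M[R]_m.+1.
Local Notation mu := (@leb R m).
Context (Omega : set E) (dO : bounded_open Omega).
Implicit Types (v z y phi : E -> R).
Local Notation sq := (sqint mu Omega : set (E -> R)).
Local Notation ip := (ip mu Omega).
Local Notation dirichlet := (dirichlet Omega).
Local Notation energy := (energy Omega).
Local Notation rep := (qc_rep Omega).
Local Notation qe := (qe Omega).
Let mO := domain_measurable dO.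
Let sF := ip_form dO.
Let ss : subspace sq := si_sub sF.
Let dF := H10_form dO.
Let sV := H10_subspace dO.
Context (f : E -> R) (sf : sq f) (qmin qmax psi : R) (qmin0 : 0 < qmin) (psi0 : 0 < psi).
Context (q d : E -> Mat) (Qq : Qad Omega qmin qmax q) (Qqd : Qad Omega qmin qmax (q + d)).
Let u := solution_map Omega f psi q.
Let lam := multiplier Omega f q u.
Let hu : H10 Omega u := solution_in dO sf qmin0 psi0 Qq.
Let upsi := solution_le dO sf qmin0 psi0 Qq.
Let slam : sq lam := (multiplierP dO sf qmin0 psi0 Qq).1.
Let lamE := (multiplierP dO sf qmin0 psi0 Qq).2.
Let lam0 := multiplier_ge0 dO sf qmin0 psi0 Qq.
Let lam_compl := complementarity dO sf qmin0 psi0 Qq.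
Let eF := energy_Qad_form dO qmin0 Qq.
Let bq := Qad_bounded dO qmin0 Qq.
Let bd : bounded_coef Omega d := Qad_direction_bounded dO qmin0 Qq Qqd.
Local Notation b := (energy d).
Local Notation a := (energy q).

(** The critical cone with the condition on the quasi-support in its a.e. form, which is easier to
    carry through limits. *)
Definition cone : set (E -> R) :=
  [set phi | orth Omega lam phi /\ qe (fun x => rep u x = psi -> rep phi x <= 0)].

Lemma orth_ip phi : orth Omega lam phi -> ip lam phi = 0.
Proof.
move=> [hphi lphi]; have sp := H1_sq dO (H10_H1 hphi); apply/eqP; rewrite eq_le.
rewrite -oppr_ge0 -(linN ss (linear_formr sF slam) sp); apply/andP; split.
- apply: (ip_ge0 dO slam.1 (subN ss sp).1); apply: ae_in1 lphi => x _ h.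
  by rewrite -[(- phi) x]/(- phi x) mulrN h oppr0.
- by apply: (ip_ge0 dO slam.1 sp.1); apply: ae_in1 lphi => x _ ->.
Qed.

Lemma critical_coneP phi : critical_cone Omega f psi q phi <-> cone phi.
Proof.
rewrite /critical_cone -/u -/lam; split.
- move=> [hphi /(qe_onP dO) h1 /(qe_q_supp dO slam lam0 hphi) h2]; split=> //.
- move=> [[hphi h2] h1]; split=> //; first exact/(qe_onP dO).
  exact/(qe_q_supp dO slam lam0 hphi).
Qed.

Lemma cone_H10 : cone `<=` H10 Omega. Proof. by move=> v [[]]. Qed.

Lemma cone0 : cone 0.
Proof.
split; first exact: (sub0 (orth_subspace dO lam)).
by apply: qe1 (rep_test dO (test0 Omega)) => x _ ->.
Qed.

Lemma coneZD c c' v z : 0 <= c -> 0 <= c' -> cone v -> cone z -> cone (c *: v + c' *: z).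
Proof.
move=> c0 c0' [ov qv] [oz qz]; have oS := orth_subspace dO lam.
split; first exact: (subD oS (subZ oS c ov) (subZ oS c' oz)).
have r1 := repZD dO c ov.1 (subZ sV c' oz.1).
have r2 := repZD dO c' oz.1 (sub0 sV); rewrite addr0 in r2.
have r3 := qe2 dO (fun x _ h1 h2 => conj h1 h2) r2 (rep_test dO (test0 Omega)).
have r4 := qe2 dO (fun x _ h1 h2 => conj h1 h2) qv qz.
apply: (qe2 dO _ r1 (qe2 dO (fun x _ h1 h2 => conj h1 h2) r3 r4)).
move=> x _ -> [[-> ->] [h1 h2]] hx; rewrite addr0.
by rewrite -[leRHS](addr0 0) lerD// mulr_ge0_le0// ?h1// h2.
Qed.

Lemma cone_closed : form_closed (H10 Omega) dirichlet cone.
Proof.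
move=> w v cw hv cv; split; first exact: (orth_closed dO (fun n => (cw n).1) hv cv).
exact: (qe_le_closed dO (fun n => (cw n).1.1) hv cv (fun n => (cw n).2)).
Qed.

(** Only the positive part is approximated; subtracting the negative part keeps the upper bound. The
    approximants are in [orth] because [0 <= lam w <= c lam (psi - u) = 0] by complementarity. *)
Lemma cone_approx phi (e : R) : cone phi -> 0 < e -> exists phi', [/\ orth Omega lam phi',
  exists2 c : R, 0 <= c & ae_in Omega (fun x => phi' x <= c * (psi - u x)) &
  dirichlet (phi' - phi) (phi' - phi) < e].
Proof.
move=> [ophi qphi] e0; have hphi := ophi.1; have oS := orth_subspace dO lam.
have hp := H10_posB dO (lexx 0) hphi.
have on := orth_posB dO (subN oS ophi).
have qp : qe (fun x => rep u x = psi -> rep (posB 0 phi) x = 0).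
  apply: (qe2 dO _ (rep_posB dO (lexx 0) hphi) qphi) => x _ -> h hx.
  by rewrite subr0 max_r// h.
have [w [hw w0 cw Hw]] := cone_nonneg_approx dO hu upsi hp (posB_ge0 0 phi) qp.
have [N HN] := cw e e0; have [c c0 Hc] := Hw N.
have ow : orth Omega lam (w N).
  split; first exact: hw.
  apply: ae_in3 Hc lam0 lam_compl => x _ h1 h2 h3.
  apply/eqP; rewrite eq_le mulr_ge0// ?w0// andbT.
  by apply: le_trans (ler_wpM2l h2 h1) _; rewrite mulrCA h3 mulr0.
exists (w N - posB 0 (- phi)); split.
- exact: (subB oS ow on).
- exists c => //; apply: ae_in1 Hc => x _; apply: le_trans.
  by rewrite -[(w N - _) x]/(w N x - posB 0 (- phi) x) gerBl posB_ge0.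
- have -> : w N - posB 0 (- phi) - phi = w N - posB 0 phi.
    by rewrite {2}(posB_decomposition phi) opprB addrA subrK.
  exact: HN.
Qed.

Lemma direction_bound : exists2 C : R, 0 < C &
  forall v z, H10 Omega v -> H10 Omega z -> b v z ^+ 2 <= C * (dirichlet v v * dirichlet z z).
Proof.
have [C C0 HC] := energy_bound dO bd; exists C; first exact: C0.
by move=> v z hv hz; exact: (HC v z (H10_H1 hv) (H10_H1 hz)).
Qed.

Lemma direction_linr v : H10 Omega v -> linear_on (H10 Omega) (b v).
Proof. by move=> /H10_H1 hv c y z /H10_H1 hy /H10_H1 hz; exact: (energy_linr dO bd hv c hy hz). Qed.

Lemma direction_linl v : H10 Omega v -> linear_on (H10 Omega) (b^~ v).
Proof. by move=> /H10_H1 hv c y z /H10_H1 hy /H10_H1 hz; exact: (energy_linl dO bd hv c hy hz). Qed.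

Lemma linearized_exists : exists w, cone w /\
  forall phi, cone phi -> 0 <= a w (phi - w) + b u (phi - w).
Proof.
have [C C0 HC] := direction_bound.
pose F v := - b u v; have lF : linear_on (H10 Omega) F.
  move=> c v z hv hz; by rewrite /F (direction_linr hu c hv hz) opprD mulrN.
have FM v : H10 Omega v -> F v ^+ 2 <= (C * dirichlet u u * qmin^-1) * a v v.
  move=> hv; rewrite /F sqrrN; apply: le_trans (HC u v hu hv) _.
  rewrite mulrA -[leRHS]mulrA; apply: ler_wpM2l.
    by rewrite mulr_ge0 ?(si_pos dF hu)// ltW.
  exact: (dirichlet_le_energy dO qmin0 Qq hv).
have cc : convex_on cone.
  by move=> s v z s0 s1 cv cz; apply: coneZD => //; rewrite subr_ge0.
have cl : form_closed (H10 Omega) a cone.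
  move=> w v cw hv cv; apply: (cone_closed cw hv).
  exact: (energy_cvg_dirichlet dO qmin0 Qq (fun n => cone_H10 (cw n)) hv cv).
have [w cw Hw] := variational_inequality eF cone_H10 (ex_intro _ 0 cone0) cc lF FM
  (energy_complete dO qmin0 Qq) cl.
exists w; split=> // phi cphi; have := Hw phi cphi; rewrite /F.
by move: (a w _) (b u _) => x y h; lra.
Qed.

(** * Convergence of the difference quotients to the linearized solution *)

Section convergence.
Context (w : E -> R) (cw : cone w) (Hw : forall phi, cone phi -> 0 <= a w (phi - w) + b u (phi - w)).
Let hw : H10 Omega w := cone_H10 cw.
Let ell y := a w y + b u y.

Let ell_lin : linear_on (H10 Omega) ell.
Proof.
move=> c v z hv hz; rewrite /ell (linear_formr eF hw c hv hz) (direction_linr hu c hv hz).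
by rewrite mulrDr addrACA.
Qed.

(** The cone contains [0] and [w + w], so that [ell (- w)] and [ell w] are both nonnegative. *)
Lemma ell_w : ell w = 0.
Proof.
have h1 := Hw cone0; have := Hw (coneZD ler01 ler01 cw cw); rewrite !scale1r addrK -/(ell w) => h2.
rewrite sub0r -/(ell (- w)) (linN sV ell_lin hw) oppr_ge0 in h1.
by apply/eqP; rewrite eq_le h1 h2.
Qed.

Lemma ell_ge0 phi : cone phi -> 0 <= ell phi.
Proof.
move=> cphi; have := Hw cphi; rewrite -/(ell _) (linB sV ell_lin (cone_H10 cphi) hw) ell_w.
by rewrite subr0.
Qed.

Lemma ell_bound : exists C : R, forall y, H10 Omega y -> ell y ^+ 2 <= C * dirichlet y y.
Proof.
have [C C0 HC] := direction_bound; have [C' C0' HC'] := energy_le dO qmin0 Qq.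
exists (2 * (a w w * C') + 2 * (C * dirichlet u u)) => y hy.
have h1 := form_CS eF hw hy; have h2 := HC u y hu hy; have h3 := HC' y hy.
have h4 : a w y ^+ 2 <= a w w * C' * dirichlet y y.
  by apply: le_trans h1 _; rewrite -mulrA ler_wpM2l// (si_pos eF hw).
rewrite mulrA in h2.
have h5 : ell y ^+ 2 <= 2 * a w y ^+ 2 + 2 * b u y ^+ 2.
  rewrite /ell; have := sqr_ge0 (a w y - b u y); move: (a w y) (b u y) => s t.
  by rewrite sqrrB sqrrD => ?; lra.
move: h4 h2 h5; move: (ell y ^+ 2) (a w y ^+ 2) (b u y ^+ 2) (a w w) (dirichlet u u) (dirichlet y y).
by move=> x1 x2 x3 x4 x5 x6 *; lra.
Qed.

Let ut t := solution_map Omega f psi (q + t *: d).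
Let delta t := t^-1 *: (ut t - u).

Section quotient.
Context (t : R) (t0 : 0 < t) (t1 : t <= 1).
Let Qt : Qad Omega qmin qmax (q + t *: d) := Qad_segment dO Qq Qqd (ltW t0) t1.
Let hut : H10 Omega (ut t) := solution_in dO sf qmin0 psi0 Qt.
Let utpsi := solution_le dO sf qmin0 psi0 Qt.

Lemma delta_H10 : H10 Omega (delta t).
Proof. exact: (subZ sV _ (subB sV hut hu)). Qed.
Let hd := delta_H10.

(** Since [t c <= 1], the function [u + t phi] is feasible and can be compared with
    [ut t = u + t delta t]. After division by [t], the terms with [f] and [a u] combine to
    [- (lam, delta t)] because [(lam, phi) = 0]; all other terms carry a factor [t]. *)
Lemma delta_vi phi (c : R) : orth Omega lam phi -> 0 <= c -> t * c <= 1 ->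
  ae_in Omega (fun x => phi x <= c * (psi - u x)) ->
  - ip lam (delta t) <= t * (a (delta t) (phi - delta t) + b u (phi - delta t)
    + t * b (delta t) (phi - delta t)).
Proof.
move=> [hphi lphi] c0 tc phic; set y := phi - delta t.
have hy : H10 Omega y := subB sV hphi hd.
have utE : ut t = t *: delta t + u.
  by rewrite /delta scalerA divff ?gt_eqF// scale1r subrK.
have Kv : obstacle_set Omega psi (u + t *: phi).
  split; first exact: (subD sV hu (subZ sV t hphi)).
  apply: ae_in2 phic upsi => x _ h1 h2; rewrite -[(u + _) x]/(u x + t * phi x).
  have h3 : t * phi x <= t * c * (psi - u x) by rewrite -mulrA ler_pM2l.
  have h4 : t * c * (psi - u x) <= psi - u x by rewrite ler_piMl// subr_ge0.
  by rewrite addrC -lerBrDr (le_trans h3).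
have vE : u + t *: phi - ut t = t *: y.
  by rewrite utE (addrC (t *: delta t)) opprD addrACA subrr add0r scalerBr.
have := solution_vi dO sf qmin0 psi0 Qt Kv; rewrite -/(ut t) vE.
have hu1 := H10_H1 hu; have hy1 := H10_H1 hy; have hd1 := H10_H1 hd.
have hty := subZ sV t hy.
rewrite (addrC q) (energy_coefZD dO _ bd bq (H10_H1 hut) (H10_H1 hty)) utE.
rewrite (linZ sV (ip_linear dO sf) t hy).
rewrite (direction_linl hty t hd hu) (linear_forml eF hty t hd hu).
rewrite !(linZ sV (direction_linr _) t hy)// !(linZ sV (linear_formr eF _) t hy)// => h.
have h2 := lamE hy; rewrite -/lam -/u in h2.
have sd := H1_sq dO (H10_H1 hd); have sphi := H1_sq dO (H10_H1 hphi).
have h3 : ip lam y = - ip lam (delta t).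
  by rewrite (linB ss (linear_formr sF slam) sphi sd) orth_ip ?sub0r.
rewrite -h3 h2; rewrite -(ler_pM2l t0); move: h.
move: (ip f y) (b (delta t) y) (b u y) (a (delta t) y) (a u y).
by move=> i1 i2 i3 i4 i5 h; lra.
Qed.

(** By complementarity [lam (ut - u) = - lam (psi - ut)]. *)
Lemma lam_delta_le0 : ae_in Omega (fun x => lam x * delta t x <= 0).
Proof.
apply: ae_in3 utpsi lam0 lam_compl => x _ h1 h2 h3.
rewrite -[delta t x]/(t^-1 * (ut t x - u x)) mulrCA pmulr_rle0 ?invr_gt0//.
have -> : ut t x - u x = (psi - u x) - (psi - ut t x) by rewrite opprB [RHS]addrC subrKA.
rewrite mulrBr h3 sub0r oppr_le0; apply: mulr_ge0; [exact: h2|rewrite subr_ge0; exact: h1].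
Qed.

Lemma ip_lam_delta_le0 : ip lam (delta t) <= 0.
Proof.
have sd := H1_sq dO (H10_H1 hd).
rewrite -oppr_ge0 -(linN ss (linear_formr sF slam) sd).
apply: (ip_ge0 dO slam.1 (subN ss sd).1); apply: ae_in1 lam_delta_le0 => x _ h.
by rewrite -[(- delta t) x]/(- delta t x) mulrN oppr_ge0.
Qed.

(** On the contact set the representatives satisfy [ut <= psi = u] q.e. *)
Lemma rep_delta : qe (fun x => rep u x = psi -> rep (delta t) x <= 0).
Proof.
have [qu ru] := qc_repP dO hut.
have q1 : qe (fun x => rep (ut t) x <= psi).
  apply: (qc_le dO qu (qcont_continuous dO (@cst_continuous _ _ psi))).
  by apply: ae_in2 ru utpsi => x _ ->.
have dE : delta t = t^-1 *: ut t + (- t^-1) *: u by rewrite /delta scalerBr scaleNr.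
have r1 := repZD dO t^-1 hut (subZ sV (- t^-1) hu); rewrite -dE in r1.
have r2 := repZD dO (- t^-1) hu (sub0 sV); rewrite addr0 in r2.
apply: (qe2 dO _ q1 (qe2 dO (fun x _ h1 h2 => conj h1 h2) r1
  (qe2 dO (fun x _ h1 h2 => conj h1 h2) r2 (rep_test dO (test0 Omega))))).
have ti : 0 < t^-1 by rewrite invr_gt0.
move=> x _ h1 [e1 [e2 e3]] hx; rewrite e1 e2 e3 hx; exact: scaled_sub_le0 ti h1.
Qed.

(** [delta_vi] with [phi = 0] and [c = 0]. The coercivity of the perturbed coefficient [q + t *: d]
    is used, which takes care of the term [t * b (delta t) (delta t)] of unknown sign. *)
Lemma delta_energy : - ip lam (delta t) + t * (qmin * dirichlet (delta t) (delta t)) <=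
  t * - b u (delta t).
Proof.
have o0 := sub0 (orth_subspace dO lam).
have := delta_vi o0 (lexx 0); rewrite mulr0 ler01 => /(_ isT).
have h0 : ae_in Omega (fun x => (0 : E -> R) x <= 0 * (psi - u x)).
  by apply: ae_inW => x _; rewrite mul0r.
move=> /(_ h0); rewrite sub0r (linN sV (linear_formr eF hd) hd).
rewrite (linN sV (direction_linr hu) hd) (linN sV (direction_linr hd) hd).
have := energy_coercive dO qmin0 Qt (H10_H1 hd).
rewrite (addrC q) (energy_coefZD dO _ bd bq (H10_H1 hd) (H10_H1 hd)) => h1 h2.
have h3 := ler_wpM2l (ltW t0) h1; move: h2 h3.
move: (ip lam _) (b (delta t) _) (b u _) (a (delta t) _) (dirichlet _ _).
by move=> i1 i2 i3 i4 i5 h2 h3; lra.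
Qed.

End quotient.

Lemma delta_bounds : exists B M : R, [/\ 0 <= B, 0 <= M &
  forall t, 0 < t -> t <= 1 -> dirichlet (delta t) (delta t) <= B /\ - ip lam (delta t) <= t * M].
Proof.
have [C C0 HC] := direction_bound; have du := si_pos dF hu.
(* From [qmin D <= - b u (delta t)] and [b u (delta t) ^+ 2 <= C * dirichlet u u * D], with [D] the
   Dirichlet energy of [delta t]. *)
pose B := C * dirichlet u u / qmin ^+ 2; have q2 : 0 < qmin ^+ 2 by rewrite exprn_gt0.
have B0 : 0 <= B by rewrite divr_ge0 ?(ltW q2)// mulr_ge0// ltW.
have P0 : 0 <= C * (dirichlet u u * B) by rewrite mulr_ge0 ?(ltW C0)// mulr_ge0.
exists B, (Num.sqrt (C * (dirichlet u u * B))); split; [exact: B0|exact: sqrtr_ge0|].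
move=> t t0 t1; have hd := delta_H10 t0 t1; have D0 := si_pos dF hd.
have h1 := delta_energy t0 t1; have h2 := ip_lam_delta_le0 t0 t1; have h3 := HC u (delta t) hu hd.
have h4 : qmin * dirichlet (delta t) (delta t) <= - b u (delta t).
  by rewrite -(ler_pM2l t0); move: h1 h2; move: (ip _ _) (b _ _) (dirichlet _ _) => x y z k1 k2; lra.
have h5 : (qmin * dirichlet (delta t) (delta t)) ^+ 2 <= C * (dirichlet u u * dirichlet (delta t) (delta t)).
  have q0 := mulr_ge0 (ltW qmin0) D0.
  apply: le_trans h3; rewrite -[leRHS]sqrrN; apply: lerXn2r; rewrite ?nnegrE; last exact: h4.
    exact: q0.
  exact: le_trans q0 h4.
have hB : dirichlet (delta t) (delta t) <= B.
  have [->|D1] := eqVneq (dirichlet (delta t) (delta t)) 0; first exact: B0.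
  have Dp : 0 < dirichlet (delta t) (delta t) by rewrite lt_def D1.
  rewrite ler_pdivlMr// -(ler_pM2r Dp); move: h5; rewrite exprMn expr2.
  by move: (dirichlet _ _) (dirichlet _ _) (qmin ^+ 2) => x y z k; lra.
split=> //; apply: (@le_trans _ _ (t * - b u (delta t))).
  apply: le_trans h1; rewrite lerDl mulr_ge0 ?(ltW t0)//.
  by rewrite mulr_ge0// ltW.
rewrite ler_pM2l//; apply: le_trans (ler_norm _) _; rewrite normrN -sqrtr_sqr ler_sqrt//.
apply: le_trans h3 _; rewrite ler_wpM2l ?(ltW C0)// ler_wpM2l//.
Qed.

(* Otherwise the nested convex sets of the directions satisfying the constraints
   of the difference quotients up to [M / n.+1] and [ell <= - e] would have a
   common limit, which lies in the cone. *)
Lemma ell_delta (e : R) : 0 < e -> exists2 t0 : R, 0 < t0 &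
  forall t, 0 < t -> t < t0 -> t <= 1 -> - e < ell (delta t).
Proof.
move=> e0; apply: contrapT => H.
have [B [M [B0 M0 HBM]]] := delta_bounds.
have /choice[tn Htn] n : exists t, [/\ 0 < t, t < n.+1%:R^-1, t <= 1 & ell (delta t) <= - e].
  apply: contrapT => nt; apply: H; exists n.+1%:R^-1; first by rewrite invr_gt0.
  move=> t t0 tn t1; rewrite ltNge; apply/negP => h; apply: nt; exists t; split=> //.
pose K n := [set v | [/\ H10 Omega v, ae_in Omega (fun x => lam x * v x <= 0),
  - ip lam v <= M * n.+1%:R^-1, qe (fun x => rep u x = psi -> rep v x <= 0) & ell v <= - e]].
have KV n : K n `<=` H10 Omega by move=> v [].
have KS n : K n.+1 `<=` K n.
  move=> v [h1 h2 h3 h4 h5]; split=> //; apply: le_trans h3 _.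
  by rewrite ler_wpM2l// lef_pV2 ?posrE// ler_nat.
have Kc n : convex_on (K n).
  move=> s v z s0 s1 [h1 h2 h3 h4 h5] [k1 k2 k3 k4 k5].
  have s1' : 0 <= 1 - s by rewrite subr_ge0.
  have sv := H1_sq dO (H10_H1 h1); have sz := H1_sq dO (H10_H1 k1).
  split.
  - exact: (sub_conv sV).
  - apply: ae_in2 h2 k2 => x _ l1 l2; rewrite -[(_ + _) x]/(s * v x + (1 - s) * z x).
    rewrite mulrDr !(mulrCA (lam x)).
    by rewrite -[leRHS](addr0 0) lerD// mulr_ge0_le0.
  - rewrite (linD (linear_formr sF slam) (subZ ss s sv) (subZ ss (1 - s) sz)).
    rewrite (linZ ss (linear_formr sF slam) s sv) (linZ ss (linear_formr sF slam) (1 - s) sz).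
    have := ler_wpM2l s0 h3; have := ler_wpM2l s1' k3.
    by move: (ip _ _) (ip _ _) (M * _) => x y z' l1 l2; lra.
  - have r1 := repZD dO s h1 (subZ sV (1 - s) k1).
    have r2 := repZD dO (1 - s) k1 (sub0 sV); rewrite addr0 in r2.
    have r3 := qe2 dO (fun x _ h1 h2 => conj h1 h2) r2 (rep_test dO (test0 Omega)).
    have r4 := qe2 dO (fun x _ h1 h2 => conj h1 h2) h4 k4.
    apply: (qe2 dO _ r1 (qe2 dO (fun x _ h1 h2 => conj h1 h2) r3 r4)).
    move=> x _ -> [[-> ->] [l1 l2]] hx; rewrite addr0.
    by rewrite -[leRHS](addr0 0) lerD// mulr_ge0_le0// ?l1// l2.
  - rewrite (linD ell_lin (subZ sV s h1) (subZ sV (1 - s) k1)).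
    rewrite (linZ sV ell_lin s h1) (linZ sV ell_lin (1 - s) k1).
    have := ler_wpM2l s0 h5; have := ler_wpM2l s1' k5.
    by move: (ell _) (ell _) => x y l1 l2; lra.
have Kn n : exists2 v, K n v & dirichlet v v <= B.
  have [t0 tlt t1 le] := Htn n; exists (delta (tn n)); last by case: (HBM _ t0 t1).
  split; [exact: delta_H10 t0 t1|exact: lam_delta_le0| |exact: rep_delta|exact: le].
  have [_ h] := HBM _ t0 t1; apply: le_trans h _.
  by rewrite mulrC ler_wpM2l// ltW.
have [v Kv cv] := nested_convex_cauchy dF KV KS Kc Kn.
have hv n : H10 Omega (v n) by case: (Kv n).
have [y hy cy] := H10_dirichlet_complete dO hv cv.
have [Ml [_ HMl]] := ip_bounded dO slam.
have sy := H1_sq dO (H10_H1 hy).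
have c1 := bounded_linear_cvg dF (ip_linear dO slam) HMl hv hy cy.
have [Ce HCe] := ell_bound.
have c2 := bounded_linear_cvg dF ell_lin HCe hv hy cy.
have ly : ell y <= - e.
  by apply: (ler_cvg_to c2 (cvg_cst (- e))); apply: nearW => n; case: (Kv n).
have ipy : 0 <= ip lam y.
  have c3 : - (M * n.+1%:R^-1) @[n --> \oo] --> - (M * 0).
    by apply: cvgN; apply: cvgM; [exact: cvg_cst|exact: cvg_harmonic].
  rewrite mulr0 oppr0 in c3.
  by apply: (ler_cvg_to c3 c1); apply: nearW => n; case: (Kv n) => _ _ h _ _; rewrite lerNl.
have lam_y : ae_in Omega (fun x => lam x * y x <= 0).
  have [s sn cs] := dirichlet_cvg_ae dO hv hy cy.
  have h : ae_in Omega (fun x => forall n, lam x * v n x <= 0).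
    by apply: ae_in_forall => n; case: (Kv n).
  apply: ae_in2 h cs => x _ hx cx.
  have c3 : lam x * v (s n) x @[n --> \oo] --> lam x * y x by apply: cvgM => //; exact: cvg_cst.
  by apply: (ler_cvg_to c3 (cvg_cst 0)); apply: nearW => n; exact: hx.
have cone_y : cone y.
  split; last first.
    by apply: (qe_le_closed dO hv hy cy) => n; case: (Kv n).
  split=> //; have sNy := subN ss sy.
  (* A function [lam y <= 0] with nonnegative integral vanishes a.e., which puts [y] in [orth]. *)
  have h : \int[mu]_(x in Omega) (lam x * (- y) x) <= 0.
    by rewrite -ip_def (linN ss (linear_formr sF slam) sy) oppr_le0.
  have := Rintegral0_ae mO (sqint_mul mO slam sNy) _ h.
  have h2 : ae_in Omega (fun x => 0 <= lam x * (- y) x).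
    by apply: ae_in1 lam_y => x _ l; rewrite -[(- y) x]/(- y x) mulrN oppr_ge0.
  move=> /(_ h2); apply: ae_in1 => x _; rewrite -[(- y) x]/(- y x) mulrN => /eqP.
  by rewrite oppr_eq0 => /eqP.
have := ell_ge0 cone_y; move: ly e0; move: (ell y) => x *; lra.
Qed.

Lemma delta_cvg (e : R) : 0 < e -> exists2 t0 : R, 0 < t0 &
  forall t, 0 < t -> t < t0 -> dirichlet (delta t - w) (delta t - w) < e.
Proof.
(* Four error terms of size [r] bound [a (delta t - w) (delta t - w)], and coercivity divides by
   [qmin]. *)
move=> e0; pose r := qmin * e / 4; have r0 : 0 < r by rewrite divr_gt0// mulr_gt0.
have r2 : 0 < r ^+ 2 by rewrite exprn_gt0.
have [B [M [B0 _ HBM]]] := delta_bounds.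
have [C C0 HC] := direction_bound; have [C' C0' HC'] := energy_le dO qmin0 Qq.
have du := si_pos dF hu.
(* [Z] times the energy of [phi - w] bounds the squares of both [a (delta t) (phi - w)] and
   [b u (phi - w)], uniformly in [t]. *)
pose Z := C' * B * C' + C * dirichlet u u + 1.
have p1 : 0 <= C' * B * C' by rewrite !mulr_ge0// ltW.
have p2 : 0 <= C * dirichlet u u by rewrite mulr_ge0// ltW.
have Z0 : 0 < Z by move: p1 p2; rewrite /Z; move: (C' * B * C') (C * _) => *; lra.
have [phi [ophi [c c0 phic] phiw]] := cone_approx cw (divr_gt0 r2 Z0).
have hphi := ophi.1; have hpw := subB sV hphi hw.
(* A bound for the square of [b (delta t) (phi - delta t)] that depends on [phi] but not on [t]. *)
pose N := C * (B * (2 * dirichlet phi phi + 2 * B)) + 1.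
have N0 : 0 < N by rewrite ltr_wpDl// !mulr_ge0 ?addr_ge0 ?mulr_ge0 ?(si_pos dF hphi) ?(ltW C0).
have [t1 t10 Ht1] := ell_delta r0.
(* In order: admissibility of [q + t *: d], the lower bound on [ell (delta t)], feasibility
   [t * c <= 1], and smallness of the term with the factor [t]. *)
pose t2 := Num.min 1 (Num.min t1 (Num.min (c + 1)^-1 (r / Num.sqrt N))).
have c1 : 0 < c + 1 by rewrite ltr_wpDl.
have sN : 0 < Num.sqrt N by rewrite sqrtr_gt0.
exists t2; first by rewrite !lt_min ltr01 t10 invr_gt0 c1 divr_gt0.
move=> t t0; rewrite !lt_min => /and4P[tl1 tl2 tl3 tl4]; have tle := ltW tl1.
have hd := delta_H10 t0 tle; have hdw := subB sV hd hw; have hpd := subB sV hphi hd.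
have [DB _] := HBM t t0 tle; have D0 := si_pos dF hd.
have tc : t * c <= 1.
  apply: (@le_trans _ _ (t * (c + 1))); first by rewrite ler_pM2l// lerDl.
  by rewrite -ler_pdivlMr// mul1r ltW.
have V := delta_vi t0 tle ophi c0 tc phic.
have lle := ip_lam_delta_le0 t0 tle.
have V2 : 0 <= a (delta t) (phi - delta t) + b u (phi - delta t) + t * b (delta t) (phi - delta t).
  rewrite -(pmulr_rge0 _ t0); apply: le_trans V; by rewrite oppr_ge0.
have dpw := si_pos dF hpw.
have T1 : `|a (delta t) (phi - w)| < r.
  apply: (sqr_lt_norm r0); apply: le_lt_trans (form_CS eF hd hpw) _.
  apply: (@le_lt_trans _ _ (C' * B * (C' * dirichlet (phi - w) (phi - w)))).
    apply: ler_pM; [exact: (si_pos eF hd)|exact: (si_pos eF hpw)| |exact: HC'].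
    by apply: le_trans (HC' _ hd) _; rewrite ler_pM2l.
  rewrite mulrA; apply: le_lt_trans (_ : Z * dirichlet (phi - w) (phi - w) < _).
    by rewrite ler_wpM2r//; move: p1 p2; rewrite /Z; move: (C' * B * C') (C * _) => *; lra.
  by rewrite mulrC -ltr_pdivlMr.
have T2 : `|b u (phi - w)| < r.
  apply: (sqr_lt_norm r0); apply: le_lt_trans (HC _ _ hu hpw) _; rewrite mulrA.
  apply: le_lt_trans (_ : Z * dirichlet (phi - w) (phi - w) < _).
    by rewrite ler_wpM2r//; move: p1 p2; rewrite /Z; move: (C' * B * C') (C * _) => *; lra.
  by rewrite mulrC -ltr_pdivlMr.
have T3 : `|t * b (delta t) (phi - delta t)| < r.
  rewrite normrM (gtr0_norm t0); apply: (@le_lt_trans _ _ (t * Num.sqrt N)); last first.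
    by rewrite -ltr_pdivlMr.
  rewrite ler_pM2l// -sqrtr_sqr ler_sqrt ?(ltW N0)//; apply: le_trans (HC _ _ hd hpd) _.
  rewrite /N; apply: (@le_trans _ _ (C * (B * (2 * dirichlet phi phi + 2 * B)))); last by rewrite lerDl.
  rewrite ler_pM2l//; apply: ler_pM => //; first exact: (si_pos dF hpd).
  have := formD2_le dF hphi (subN sV hd); rewrite (formN2 dF hd) => /le_trans; apply.
  by rewrite lerD2l ler_pM2l.
have T4 := Ht1 t t0 tl2 tle.
(* Expand the square and bound [a (delta t) (delta t)] by [V2]; the terms left over are
   [a w w + b u w = ell w = 0]. *)
have main : a (delta t - w) (delta t - w) <= a (delta t) (phi - w) + b u (phi - w) +
    t * b (delta t) (phi - delta t) - ell (delta t).
  rewrite (formB2 eF hd hw) /ell.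
  have e1 : a (delta t) (phi - delta t) = a (delta t) phi - a (delta t) (delta t).
    exact: (linB sV (linear_formr eF hd) hphi hd).
  have e2 : b u (phi - delta t) = b u phi - b u (delta t).
    exact: (linB sV (direction_linr hu) hphi hd).
  have e3 : a (delta t) (phi - w) = a (delta t) phi - a (delta t) w.
    exact: (linB sV (linear_formr eF hd) hphi hw).
  have e4 : b u (phi - w) = b u phi - b u w.
    exact: (linB sV (direction_linr hu) hphi hw).
  have e5 : a w w + b u w = 0 := ell_w.
  rewrite e1 e2 in V2; rewrite e3 e4 (si_sym eF hw hd).
  move: V2 e5; move: (a (delta t) phi) (a (delta t) (delta t)) (b u phi) (b u (delta t)) (a (delta t) w)
    (b u w) (a w w) (t * _) => x1 x2 x3 x4 x5 x6 x7 x8 l1 l2; lra.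
have co := energy_coercive dO qmin0 Qq (H10_H1 hdw).
rewrite -(ltr_pM2l qmin0); apply: le_lt_trans co _; apply: le_lt_trans main _.
have -> : qmin * e = r + r + r + r by rewrite /r; field.
have := ler_norm (a (delta t) (phi - w)); have := ler_norm (b u (phi - w)).
have := ler_norm (t * b (delta t) (phi - delta t)); move: T1 T2 T3 T4.
move: (a _ _) (b u _) (t * _) (ell _) => x1 x2 x3 x4.
by move: (`|x1|) (`|x2|) (`|x3|) => y1 y2 y3 l1 l2 l3 l4 l5 l6 l7; lra.
Qed.

Lemma dir_derivative : is_dir_derivative Omega f psi q d w.
Proof.
split; first exact: hw.
have [C C0 HC] := sobolev_le_dirichlet dO.
apply/cvgrPdist_lt => e e0; have e2 : 0 < e ^+ 2 by rewrite exprn_gt0.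
have [t0 t00 Ht] := delta_cvg (divr_gt0 e2 C0).
near=> t.
have tp : 0 < t by near: t; exact: nbhs_right_gt.
have tl : t < t0 by near: t; exact: nbhs_right_lt.
have t1 : t <= 1 by near: t; exact: nbhs_right_le.
have hdw := subB sV (delta_H10 tp t1) hw.
rewrite sub0r normrN H1_normE ger0_norm ?sqrtr_ge0//.
rewrite -[ltRHS](ger0_norm (ltW e0)) -sqrtr_sqr ltr_sqrt//.
by apply: le_lt_trans (HC _ hdw) _; rewrite mulrC -ltr_pdivlMr//; exact: Ht.
Unshelve. all: by end_near. Qed.
End convergence.

Lemma linearized_solutionP w : linearized_solution Omega f psi q d w <->
  cone w /\ forall phi, cone phi -> 0 <= a w (phi - w) + b u (phi - w).
Proof.
have E y phi : (div_pairing Omega d u phi <= diffusion_form Omega q y phi) =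
    (0 <= a y phi + b u phi).
  by rewrite /div_pairing !energy.unlock -subr_ge0 opprK.
split=> [[/critical_coneP cw Hw]|[cw Hw]]; split.
- exact: cw.
- by move=> phi /critical_coneP cphi; rewrite -E; exact: Hw.
- exact/critical_coneP.
- by move=> phi /critical_coneP cphi; rewrite -/u E; exact: Hw.
Qed.

Lemma linearized_unique w w' : linearized_solution Omega f psi q d w ->
  linearized_solution Omega f psi q d w' -> ae_in Omega (fun x => w' x = w x).
Proof.
move=> /linearized_solutionP[cw Hw] /linearized_solutionP[cw' Hw'].
have hw := cone_H10 cw; have hw' := cone_H10 cw'; have hd := subB sV hw' hw.
apply: (H10_ae_unique dO hw' hw).
have h1 := Hw _ cw'; have h2 := Hw' _ cw.
have e1 : w - w' = - (w' - w) by rewrite opprB.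
rewrite e1 (linN sV (linear_formr eF hw') hd) (linN sV (direction_linr hu) hd) in h2.
have h3 : a (w' - w) (w' - w) <= 0.
  rewrite (linB sV (linear_forml eF hd) hw' hw); move: h1 h2.
  by move: (a w' _) (a w _) (b u _) => x y z *; lra.
apply: le_trans (dirichlet_le_energy dO qmin0 Qq hd) _.
by rewrite pmulr_rle0 ?invr_gt0.
Qed.

End derivative.

Theorem theorem3p2 (R : realType) (m : nat) (m_lt3 : (m < 3)%N)
  (Omega : set 'rV[R]_m.+1) (f : 'rV[R]_m.+1 -> R) (qmin qmax psi : R)
  (domain_Omega : bounded_domain Omega) (regular_Omega : groger_regular Omega)
  (L2_f : L2 Omega f) (qmin_gt0 : 0 < qmin) (qmin_lt_qmax : qmin < qmax)
  (psi_gt0 : 0 < psi)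
  (q : 'rV[R]_m.+1 -> 'M[R]_m.+1) (Qad_q : Qad Omega qmin qmax q)
  (d : 'rV[R]_m.+1 -> 'M[R]_m.+1) (Q_d : Qspace Omega d)
  (Qad_qd : Qad Omega qmin qmax (q + d)) :
  exists u' : 'rV[R]_m.+1 -> R,
    [/\ is_dir_derivative Omega f psi q d u',
        linearized_solution Omega f psi q d u'
      & forall w, linearized_solution Omega f psi q d w ->
          ae_in Omega (fun x => w x = u' x)].
Proof.
have [_ oO _ bO] := domain_Omega; have dO : bounded_open Omega by split.
have sf := iffLR (L2P dO f) L2_f.
have [w [cw Hw]] := linearized_exists dO sf qmin_gt0 psi_gt0 Qad_q Qad_qd.
have lw := iffRL (linearized_solutionP dO sf qmin_gt0 psi_gt0 d Qad_q w) (conj cw Hw).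
exists w; split.
- exact (dir_derivative dO sf qmin_gt0 psi_gt0 Qad_q Qad_qd cw Hw).
- exact: lw.
- by move=> z lz; exact (linearized_unique dO sf qmin_gt0 psi_gt0 Qad_q Qad_qd lw lz).
Qed.
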